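(* Let $\mathbf{m}\in\mathcal{M}$, $\mathbf{g}\in G$ and $\boldsymbol{\lambda}\in\Lambda$. Let $s^{\varphi_{\mathbf{m}}}_{\boldsymbol{\lambda}^{\mathbf{g}}}$ be the Schur element of $\mathcal{H}_{\mathbf{m}}$ associated to the irreducible representation $\rho^{\mathbf{m}}_{\boldsymbol{\lambda}^{\mathbf{g}}}$, and let $s^{\varphi_{\mathbf{g}.\mathbf{m}}}_{\boldsymbol{\lambda}}$ be the Schur element of $\mathcal{H}_{\mathbf{g}.\mathbf{m}}$ associated to $\rho^{\mathbf{g}.\mathbf{m}}_{\boldsymbol{\lambda}}$. Then $$s^{\varphi_{\mathbf{m}}}_{\boldsymbol{\lambda}^{\mathbf{g}}}=s^{\varphi_{\mathbf{g}.\mathbf{m}}}_{\boldsymbol{\lambda}}.$$ In particular, $a^{\varphi_{\mathbf{m}}}_{\boldsymbol{\lambda}^{\mathbf{g}}}=a^{\varphi_{\mathbf{g}.\mathbf{m}}}_{\boldsymbol{\lambda}}$.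
   Context: **Group and generic Hecke algebra.** Let $K$ be a finite abelian extension of $\mathbb{Q}$ with ring of integers $\mathbb{Z}_K$ and group of roots of unity $\mu(K)$; $\zeta_d:=\exp(2\pi i/d)$. Let $V$ be a finite dimensional $K$-vector space and $W\subset \mathrm{GL}(V)$ a finite group generated by pseudo-reflections and acting irreducibly on $V$. Let $\mathcal{A}$ be the set of reflecting hyperplanes, $V^{\mathrm{reg}}=V-\bigcup_{H\in\mathcal{A}}H$ (after extending scalars to $\mathbb{C}$), $x_0\in V^{\mathrm{reg}}$, $B=\Pi_1(V^{\mathrm{reg}}/W,x_0)$ the braid group. For an orbit $\mathcal{C}\in\mathcal{A}/W$, let $\mathbf{S}_{\mathcal{C}}$ be the set of monodromy generators around the images in $V^{\mathrm{reg}}/W$ of the elements of $\mathcal{C}$, and $e_{\mathcal{C}}$ the common order of the pointwise stabilizers $W_H$, $H\in\mathcal{C}$. Let $\mathbf{u}=(u_{\mathcal{C},j})_{\mathcal{C}\in\mathcal{A}/W,\,0\le j\le e_{\mathcal{C}}-1}$ be indeterminates. The generic Hecke algebra $\mathcal{H}(W)$ is the quotient of $\mathbb{Z}[\mathbf{u},\mathbf{u}^{-1}]B$ by the ideal generated by the elements $(\mathbf{s}-u_{\mathcal{C},0})\cdots(\mathbf{s}-u_{\mathcal{C},e_{\mathcal{C}}-1})$, for $\mathcal{C}\in\mathcal{A}/W$, $\mathbf{s}\in\mathbf{S}_{\mathcal{C}}$. **Standing assumptions.** $\mathcal{H}(W)$ is a free $\mathbb{Z}[\mathbf{u},\mathbf{u}^{-1}]$-module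 of rank $|W|$, and there is a unique symmetrizing form $t$ on $\mathcal{H}(W)$ (a linear form with $t(hh')=t(h'h)$ and $(h,h')\mapsto t(hh')$ non-degenerate) such that (i) under $u_{\mathcal{C},j}\mapsto\zeta_{e_{\mathcal{C}}}^j$ it becomes the canonical form $w\mapsto\delta_{w,1}$ of the group algebra of $W$; (ii) for all $b\in B$, $t(b^{-1})^{*}=t(b\pi)/t(\pi)$, where $*$ is the automorphism $u_{\mathcal{C},j}\mapsto u_{\mathcal{C},j}^{-1}$ and $\pi$ is the central element of $B$ given by the loop $s\mapsto \exp(2\pi i s)x_0$, $0\le s\le1$. Let $\mathbf{v}=(v_{\mathcal{C},j})$ be indeterminates with $v_{\mathcal{C},j}^{|\mu(K)|}=\zeta_{e_{\mathcal{C}}}^{-j}u_{\mathcal{C},j}$; then $K(\mathbf{v})\mathcal{H}(W)$ is split semisimple (known). **Cyclotomic Hecke algebras.** Let $q$ be an indeterminate and $y^{|\mu(K)|}=q$. Let $\mathcal{M}=\prod_{\mathcal{C}\in\mathcal{A}/W}\mathbb{Z}^{e_{\mathcal{C}}}$. For $\mathbf{m}=(m_{\mathcal{C},j})\in\mathcal{M}$, the cyclotomic specialization $\varphi_{\mathbf{m}}:\mathbb{Z}_K[\mathbf{v},\mathbf{v}^{-1}]\to\mathbb{Z}_K[y,y^{-1}]$ is the $\mathbb{Z}_K$-algebra morphism $v_{\mathcal{C},j}\mapsto y^{m_{\mathcal{C},j}}$, i.e. $u_{\mathcal{C},j}\mapsto\zeta_{e_{\mathcal{C}}}^jq^{m_{\mathcal{C},j}}$.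 The cyclotomic Hecke algebra $\mathcal{H}_{\mathbf{m}}$ is the $\mathbb{Z}_K[q,q^{-1}]$-algebra obtained by specializing $\mathcal{H}(W)$ via $\varphi_{\mathbf{m}}$, with symmetrizing form $t_{\varphi_{\mathbf{m}}}$ the specialization of $t$. The algebra $K(y)\mathcal{H}_{\mathbf{m}}$ is split semisimple (known). Fix an indexing set $\Lambda$ with $\mathrm{Irr}(W)=\{V^{\boldsymbol{\lambda}}\mid\boldsymbol{\lambda}\in\Lambda\}$; by Tits' deformation theorem the specialization $v_{\mathcal{C},j}\mapsto1$ (thus $y\mapsto 1$) induces bijections $\mathrm{Irr}(K(\mathbf{v})\mathcal{H}(W))\leftrightarrow\mathrm{Irr}(K(y)\mathcal{H}_{\mathbf{m}})\leftrightarrow\mathrm{Irr}(W)$, and one writes $\mathrm{Irr}(K(y)\mathcal{H}_{\mathbf{m}})=\{V^{\boldsymbol{\lambda}}_{\varphi_{\mathbf{m}}}\mid\boldsymbol{\lambda}\in\Lambda\}$; $\rho^{\mathbf{m}}_{\boldsymbol{\lambda}}$ is the representation afforded by $V^{\boldsymbol{\lambda}}_{\varphi_{\mathbf{m}}}$. **Schur elements and $a$-function.** The Schur elements $s^{\varphi_{\mathbf{m}}}_{\boldsymbol{\lambda}}\in\mathbb{Z}_K[y,y^{-1}]$ are defined by $t_{\varphi_{\mathbf{m}}}=\sum_{\boldsymbol{\lambda}\in\Lambda}\frac{1}{s^{\varphi_{\mathbf{m}}}_{\boldsymbol{\lambda}}}\chi_{\boldsymbol{\lambda}}$, $\chi_{\boldsymbol{\lambda}}$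 the character of $V^{\boldsymbol{\lambda}}_{\varphi_{\mathbf{m}}}$. For a Laurent polynomial $P(y)$, $\mathrm{val}_y(P)$ is its order at $0$, and $\mathrm{val}_q(P)=\mathrm{val}_y(P)/|\mu(K)|$. Set $a^{\varphi_{\mathbf{m}}}_{\boldsymbol{\lambda}}:=-\mathrm{val}_q(s^{\varphi_{\mathbf{m}}}_{\boldsymbol{\lambda}})$. **Action of $G$.** Let $G=\prod_{\mathcal{C}\in\mathcal{A}/W}\mathbb{Z}/e_{\mathcal{C}}\mathbb{Z}$ act on $\mathcal{M}$ by cyclic permutation: $(\mathbf{g}.\mathbf{m})_{\mathcal{C},j}=m_{\mathcal{C},j+g_{\mathcal{C}}}$ (second subscripts modulo $e_{\mathcal{C}}$). For $\mathbf{g}=(g_{\mathcal{C}})\in G$ there is an algebra isomorphism $\Gamma^{\mathbf{g}}:\mathcal{H}_{\mathbf{m}}\to\mathcal{H}_{\mathbf{g}.\mathbf{m}}$ sending the image of each $\mathbf{s}\in\mathbf{S}_{\mathcal{C}}$ in $\mathcal{H}_{\mathbf{m}}$ to $\zeta_{e_{\mathcal{C}}}^{g_{\mathcal{C}}}$ times the image of $\mathbf{s}$ in $\mathcal{H}_{\mathbf{g}.\mathbf{m}}$. For $\boldsymbol{\lambda}\in\Lambda$, $\boldsymbol{\lambda}^{\mathbf{g}}$ is the element of $\Lambda$ such that $\rho^{\mathbf{g}.\mathbf{m}}_{\boldsymbol{\lambda}}\circ\Gamma^{\mathbf{g}}$ is afforded by $V^{\boldsymbol{\lambda}^{\mathbf{g}}}_{\varphi_{\mathbf{m}}}$;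 this gives a well-defined action of $G$ on $\Lambda$, independent of $\mathbf{m}$. *)

(* Defs.v *)
From HB Require Import structures.
From mathcomp Require Import all_boot all_order all_algebra all_fingroup.
From mathcomp Require Import all_character all_field finmap monalg.
From mathcomp Require Import all_classical all_reals all_analysis.
From mathcomp Require Import generic_quotient fraction complex.
From mathcomp Require Import ring lra.

Set Implicit Arguments.
Unset Strict Implicit.
Unset Printing Implicit Defensive.

Import Order.TTheory GRing.Theory Num.Theory.
Import numFieldNormedType.Exports.

Local Open Scope classical_set_scope.
Local Open Scope ring_scope.
Local Open Scope quotient_scope.

(* The monoid algebra A[M]; `<< a *g x >>' is the element a x.                *)
Definition monalg (A : comNzRingType) (M : monoidType) : Type := {malg A[M]}.

Section MonoidAlgebra.
Variables (A : comNzRingType) (M : monoidType).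
Implicit Types g : monalg A M.

HB.instance Definition _ := GRing.Lmodule.on (monalg A M).

Definition monalg_of (x : M) : monalg A M := << 1 *g x >>.
Definition monalg_one : monalg A M := monalg_of 1%g.
Definition monalg_mul g1 g2 : monalg A M :=
  \sum_(x <- msupp g1) \sum_(y <- msupp g2) << g1@_x * g2@_y *g (x * y)%g >>.

Let mulw (d1 d2 : {fset M}) g1 g2 :
  (msupp g1 `<=` d1)%fset -> (msupp g2 `<=` d2)%fset ->
  monalg_mul g1 g2 =
    \sum_(x <- d1) \sum_(y <- d2) << g1@_x * g2@_y *g (x * y)%g >>.
Proof.
move=> le1 le2; rewrite /monalg_mul (big_fset_incl _ le1) /=.
  apply/eq_bigr=> x _; apply/big_fset_incl => // y _ /mcoeff_outdom ->.
  by rewrite mulr0 monalgU0.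
move=> x _ /mcoeff_outdom g1x.
by rewrite big1 => // y _; rewrite g1x mul0r monalgU0.
Qed.

Let mulUU a b x y :
  monalg_mul << a *g x >> << b *g y >> = << a * b *g (x * y)%g >>.
Proof. by rewrite (mulw msuppU_le msuppU_le) !big_seq_fset1 !mcoeffUU. Qed.

Let mulDl : left_distributive monalg_mul +%R.
Proof.
move=> g1 g2 g.
rewrite (mulw (msuppD_le _ _) (fsubset_refl _)).
rewrite (mulw (fsubsetUl _ (msupp g2)) (fsubset_refl _)).
rewrite (mulw (fsubsetUr (msupp g1) _) (fsubset_refl _)).
rewrite -big_split /=; apply/eq_bigr=> x _.
rewrite -big_split /=; apply/eq_bigr=> y _.
by rewrite mcoeffD mulrDl monalgUD.
Qed.

Let mulDr : right_distributive monalg_mul +%R.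
Proof.
move=> g g1 g2.
rewrite (mulw (fsubset_refl _) (msuppD_le _ _)).
rewrite (mulw (fsubset_refl _) (fsubsetUl _ (msupp g2))).
rewrite (mulw (fsubset_refl _) (fsubsetUr (msupp g1) _)).
rewrite -big_split /=; apply/eq_bigr=> x _.
rewrite -big_split /=; apply/eq_bigr=> y _.
by rewrite mcoeffD mulrDr monalgUD.
Qed.

Let mul0 : left_zero 0 monalg_mul.
Proof. by move=> g; rewrite /monalg_mul msupp0 big_seq_fset0. Qed.

Let mulg0 : right_zero 0 monalg_mul.
Proof.
by move=> g; rewrite /monalg_mul big1 // => x _; rewrite msupp0 big_seq_fset0.
Qed.

Let mul_suml I r (F : I -> monalg A M) g :
  monalg_mul (\sum_(i <- r) F i) g = \sum_(i <- r) monalg_mul (F i) g.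
Proof.
exact: (big_morph (monalg_mul^~ g) (fun _ _ => mulDl _ _ _) (mul0 _)).
Qed.

Let mul_sumr I r (F : I -> monalg A M) g :
  monalg_mul g (\sum_(i <- r) F i) = \sum_(i <- r) monalg_mul g (F i).
Proof.
exact: (big_morph (monalg_mul g) (fun _ _ => mulDr _ _ _) (mulg0 _)).
Qed.

Let mulA : associative monalg_mul.
Proof.
move=> g1 g2 g3; rewrite (monalgE g1) (monalgE g2) (monalgE g3).
move: monalg_mul mul_suml mul_sumr mulUU => m ml mr mU.
rewrite !ml; apply: eq_bigr => x _; rewrite [LHS]mr [X in _ = m X _]mr ml.
apply: eq_bigr => y _; rewrite !mr; apply: eq_bigr => z _.
by rewrite !mU mulrA mulgA.
Qed.

Let mul1 : left_id monalg_one monalg_mul.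
Proof.
move=> g; rewrite [in LHS](monalgE g) mul_sumr [RHS]monalgE.
by apply/eq_bigr => x _; rewrite mulUU mul1r mul1g.
Qed.

Let mulg1' : right_id monalg_one monalg_mul.
Proof.
move=> g; rewrite [in LHS](monalgE g) mul_suml [RHS]monalgE.
by apply/eq_bigr => x _; rewrite mulUU mulr1 mulg1.
Qed.

Let one_neq0 : monalg_one != 0.
Proof.
by apply/eqP => /malgP /(_ 1%g) /eqP; rewrite mcoeffUU mcoeff0 oner_eq0.
Qed.

HB.instance Definition _ := GRing.Zmodule_isNzRing.Build (monalg A M)
  mulA mul1 mulg1' mulDl mulDr one_neq0.

Lemma monalgUM (a b : A) (x y : M) :
  (<< a *g x >> : monalg A M) * << b *g y >> = << a * b *g (x * y)%g >>.
Proof. exact: mulUU. Qed.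

Let scaleE (c : A) (g : monalg A M) :
  c *: g = \sum_(x <- msupp g) << c * g@_x *g x >>.
Proof. by []. Qed.

Let scale_mull (c : A) (g : monalg A M) :
  (<< c *g 1%g >> : monalg A M) * g = c *: g.
Proof.
rewrite [in LHS](monalgE g) mulr_sumr scaleE; apply: eq_bigr => x _.
by rewrite monalgUM mul1g.
Qed.

Let scale_mulr (c : A) (g : monalg A M) :
  g * (<< c *g 1%g >> : monalg A M) = c *: g.
Proof.
rewrite [in LHS](monalgE g) mulr_suml scaleE; apply: eq_bigr => x _.
by rewrite monalgUM mulg1 mulrC.
Qed.

Let scalemAl (a : A) (g1 g2 : monalg A M) : a *: (g1 * g2) = (a *: g1) * g2.
Proof. by rewrite -!scale_mull mulrA. Qed.

Let scalemAr (a : A) (g1 g2 : monalg A M) : a *: (g1 * g2) = g1 * (a *: g2).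
Proof. by rewrite -!scale_mulr mulrA. Qed.

HB.instance Definition _ :=
  GRing.Lmodule_isLalgebra.Build A (monalg A M) scalemAl.
HB.instance Definition _ :=
  GRing.Lalgebra_isAlgebra.Build A (monalg A M) scalemAr.

End MonoidAlgebra.

(* The quotient of an A-algebra E by the two-sided ideal generated by S.      *)
Section QuotientAlgebra.
Variables (A : comNzRingType) (E : algType A) (S : set E).

Definition ideal_gen : set E := [set z | exists n (x s y : 'I_n -> E),
  (forall i, S (s i)) /\ z = \sum_(i < n) x i * s i * y i].

Let ideal0 : ideal_gen 0.
Proof.
by exists 0, (fun=> 0), (fun=> 0), (fun=> 0); split=> [[]|] //; rewrite big_ord0.
Qed.

Let idealD x y : ideal_gen x -> ideal_gen y -> ideal_gen (x + y).
Proof.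
move=> [m [a [s [b [Ss ->]]]]] [n [a' [s' [b' [Ss' ->]]]]].
pose c (f : 'I_m -> E) (g : 'I_n -> E) i :=
  match fintype.split i with inl j => f j | inr j => g j end.
exists (m + n)%N, (c a a'), (c s s'), (c b b'); split.
  by move=> i; rewrite /c; case: fintype.split.
rewrite big_split_ord /=; congr (_ + _); apply: eq_bigr => i _; rewrite /c.
  by rewrite (unsplitK (inl i)).
by rewrite (unsplitK (inr i)).
Qed.

Let idealMl z x : ideal_gen x -> ideal_gen (z * x).
Proof.
move=> [n [a [s [b [Ss ->]]]]]; exists n, (fun i => z * a i), s, b; split => //.
by rewrite mulr_sumr; apply: eq_bigr => i _; rewrite !mulrA.
Qed.

Let idealMr z x : ideal_gen x -> ideal_gen (x * z).
Proof.
move=> [n [a [s [b [Ss ->]]]]]; exists n, a, s, (fun i => b i * z); split => //.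
by rewrite mulr_suml; apply: eq_bigr => i _; rewrite !mulrA.
Qed.

Let idealZ a x : ideal_gen x -> ideal_gen (a *: x).
Proof. by move=> /(idealMl a%:A); rewrite -scalerAl mul1r. Qed.

Let idealN x : ideal_gen x -> ideal_gen (- x).
Proof. by move=> /(idealZ (-1)); rewrite scaleN1r. Qed.

Let cong : rel E := fun x y => `[< ideal_gen (x - y) >].

Let cong_equiv : equiv_class_of cong.
Proof.
split.
- by move=> x; apply/asboolP; rewrite subrr.
- by move=> x y; apply/asboolP/asboolP => /idealN; rewrite opprB.
- move=> y x z /asboolP xy /asboolP yz; apply/asboolP.
  by rewrite -(subrKA y); apply: idealD.
Qed.

Canonical quot_equiv := EquivRelPack cong_equiv.

Definition quot_alg : Type := {eq_quot quot_equiv}.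
HB.instance Definition _ := Choice.on quot_alg.
HB.instance Definition _ := EqQuotient.on quot_alg.

Definition quot_proj (x : E) : quot_alg := \pi_quot_alg x.

Lemma quot_projP x y : quot_proj x = quot_proj y <-> ideal_gen (x - y).
Proof.
split=> [/eqP|xy]; first by rewrite eqmodE => /asboolP.
by apply/eqP; rewrite eqmodE; apply/asboolP.
Qed.

Let projE (q : quot_alg) : quot_proj (repr q) = q.
Proof. exact: reprK. Qed.

Lemma quot_projW (P : quot_alg -> Prop) :
  (forall x, P (quot_proj x)) -> forall q, P q.
Proof. by move=> h q; rewrite -(projE q). Qed.

Let qzero := quot_proj 0.
Let qone := quot_proj 1.
Let qopp (q : quot_alg) := quot_proj (- repr q).
Let qadd (q r : quot_alg) := quot_proj (repr q + repr r).
Let qmul (q r : quot_alg) := quot_proj (repr q * repr r).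
Let qscale a (q : quot_alg) := quot_proj (a *: repr q).

Let reprP x : ideal_gen (repr (quot_proj x) - x).
Proof. exact/quot_projP/projE. Qed.

Let qaddE x y : qadd (quot_proj x) (quot_proj y) = quot_proj (x + y).
Proof. by apply/quot_projP; rewrite opprD addrACA; apply: idealD. Qed.

Let qoppE x : qopp (quot_proj x) = quot_proj (- x).
Proof. by apply/quot_projP; rewrite -opprD; apply: idealN. Qed.

Let qscaleE a x : qscale a (quot_proj x) = quot_proj (a *: x).
Proof. by apply/quot_projP; rewrite -scalerBr; apply: idealZ. Qed.

Let qmulE x y : qmul (quot_proj x) (quot_proj y) = quot_proj (x * y).
Proof.
apply/quot_projP; set x' := repr _; set y' := repr _.
have -> : x' * y' - x * y = (x' - x) * y' + x * (y' - y).
  by rewrite mulrBl mulrBr addrA subrK.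
by apply: idealD; [apply: idealMr|apply: idealMl]; apply: reprP.
Qed.

Let qE := (qaddE, qoppE, qmulE, qscaleE).

Ltac by_repr := repeat (let q := fresh in intro q; revert q;
    refine (@quot_projW _ _); intro);
  rewrite /qzero /qone ?qE;
  congr quot_proj.

Let qaddA : associative qadd. Proof. by by_repr; rewrite addrA. Qed.
Let qaddC : commutative qadd. Proof. by by_repr; rewrite addrC. Qed.
Let qadd0 : left_id qzero qadd. Proof. by by_repr; rewrite add0r. Qed.
Let qaddN : left_inverse qzero qopp qadd. Proof. by by_repr; rewrite addNr. Qed.
HB.instance Definition _ :=
  GRing.isZmodule.Build quot_alg qaddA qaddC qadd0 qaddN.

Let qmulA : associative qmul. Proof. by by_repr; rewrite mulrA. Qed.
Let qmul1 : left_id qone qmul. Proof. by by_repr; rewrite mul1r. Qed.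
Let qmulg1 : right_id qone qmul. Proof. by by_repr; rewrite mulr1. Qed.
Let qmulDl : left_distributive qmul qadd.
Proof. by by_repr; rewrite mulrDl. Qed.
Let qmulDr : right_distributive qmul qadd.
Proof. by by_repr; rewrite mulrDr. Qed.
HB.instance Definition _ :=
  GRing.Zmodule_isPzRing.Build quot_alg qmulA qmul1 qmulg1 qmulDl qmulDr.

Let qscaleA a b q : qscale a (qscale b q) = qscale (a * b) q.
Proof. by move: q; by_repr; rewrite scalerA. Qed.
Let qscale1 : left_id 1 qscale. Proof. by by_repr; rewrite scale1r. Qed.
Let qscaleDr : right_distributive qscale qadd.
Proof. by move=> a; by_repr; rewrite scalerDr. Qed.
Let qscaleDl q a b : qscale (a + b) q = qadd (qscale a q) (qscale b q).
Proof. by move: q; by_repr; rewrite scalerDl. Qed.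
HB.instance Definition _ := GRing.Zmodule_isLmodule.Build A quot_alg
  qscaleA qscale1 qscaleDr qscaleDl.

Lemma quot_projD x y : quot_proj (x + y) = quot_proj x + quot_proj y.
Proof. by rewrite -qaddE. Qed.
Lemma quot_projM x y : quot_proj (x * y) = quot_proj x * quot_proj y.
Proof. by rewrite -qmulE. Qed.
Lemma quot_proj1 : quot_proj 1 = 1. Proof. by []. Qed.
Lemma quot_projZ a x : quot_proj (a *: x) = a *: quot_proj x.
Proof. by rewrite -qscaleE. Qed.

End QuotientAlgebra.

(* Extension of scalars B (x)_A H along a ring morphism phi : A -> B, as the  *)
(* quotient of the B-algebra of the multiplicative monoid of H by the         *)
(* relations making h |-> 1 (x) h additive and phi-semilinear.                *)
Definition mulmonoid (H : Type) : Type := H.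

Section ScalarExtension.
Variables (A B : comNzRingType) (phi : A -> B) (E : algType A) (S : set E).
Local Notation H := (quot_alg S).

HB.instance Definition _ := Choice.on (mulmonoid H).
HB.instance Definition _ := isMonoid.Build (mulmonoid H)
  (@mulrA H) (@mul1r H) (@mulr1 H).

Let br (h : H) : monalg B (mulmonoid H) := monalg_of B (h : mulmonoid H).

Definition scalar_ext_rel : set (monalg B (mulmonoid H)) :=
  [set z | (exists h k : H, z = br (h + k) - br h - br k) \/
           (exists (a : A) (h : H), z = br (a *: h) - phi a *: br h)].

Definition tens1 (h : H) : quot_alg scalar_ext_rel := quot_proj _ (br h).

End ScalarExtension.
Notation scalar_ext phi S := (quot_alg (@scalar_ext_rel _ _ phi _ S)).

(* Paths are functions on R, of which only the restriction to [0, 1] matters. *)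
Section Paths.
Context {R : realType} {X : topologicalType}.
Implicit Types (a b c : X) (f g h : R -> X).

Definition is_path a b f :=
  [/\ {within `[0, 1], continuous f}, f 0 = a & f 1 = b].

(* first f, then g *)
Definition path_cat f g (t : R) : X :=
  if t <= 2^-1 then f (2 * t) else g (2 * t - 1).

Definition path_rev f (t : R) : X := f (1 - t).

Definition homotopic a b f g := exists F : R * R -> X,
  [/\ {within `[0, 1] `*` `[0, 1], continuous F},
      {in `[0, 1], forall t, F (0, t) = f t /\ F (1, t) = g t} &
      {in `[0, 1], forall s, F (s, 0) = a /\ F (s, 1) = b}].

End Paths.

Section PathTheory.
Implicit Types S T U : topologicalType.

Let within_comp S T U (A : set S) (B : set T) (g : S -> T) (f : T -> U) :
  {within A, continuous g} -> {within B, continuous f} ->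
  (forall x, A x -> B (g x)) -> {within A, continuous (f \o g)}.
Proof.
move=> /subspace_continuousP cg /subspace_continuousP cf AB.
apply/subspace_continuousP => x Ax V /(cf _ (AB _ Ax)) /(cg _ Ax) BV.
move: BV; rewrite /fmap /within /= /nbhs /=; apply: filterS => y /= yV Ay.
by apply: yV => //; apply: AB.
Qed.

Context {R : realType}.
Let I : set R := `[0, 1].
Let I2 : set (R * R) := I `*` I.

Let closed_I2 : closed I2.
Proof.
rewrite (_ : I2 = fst @^-1` I `&` snd @^-1` I) //.
by apply: closedI; apply: preimage_closed; rewrite /I;
  do ?exact: interval_closed; move=> x _; [exact: cvg_fst|exact: cvg_snd].
Qed.

Let within_if T U (D : set T) (c : T -> R) (F G : T -> U) :
  closed D -> continuous c ->
  {within D `&` [set x | c x <= 2^-1], continuous F} ->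
  {within D `&` [set x | 2^-1 <= c x], continuous G} ->
  (forall x, D x -> c x = 2^-1 -> F x = G x) ->
  {within D, continuous (fun x => if c x <= 2^-1 then F x else G x)}.
Proof.
move=> clD cc cF cG FG.
have -> : D = (D `&` [set x | c x <= 2^-1]) `|` (D `&` [set x | 2^-1 <= c x]).
  apply/seteqP; split=> [x Dx|x [] []//].
  by case: (leP (c x) 2^-1) => cx; [left|right]; split => //=; apply: ltW.
apply: withinU_continuous.
- apply: closedI => //; apply: (@preimage_closed _ _ c [set y | y <= 2^-1]).
    by move=> x _; apply: cc.
  exact: closed_le.
- apply: closedI => //; apply: (@preimage_closed _ _ c [set y | 2^-1 <= y]).
    by move=> x _; apply: cc.
  exact: closed_ge.
- apply: subspace_eq_continuous cF => x; rewrite inE => -[Dx /= cx] /=.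
  by rewrite /from_subspace /= cx.
- apply: subspace_eq_continuous cG => x; rewrite inE => -[Dx /= cx] /=.
  by rewrite /from_subspace /=; case: leP => // cx'; rewrite FG //; apply/eqP; rewrite eq_le cx cx'.
Qed.

Let pair_cont S T U (p : S -> T) (q : S -> U) :
  continuous p -> continuous q -> continuous (fun x => (p x, q x)).
Proof. by move=> cp cq x; exact: (cvg_pair (cp x) (cq x)). Qed.

Context {X : topologicalType}.
Implicit Types (a b c : X) (f g h : R -> X).

Let I01P (t : R) : I t -> 0 <= t <= 1.
Proof. by rewrite /I /= in_itv. Qed.

Let I01 (t : R) : 0 <= t <= 1 -> I t.
Proof. by rewrite /I /= in_itv. Qed.

Let inI01 (t : R) : t \in `[0, 1] = (0 <= t <= 1).
Proof. by rewrite in_itv. Qed.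

Let affine_cont (p q : R) : continuous (fun t : R => p * t + q).
Proof.
move=> t; apply: cvgD; last exact: cvg_cst.
by apply: cvgM; [exact: cvg_cst|exact: cvg_id].
Qed.

Lemma path_cst a : is_path a a (fun _ : R => a).
Proof. by split => //; apply: continuous_subspaceT => t; exact: cvg_cst. Qed.

Lemma path_revP a b f : is_path a b f -> is_path b a (path_rev f).
Proof.
move=> [cf f0 f1]; split; rewrite /path_rev ?subr0 ?subrr //.
apply: (within_comp (B := I)) cf _.
  apply: continuous_subspaceT => t; apply: cvgB; first exact: cvg_cst.
  exact: cvg_id.
by move=> t /I01P h; apply: I01; lra.
Qed.

Lemma path_catP a b c f g :
  is_path a b f -> is_path b c g -> is_path a c (path_cat f g).
Proof.
move=> [cf f0 f1] [cg g0 g1]; split; rewrite /path_cat.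
- apply: (@within_if _ _ I id).
  + exact: interval_closed.
  + by move=> t; exact: cvg_id.
  + apply: (within_comp (B := I)) cf _.
      apply: continuous_subspaceT => t.
      by apply: cvgM; [exact: cvg_cst|exact: cvg_id].
    by move=> t [] /I01P h /= h'; apply: I01; lra.
  + apply: (within_comp (B := I)) cg _.
      by apply: continuous_subspaceT; exact: affine_cont.
    by move=> t [] /I01P h /= h'; apply: I01; lra.
  + by move=> t _ ->; rewrite divff // subrr f1 g0.
- by rewrite invr_ge0 ler0n mulr0.
- by rewrite ifF ?mulr1; [rewrite -[X in X - 1]/(1 + 1) addrK|lra].
Qed.

Lemma homotopic_reparam a b f (p q : R -> R) :
  is_path a b f -> continuous p -> continuous q ->
  (forall t, 0 <= t <= 1 -> 0 <= p t <= 1) ->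
  (forall t, 0 <= t <= 1 -> 0 <= q t <= 1) ->
  p 0 = q 0 -> p 1 = q 1 ->
  homotopic (f (p 0)) (f (p 1)) (f \o p) (f \o q).
Proof.
move=> [cf _ _] cp cq Ip Iq pq0 pq1.
exists (fun st => f ((1 - st.1) * p st.2 + st.1 * q st.2)); split.
- apply: (within_comp (B := I)) cf _.
    apply: continuous_subspaceT => st; apply: cvgD; apply: cvgM.
    + by apply: cvgB; [exact: cvg_cst|exact: cvg_fst].
    + by apply: continuous_comp; [exact: cvg_snd|exact: cp].
    + exact: cvg_fst.
    + by apply: continuous_comp; [exact: cvg_snd|exact: cq].
  move=> [s t] [] /= /I01P /andP[s0 s1] /I01P /[dup] /Ip It /Iq It'.
  by apply: I01; nra.
- move=> t _ /=.
  by rewrite subr0 subrr !mul0r !mul1r addr0 add0r.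
- move=> s _ /=; rewrite -pq0 -pq1.
  by split; congr f; ring.
Qed.

Lemma homotopic_refl a b f : is_path a b f -> homotopic a b f f.
Proof.
move=> pf; case: (pf) => _ f0 f1.
have := @homotopic_reparam a b f id id pf.
by rewrite f0 f1; apply => // t; exact: cvg_id.
Qed.

Lemma homotopic_sym a b f g : homotopic a b f g -> homotopic a b g f.
Proof.
move=> [F [cF F01 Fab]]; exists (fun st => F (1 - st.1, st.2)); split.
- apply: (within_comp (B := I2)) cF _.
    apply: continuous_subspaceT; apply: pair_cont => st; last exact: cvg_snd.
    by apply: cvgB; [exact: cvg_cst|exact: cvg_fst].
  by move=> [s t] [] /= /I01P ? /I01P ?; split; apply: I01 => /=; lra.
- by move=> t /F01 [? ?]; rewrite /= subr0 subrr.
- by move=> s; rewrite inI01 => sI; apply: Fab; rewrite inI01 /=; lra.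
Qed.

Lemma homotopic_trans a b f g h :
  homotopic a b f g -> homotopic a b g h -> homotopic a b f h.
Proof.
move=> [F [cF F01 Fab]] [G [cG G01 Gab]].
exists (fun st => if st.1 <= 2^-1 then F (2 * st.1, st.2)
                  else G (2 * st.1 - 1, st.2)); split.
- apply: (@within_if _ _ I2 fst) => //.
  + by move=> t; exact: cvg_fst.
  + apply: (within_comp (B := I2)) cF _.
      apply: continuous_subspaceT; apply: pair_cont => st; last exact: cvg_snd.
      by apply: cvgM; [exact: cvg_cst|exact: cvg_fst].
    by move=> [s t] [] [] /= /I01P ? /I01P ? ?; split; apply: I01 => /=; lra.
  + apply: (within_comp (B := I2)) cG _.
      apply: continuous_subspaceT; apply: pair_cont => st; last exact: cvg_snd.
      apply: cvgB; last exact: cvg_cst.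
      by apply: cvgM; [exact: cvg_cst|exact: cvg_fst].
    by move=> [s t] [] [] /= /I01P ? /I01P ? ?; split; apply: I01 => /=; lra.
  + move=> [s t] [] /= /I01P _ /I01P; rewrite -inI01 => tI ->.
    by rewrite divff // subrr (F01 _ tI).2 (G01 _ tI).1.
- move=> t tI /=; rewrite mulr0 invr_ge0 ler0n (F01 _ tI).1; split => //.
  rewrite ifF; last by lra.
  by rewrite mulr1 -[X in X - 1]/(1 + 1) addrK (G01 _ tI).2.
- move=> s; rewrite inI01 => sI /=; case: leP => sh.
    by apply: Fab; rewrite inI01 /=; lra.
  by apply: Gab; rewrite inI01 /=; lra.
Qed.

Lemma homotopic_cat a b c f f' g g' :
  homotopic a b f f' -> homotopic b c g g' ->
  homotopic a c (path_cat f g) (path_cat f' g').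
Proof.
move=> [F [cF F01 Fab]] [G [cG G01 Gab]].
exists (fun st => if st.2 <= 2^-1 then F (st.1, 2 * st.2)
                  else G (st.1, 2 * st.2 - 1)); split.
- apply: (@within_if _ _ I2 snd) => //.
  + by move=> t; exact: cvg_snd.
  + apply: (within_comp (B := I2)) cF _.
      apply: continuous_subspaceT; apply: pair_cont => st; first exact: cvg_fst.
      by apply: cvgM; [exact: cvg_cst|exact: cvg_snd].
    by move=> [s t] [] [] /= /I01P ? /I01P ? ?; split; apply: I01 => /=; lra.
  + apply: (within_comp (B := I2)) cG _.
      apply: continuous_subspaceT; apply: pair_cont => st; first exact: cvg_fst.
      apply: cvgB; last exact: cvg_cst.
      by apply: cvgM; [exact: cvg_cst|exact: cvg_snd].
    by move=> [s t] [] [] /= /I01P ? /I01P ? ?; split; apply: I01 => /=; lra.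
  + move=> [s t] [] /= /I01P; rewrite -inI01 => sI _ ->.
    by rewrite divff // subrr (Fab _ sI).2 (Gab _ sI).1.
- move=> t; rewrite inI01 => tI /=; rewrite /path_cat; case: leP => th.
    by apply: F01; rewrite inI01 /=; lra.
  by apply: G01; rewrite inI01 /=; lra.
- move=> s sI /=; rewrite mulr0 invr_ge0 ler0n (Fab _ sI).1; split => //.
  rewrite ifF; last by lra.
  by rewrite mulr1 -[X in X - 1]/(1 + 1) addrK (Gab _ sI).2.
Qed.

Let minc (p q : R -> R) : continuous p -> continuous q ->
  continuous (fun t => Num.min (p t) (q t)).
Proof. by move=> cp cq t; exact: (continuous_min (cp t) (cq t)). Qed.

Let maxc (p q : R -> R) : continuous p -> continuous q ->
  continuous (fun t => Num.max (p t) (q t)).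
Proof. by move=> cp cq t; exact: (continuous_max (cp t) (cq t)). Qed.

Let idc : continuous (id : R -> R). Proof. by move=> t; exact: cvg_id. Qed.
Let cstc (r : R) : continuous (fun _ : R => r).
Proof. by move=> t; exact: cvg_cst. Qed.

Ltac minmax_lra := do ?case: ifPn; intros; lra.

Lemma homotopic_catA a b c d f g h :
  is_path a b f -> is_path b c g -> is_path c d h ->
  homotopic a d (path_cat (path_cat f g) h) (path_cat f (path_cat g h)).
Proof.
move=> pf pg ph; have pfgh := path_catP pf (path_catP pg ph).
pose p (t : R) := Num.min (2 * t + 0) (Num.min (1 * t + 4^-1) (2^-1 * t + 2^-1)).
have -> : path_cat (path_cat f g) h = path_cat f (path_cat g h) \o p.
  apply/funext => t; rewrite /path_cat /p /=.
  case: (leP t 2^-1) => t2; last first.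
    rewrite (_ : Num.min _ _ = 2^-1 * t + 2^-1); last by rewrite ?minEle ?maxEle; minmax_lra.
    rewrite ifF; last by lra.
    by rewrite ifF; [congr h; field|lra].
  case: (leP (2 * t) 2^-1) => t4.
    rewrite (_ : Num.min _ _ = 2 * t); last by rewrite ?minEle ?maxEle; minmax_lra.
    by rewrite ifT //; lra.
  rewrite (_ : Num.min _ _ = t + 4^-1); last by rewrite ?minEle ?maxEle; minmax_lra.
  rewrite ifF; last by lra.
  by rewrite ifT; [congr g; field|lra].
have p0 : p 0 = 0 by rewrite /p ?minEle ?maxEle; minmax_lra.
have p1 : p 1 = 1 by rewrite /p ?minEle ?maxEle; minmax_lra.
have [_ h0 h1] := pfgh.
have := @homotopic_reparam a d _ p id pfgh; rewrite p0 p1 h0 h1; apply => //.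
- by apply: minc; [|apply: minc]; exact: affine_cont.
- by move=> t ?; rewrite /p ?minEle ?maxEle; minmax_lra.
Qed.

Lemma homotopic_cst_cat a b f : is_path a b f ->
  homotopic a b (path_cat (fun=> a) f) f.
Proof.
move=> pf; have [_ f0 f1] := pf.
pose p (t : R) := Num.max 0 (2 * t + -1).
have -> : path_cat (fun=> a) f = f \o p.
  apply/funext => t; rewrite /path_cat /p /=; case: leP => th.
    by rewrite (_ : Num.max _ _ = 0) ?f0 //; rewrite maxEle; minmax_lra.
  by congr f; rewrite ?minEle ?maxEle; minmax_lra.
have p0 : p 0 = 0 by rewrite /p ?minEle ?maxEle; minmax_lra.
have p1 : p 1 = 1 by rewrite /p ?minEle ?maxEle; minmax_lra.
have := @homotopic_reparam a b _ p id pf; rewrite p0 p1 f0 f1; apply => //.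
- by apply: maxc; [exact: cstc|exact: affine_cont].
- by move=> t ?; rewrite /p ?minEle ?maxEle; minmax_lra.
Qed.

Lemma homotopic_cat_cst a b f : is_path a b f ->
  homotopic a b (path_cat f (fun=> b)) f.
Proof.
move=> pf; have [_ f0 f1] := pf.
pose p (t : R) := Num.min 1 (2 * t + 0).
have -> : path_cat f (fun=> b) = f \o p.
  apply/funext => t; rewrite /path_cat /p /=; case: leP => th.
    by congr f; rewrite ?minEle ?maxEle; minmax_lra.
  by rewrite (_ : Num.min _ _ = 1) ?f1 //; rewrite minEle; minmax_lra.
have p0 : p 0 = 0 by rewrite /p ?minEle ?maxEle; minmax_lra.
have p1 : p 1 = 1 by rewrite /p ?minEle ?maxEle; minmax_lra.
have := @homotopic_reparam a b _ p id pf; rewrite p0 p1 f0 f1; apply => //.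
- by apply: minc; [exact: cstc|exact: affine_cont].
- by move=> t ?; rewrite /p ?minEle ?maxEle; minmax_lra.
Qed.

Lemma homotopic_cat_rev a b f : is_path a b f ->
  homotopic a a (path_cat f (path_rev f)) (fun=> a).
Proof.
move=> pf; have [_ f0 f1] := pf.
pose p (t : R) := Num.min (2 * t + 0) (-2 * t + 2).
have -> : path_cat f (path_rev f) = f \o p.
  apply/funext => t; rewrite /path_cat /path_rev /p /=.
  by case: leP => th; congr f; rewrite ?minEle ?maxEle; minmax_lra.
have p0 : p 0 = 0 by rewrite /p ?minEle ?maxEle; minmax_lra.
have p1 : p 1 = 0 by rewrite /p ?minEle ?maxEle; minmax_lra.
have := @homotopic_reparam a b _ p (fun=> 0) pf; rewrite p0 p1 /comp f0.
apply => //.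
- by apply: minc; exact: affine_cont.
- by move=> t ?; rewrite /p ?minEle ?maxEle; minmax_lra.
- by move=> t ?; lra.
Qed.

Lemma homotopic_rev a b f g :
  homotopic a b f g -> homotopic b a (path_rev f) (path_rev g).
Proof.
move=> [F [cF F01 Fab]]; exists (fun st => F (st.1, 1 - st.2)); split.
- apply: (within_comp (B := I2)) cF _.
    apply: continuous_subspaceT; apply: pair_cont => st; first exact: cvg_fst.
    by apply: cvgB; [exact: cvg_cst|exact: cvg_snd].
  by move=> [s t] [] /= /I01P ? /I01P ?; split; apply: I01 => /=; lra.
- by move=> t; rewrite inI01 => tI; apply: F01; rewrite inI01 /=; lra.
- by move=> s /Fab [? ?]; rewrite /= subr0 subrr.
Qed.

End PathTheory.

(* In Pi_1(X, x), the product p * q is the class of the loop running first    *)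
(* through q, then through p; with the right action of W used below, this     *)
(* makes the map from the braid group to W a morphism.                        *)
Section FundamentalGroup.
Variables (R : realType) (X : topologicalType) (x : X).

Definition loop : Type := {f : R -> X | `[< is_path x x f >]}.
HB.instance Definition _ := Choice.on loop.

Let loopP (f : loop) : is_path x x (val f). 
Proof. exact: asboolW (valP f). Qed.

Let mk_loop f (pf : is_path x x f) : loop := exist _ f (asboolT pf).

Let hrel : rel loop := fun f g => `[< homotopic x x (val f) (val g) >].

Let hrel_equiv : equiv_class_of hrel.
Proof.
split.
- by move=> f; apply/asboolP; exact: (homotopic_refl (loopP f)).
- by move=> f g; apply/asboolP/asboolP; exact: homotopic_sym.
- move=> g f h /asboolP fg /asboolP gh; apply/asboolP.
  exact: (homotopic_trans fg gh).
Qed.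

Canonical homotopic_equiv := EquivRelPack hrel_equiv.

Definition pi1 : Type := {eq_quot homotopic_equiv}.
HB.instance Definition _ := Choice.on pi1.
HB.instance Definition _ := EqQuotient.on pi1.

Let cst_loop : loop := mk_loop (path_cst x).

(* The class of a loop; functions which are not loops are sent to 1.          *)
Definition pi1_class (f : R -> X) : pi1 := \pi_pi1 (insubd cst_loop f).

Lemma pi1_classP f g : is_path x x f -> is_path x x g ->
  pi1_class f = pi1_class g <-> homotopic x x f g.
Proof.
move=> /asboolP pf /asboolP pg.
rewrite -(insubdK cst_loop pf) -(insubdK cst_loop pg).
rewrite /pi1_class !valKd; split => [/eqP|fg].
  by rewrite eqmodE => /asboolP.
by apply/eqP; rewrite eqmodE; apply/asboolP.
Qed.

Definition pi1_repr (p : pi1) : R -> X := val (repr p).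

Lemma pi1_reprP p : is_path x x (pi1_repr p).
Proof. exact: loopP. Qed.

Lemma pi1_reprK p : pi1_class (pi1_repr p) = p.
Proof. by rewrite /pi1_class valKd reprK. Qed.

Let reprh f : is_path x x f -> homotopic x x (pi1_repr (pi1_class f)) f.
Proof.
move=> pf; apply/pi1_classP => //; first exact: pi1_reprP.
by rewrite pi1_reprK.
Qed.

Definition pi1_one := pi1_class (fun=> x).
Definition pi1_mul p q := pi1_class (path_cat (pi1_repr q) (pi1_repr p)).
Definition pi1_inv p := pi1_class (path_rev (pi1_repr p)).

Lemma pi1_mulE f g : is_path x x f -> is_path x x g ->
  pi1_mul (pi1_class f) (pi1_class g) = pi1_class (path_cat g f).
Proof.
move=> pf pg; apply/pi1_classP; try exact: path_catP (pi1_reprP _) (pi1_reprP _).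
  exact: path_catP pg pf.
by apply: homotopic_cat; exact: reprh.
Qed.

Let rP := pi1_reprP.

Let mulA : associative pi1_mul.
Proof.
move=> p q r; rewrite -[p]pi1_reprK -[q]pi1_reprK -[r]pi1_reprK.
move: (rP p) (rP q) (rP r) => pf pg ph.
rewrite (pi1_mulE pg ph) (pi1_mulE pf pg) (pi1_mulE pf (path_catP ph pg)).
rewrite (pi1_mulE (path_catP pg pf) ph).
apply/pi1_classP; [by do ?apply: path_catP..|exact: homotopic_catA ph pg pf].
Qed.

Let mul1 : left_id pi1_one pi1_mul.
Proof.
move=> p; rewrite -[p]pi1_reprK (pi1_mulE (path_cst x) (rP p)).
apply/pi1_classP => //; last exact: homotopic_cat_cst (rP p).
exact: path_catP (rP p) (path_cst x).
Qed.

Let mul1r : right_id pi1_one pi1_mul.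
Proof.
move=> p; rewrite -[p]pi1_reprK (pi1_mulE (rP p) (path_cst x)).
apply/pi1_classP => //; last exact: homotopic_cst_cat (rP p).
exact: path_catP (path_cst x) (rP p).
Qed.

Let mulV : left_inverse pi1_one pi1_inv pi1_mul.
Proof.
move=> p; have pr := path_revP (rP p).
rewrite -[X in pi1_mul _ X]pi1_reprK (pi1_mulE pr (rP p)).
apply/pi1_classP; [exact: path_catP (rP p) pr|exact: path_cst|].
exact: homotopic_cat_rev (rP p).
Qed.

Let mulVr : right_inverse pi1_one pi1_inv pi1_mul.
Proof.
move=> p; have pr := path_revP (rP p).
rewrite -[X in pi1_mul X _]pi1_reprK (pi1_mulE (rP p) pr).
apply/pi1_classP; [exact: path_catP pr (rP p)|exact: path_cst|].
have := homotopic_cat_rev pr; congr homotopic; congr path_cat.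
by apply/funext => t; rewrite /path_rev subKr.
Qed.

HB.instance Definition _ := isGroup.Build pi1 mulA mul1 mul1r mulV mulVr.

End FundamentalGroup.

(* Laurent polynomials: the monoid algebra of the free abelian group Z^I,     *)
(* written multiplicatively.                                                  *)
Definition expo (I : finType) : Type := {ffun I -> int}.

Section Expo.
Variable I : finType.
HB.instance Definition _ := Choice.on (expo I).
Let mul (k l : expo I) : expo I := (k : {ffun I -> int}) + l.
Let one : expo I := 0 : {ffun I -> int}.
Let mulA : associative mul. Proof. exact: addrA. Qed.
Let mul1 : left_id one mul. Proof. exact: add0r. Qed.
Let mul1r : right_id one mul. Proof. exact: addr0. Qed.
HB.instance Definition _ := isMonoid.Build (expo I) mulA mul1 mul1r.
Lemma expo_mulC (k l : expo I) : (k * l)%g = (l * k)%g.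
Proof. exact: addrC. Qed.
End Expo.

Definition laurent (A : comNzRingType) (I : finType) : Type :=
  monalg A (expo I).

Section Laurent.
Variables (A : comNzRingType) (I : finType).

HB.instance Definition _ := GRing.Algebra.on (laurent A I).

Let mulC : commutative (@GRing.mul (laurent A I)).
Proof.
move=> f g; rewrite (monalgE f) (monalgE g) mulr_suml mulr_sumr.
apply: eq_bigr => k _; rewrite mulr_suml mulr_sumr; apply: eq_bigr => l _.
by rewrite !monalgUM mulrC expo_mulC.
Qed.

HB.instance Definition _ :=
  GRing.PzRing_hasCommutativeMul.Build (laurent A I) mulC.

Let unit : pred (laurent A I) := fun f => `[< exists g, g * f = 1 >].
Let inv (f : laurent A I) : laurent A I := xget f [set g | g * f = 1].

Let mulV : {in unit, left_inverse 1 inv *%R}.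
Proof.
by move=> f /asboolP fu; rewrite /inv; case: xgetP => // fN; case: fu => g /fN.
Qed.

Let unitP (f g : laurent A I) : g * f = 1 -> unit f.
Proof. by move=> gf; apply/asboolP; exists g. Qed.

Let inv_out : {in [predC unit], inv =1 id}.
Proof.
move=> f /asboolPn fu; rewrite /inv; case: xgetP => // g _ gf.
by case: fu; exists g.
Qed.

HB.instance Definition _ :=
  GRing.ComNzRing_hasMulInverse.Build (laurent A I) mulV unitP inv_out.

Definition lvar (i : I) : laurent A I :=
  << 1 *g ([ffun j => (j == i)%:Z] : expo I) >>.

(* The value of f at (x_i), the coefficients being sent to S through phi.     *)
Definition laurent_eval (S : comUnitRingType) (phi : A -> S) (x : I -> S)
    (f : laurent A I) : S :=
  \sum_(k <- msupp f) phi f@_k * \prod_i x i ^ (k : {ffun I -> int}) i.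

End Laurent.
Arguments lvar {A I} i.

Notation laurent1 A := (laurent A unit).

(* The order at 0 (the least exponent); 0 for the zero polynomial.            *)
Definition lord (A : comNzRingType) (f : laurent1 A) : int :=
  let s := [seq (k : {ffun unit -> int}) tt | k <- msupp f] in
  \big[Num.min/head 0 s]_(i <- s) i.

Section RingOfIntegers.
Variable K : fieldType.

Definition ZKpred : pred K := fun x => `[< integralOver (intr : int -> K) x >].

Let ZK_subring : subring_closed ZKpred.
Proof.
split=> [|x y /asboolP xi /asboolP yi|x y /asboolP xi /asboolP yi];
  apply/asboolP.
- exact: integral1.
- exact: integral_sub.
- exact: integral_mul.
Qed.

HB.instance Definition _ := GRing.isSubringClosed.Build K ZKpred ZK_subring.

Definition ZK : Type := {x : K | ZKpred x}.
HB.instance Definition _ := SubChoice.on ZK.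
HB.instance Definition _ := [SubChoice_isSubComNzRing of ZK by <:].

End RingOfIntegers.

Section AlgebraTheory.
Variables (A : comNzRingType) (E : algType A) (S : set E).
Local Notation H := (quot_alg S).

Definition free_of_rank (r : nat) :=
  exists b : 'I_r -> H, forall h, exists! c : {ffun 'I_r -> A},
    h = \sum_i c i *: b i.

(* Non-degeneracy is over A: h |-> t(h -) is bijective from H onto its dual.  *)
Definition symmetrizing (t : {scalar H}) :=
  (forall h k, t (h * k) = t (k * h)) /\
  (forall f : {scalar H}, exists! h, forall k, f k = t (h * k)).

Definition alg_morphism (E' : algType A) (S' : set E') (f : H -> quot_alg S') :=
  [/\ forall a h k, f (a *: h + k) = a *: f h + f k,
      forall h k, f (h * k) = f h * f k & f 1 = 1].

End AlgebraTheory.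

Section Representations.
Variables (F : fieldType) (E : algType F) (S : set E).
Local Notation H := (quot_alg S).

Definition alg_repr d (r : H -> 'M[F]_d) :=
  [/\ forall a h k, r (a *: h + k) = a *: r h + r k,
      forall h k, r (h * k) = r h *m r k & r 1 = 1%:M].

Definition alg_irr d (r : H -> 'M[F]_d) :=
  [/\ alg_repr r, (0 < d)%N &
      forall U : 'M[F]_d,
        (forall h, (U *m r h <= U)%MS) -> U != 0 -> row_full U].

Definition split_semisimple :=
  exists k (d : 'I_k -> nat) (r : forall i, H -> 'M[F]_(d i)),
    (forall i, (0 < d i)%N /\ alg_repr (r i)) /\
    (forall M : forall i, 'M[F]_(d i), exists! h, forall i, r i h = M i).

End Representations.

(* Equivalence of matrix representations, as in `mx_rsim'.                    *)
Definition repr_sim (F : fieldType) (T : Type) d1 d2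
    (r1 : T -> 'M[F]_d1) (r2 : T -> 'M[F]_d2) :=
  exists P : 'M[F]_(d1, d2),
    [/\ row_free P, row_full P & forall h, r1 h *m P = P *m r2 h].

HB.instance Definition _ (R : realType) := NormedModule.copy R[i] R[i]^o.

Definition expi (R : realType) (theta : R) : R[i] :=
  Complex (cos theta) (sin theta).

(* W acts on the right on the space V = K^n of row vectors, through rW. A     *)
(* hyperplane H is given by the canonical square matrix with row space H.     *)
Section ReflectionGroup.
Variables (K : fieldType) (gT : finGroupType) (W : {group gT}) (n : nat).
Variable rW : mx_representation K W n.

Definition is_refl (w : gT) : bool := \rank (rW w - 1%:M) == 1%N.

Definition arrangement : seq 'M[K]_n :=
  undup [seq <<kermx (rW w - 1%:M)>>%MS | w <- enum W & is_refl w].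

Definition hplane := seq_sub arrangement.
HB.instance Definition _ := Finite.on hplane.

Definition hmx (H : hplane) : 'M[K]_n := ssval H.

Definition hstab (H : hplane) : {set gT} :=
  [set w in W | hmx H *m rW w == hmx H].

Definition horbit_of (H : hplane) : {set hplane} :=
  [set H' | [exists w in W, hmx H' == <<hmx H *m rW w>>%MS]].

Definition horbit := {C : {set hplane} | [exists H, C == horbit_of H]}.
HB.instance Definition _ := Finite.on horbit.

(* e_C, as the maximum of the orders (all equal) of the W_H, H in C           *)
Definition horder (C : horbit) : nat := \max_(H in val C) #|hstab H|.

Definition paramidx := {C : horbit & 'I_(horder C)}.
HB.instance Definition _ := Finite.on paramidx.

Definition multiplicity := forall C : horbit, 'I_(horder C) -> int.

(* G, the elements of Z/eZ being represented in [0, e[                        *)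
Definition cyclic_prod := forall C : horbit, 'I_(horder C).

Definition ord_add e (j g : 'I_e) : 'I_e :=
  Ordinal (ltn_pmod (j + g) (leq_ltn_trans (leq0n j) (ltn_ord j))).

Definition cyclic_act (g : cyclic_prod) (m : multiplicity) : multiplicity :=
  fun C j => m C (ord_add j (g C)).

End ReflectionGroup.

Section BraidGroup.
Variables (R : realType) (K : fieldType) (iota : {rmorphism K -> R[i]}).
Variables (gT : finGroupType) (W : {group gT}) (n : nat).
Variable rW : mx_representation K W n.
Local Notation VC := 'rV[R[i]]_n.
Implicit Types (x : VC) (H : hplane rW).

Definition wact x (w : gT) : VC := x *m map_mx iota (rW w).

Definition on_hplane x H : bool := (x <= map_mx iota (hmx H))%MS.

Definition Vreg : set VC := [set x | forall H, ~~ on_hplane x H].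

Let wrel : rel Vreg := fun a b => [exists w in W, val b == wact (val a) w].

Let wrel_equiv : equiv_class_of wrel.
Proof.
have actM z v w : v \in W -> w \in W -> wact (wact z v) w = wact z (v * w)%g.
  by move=> vW wW; rewrite /wact -mulmxA -map_mxM -repr_mxM.
have act1 z : wact z 1%g = z by rewrite /wact repr_mx1 map_mx1 mulmx1.
have wrelV a b : wrel a b -> wrel b a.
  move=> /existsP[w /andP[wW /eqP e]]; apply/existsP; exists w^-1%g.
  by rewrite groupV wW e actM ?groupV // mulgV act1 eqxx.
split.
- by move=> a; apply/existsP; exists 1%g; rewrite group1 act1 eqxx.
- by move=> a b; apply/idP/idP; exact: wrelV.
- move=> b a c /existsP[v /andP[vW /eqP ev]] /existsP[w /andP[wW /eqP ew]].
  apply/existsP; exists (v * w)%g.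
  by rewrite groupM //= ew ev actM.
Qed.

Canonical wequiv := EquivRelPack wrel_equiv.

Definition VregW := quotient_topology {eq_quot wequiv}.
HB.instance Definition _ := Topological.on VregW.

Variable x0 : Vreg.

Definition braid_group : Type := pi1 R (\pi_VregW x0 : VregW).
HB.instance Definition _ := Group.on braid_group.

Definition Vreg_path (a b : VC) (f : R -> VC) :=
  is_path a b f /\ {in `[0, 1], forall t, Vreg (f t)}.

(* The class of the image in V^reg/W of a path in V^reg from x0 to W x0.      *)
Definition braid_of (f : R -> VC) : braid_group :=
  pi1_class _ (fun t => \pi_VregW (insubd x0 (f t)) : VregW).

Definition full_turn : braid_group :=
  braid_of (fun t => expi (2 * trigo.pi * t) *: val x0).

(* The projection onto H parallel to its W_H-stable complement.               *)
Definition hproj H x : VC :=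
  #|hstab H|%:R^-1 *: \sum_(w in hstab H) wact x w.

Definition partial_turn H x (t : R) : VC :=
  hproj H x + expi (2 * trigo.pi * t / #|hstab H|%:R) *: (x - hproj H x).

(* x is close to H and far from the other hyperplanes                         *)
Definition close_to H x := forall z : R[i], `|z| <= 1 ->
  forall H', H' != H -> ~~ on_hplane (hproj H x + z *: (x - hproj H x)) H'.

(* The generators s_(H, c) of the monodromy: follow c from x0 to a point x1   *)
(* close to H, turn from x1 to x1 s around H, where s is the generator of W_H *)
(* of determinant exp(2 i pi / e), and come back along the image of c by s.   *)
Definition monodromy (C : horbit rW) : set braid_group := [set b |
  exists H s x1 (c : R -> VC),
  [/\ H \in val C,
      s \in hstab H,
      iota (\det (rW s)) = expi (2 * trigo.pi / #|hstab H|%:R),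
      Vreg_path (val x0) x1 c /\ close_to H x1 &
      b = braid_of (path_cat c (path_cat (partial_turn H x1)
                                         (fun t => wact (path_rev c t) s)))]].

End BraidGroup.
Arguments braid_of {R K iota gT W n rW} x0 f.
Arguments full_turn {R K iota gT W n rW} x0.
Arguments monodromy {R K iota gT W n rW} x0 C _.

Section HeckeAlgebra.
Variables (R : realType) (K : fieldType) (iota : {rmorphism K -> R[i]}).
Variables (gT : finGroupType) (W : {group gT}) (n : nat).
Variables (rW : mx_representation K W n) (x0 : Vreg iota rW).
Local Notation B := (braid_group x0).
Local Notation horbit := (horbit rW).
Local Notation horder := (@horder K gT W n rW).
Local Notation paramidx := (paramidx rW).
Local Notation multiplicity := (multiplicity rW).
Implicit Types (C : horbit) (m : multiplicity).

Definition Zu := laurent int paramidx.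
HB.instance Definition _ := GRing.ComUnitRing.on Zu.
Definition uvar C (j : 'I_(horder C)) : Zu :=
  lvar (Tagged (fun C => 'I_(horder C)) j).

(* Also used for Z_K[y, y^-1].                                                *)
Local Notation ZKq := (laurent1 (ZK K)).
Local Notation Ky := {fraction {poly K}}.

(* The generic Hecke algebra H(W) is quot_alg hecke_rel.                      *)
Definition hecke_rel : set (monalg Zu B) := [set z | exists C s,
  monodromy x0 C s /\
  z = \prod_(j < horder C) (monalg_of Zu s - (uvar j)%:A)].
Local Notation hecke := (quot_alg hecke_rel).

Definition hecke_T (b : B) : hecke := quot_proj hecke_rel (monalg_of Zu b).

(* The element of Z_K with image exp(2 i pi / d), if any, and 0 otherwise;    *)
(* there is one for d = e_C, the determinant of a generator of some W_H.      *)
Definition zeta (d : nat) : ZK K :=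
  xget 0 [set z : ZK K | iota (val z) = expi (2 * trigo.pi / d%:R)].

(* u_(C, j) |-> zeta_(e_C)^j                                                  *)
Definition group_spec (f : Zu) : K :=
  laurent_eval intr
    (fun i : paramidx => val (zeta (horder (tag i)) ^+ tagged i)) f.

(* u_(C, j) |-> u_(C, j)^-1                                                   *)
Definition ustar (f : Zu) : Zu :=
  laurent_eval intr (fun i : paramidx => (lvar i : Zu)^-1) f.

(* The second clause says that t becomes w |-> delta_(w, 1) on the group      *)
(* algebra of W, a path c from x0 to x0 w giving an element of the braid group *)
(* with image w in W; the last two are t(b^-1)^* = t(b pi) / t(pi).           *)
Definition hecke_form (t : {scalar hecke}) :=
  [/\ symmetrizing t,
      (forall w (c : R -> 'rV[R[i]]_n), w \in W ->
         Vreg_path iota rW (val x0) (wact iota rW (val x0) w) c ->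
         group_spec (t (hecke_T (braid_of x0 c))) = (w == 1%g)%:R),
      t (hecke_T (full_turn x0)) != 0 &
      (forall b, ustar (t (hecke_T b^-1%g)) * t (hecke_T (full_turn x0)) =
                 t (hecke_T (b * full_turn x0)%g))].

(* u_(C, j) |-> zeta_(e_C)^j q^(m_(C, j))                                     *)
Definition cyclo_spec m (f : Zu) : ZKq :=
  laurent_eval intr (fun i : paramidx =>
    zeta (horder (tag i)) ^+ tagged i *: lvar tt ^ m (tag i) (tagged i)) f.

Definition cyclo_rel m := @scalar_ext_rel _ _ (cyclo_spec m) _ hecke_rel.
Local Notation cyclo m := (quot_alg (cyclo_rel m)).

Definition cyclo_of m (h : hecke) : cyclo m := tens1 (cyclo_spec m) h.

Definition mu_card : nat :=
  #|` fset_set [set z : K | exists2 k, (0 < k)%N & z ^+ k = 1]|%fset.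

Definition eval_y (f : ZKq) : Ky :=
  laurent_eval (fun a : ZK K => tofrac (val a)%:P) (fun=> tofrac 'X) f.

Definition eval_q (f : ZKq) : Ky :=
  laurent_eval (fun a : ZK K => tofrac (val a)%:P)
    (fun=> tofrac 'X ^+ mu_card) f.

Definition Kcyclo_rel m := @scalar_ext_rel _ _ eval_q _ (cyclo_rel m).
Arguments Kcyclo_rel m _ : clear implicits.
Local Notation Kcyclo m := (quot_alg (Kcyclo_rel m)).

Definition Kcyclo_of m (h : cyclo m) : Kcyclo m := tens1 eval_q h.

(* f in K(y) is defined at y = 1 with value c                                 *)
Definition value_at1 (f : Ky) (c : K) :=
  exists p r : {poly K},
    [/\ r.[1] != 0, f = tofrac p / tofrac r & c = p.[1] / r.[1]].

Definition irr_labelling (L : finType) (d : L -> nat)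
    (rho : forall l, mx_representation K W (d l)) :=
  [/\ forall l, mx_irreducible (rho l),
      forall l l', mx_rsim (rho l) (rho l') -> l = l' &
      forall d' (r : mx_representation K W d'), mx_irreducible r ->
        exists l, mx_rsim r (rho l)].

(* Irr(K(y) H_m) = {V^lambda_m}, with V^lambda_m mapping to V^lambda under    *)
(* the specialization y |-> 1, in which T_b becomes the image of b in W       *)
Definition tits_labelling m (L : finType) (d : L -> nat)
    (rho : forall l, mx_representation K W (d l))
    (rhom : forall l, Kcyclo m -> 'M[Ky]_(d l)) :=
  [/\ forall l, alg_irr (rhom l),
      forall l l', repr_sim (rhom l) (rhom l') -> l = l',
      forall d' (r : Kcyclo m -> 'M[Ky]_d'), alg_irr r ->
        exists l, repr_sim r (rhom l) &
      forall l w (c : R -> 'rV[R[i]]_n), w \in W ->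
        Vreg_path iota rW (val x0) (wact iota rW (val x0) w) c ->
        value_at1
          (\tr (rhom l (Kcyclo_of (cyclo_of m (hecke_T (braid_of x0 c))))))
          (\tr (rho l w))].

Definition schur_elements m (tm : {scalar cyclo m}) (L : finType) (d : L -> nat)
    (rhom : forall l, Kcyclo m -> 'M[Ky]_(d l)) (s : L -> ZKq) :=
  (forall l, eval_y (s l) != 0) /\
  (forall h : cyclo m, eval_q (tm h) =
     \sum_l (eval_y (s l))^-1 * \tr (rhom l (Kcyclo_of h))).

Definition is_Gamma (g : cyclic_prod rW) m
    (Gamma : cyclo m -> cyclo (cyclic_act g m)) :=
  [/\ alg_morphism Gamma, bijective Gamma &
      forall C s, monodromy x0 C s ->
        Gamma (cyclo_of m (hecke_T s)) =
        ((zeta (horder C) ^+ g C)%:A : ZKq) *: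
          cyclo_of (cyclic_act g m) (hecke_T s)].

(* - val_q of a Laurent polynomial in y                                       *)
Definition afun (f : ZKq) : rat := - ((lord f)%:~R / mu_card%:R).

End HeckeAlgebra.
Arguments hecke_rel {R K iota gT W n rW} x0 _.
Arguments cyclo_rel {R K iota gT W n rW} x0 m _.
Arguments Kcyclo_rel {R K iota gT W n rW} x0 m _.

(* Main.v *)
(* Let b run over products of monodromy generators lifting the elements of W;
   the T_b span K(y)H_m, because the determinant of their Gram matrix for t
   becomes 1 in the group algebra of W.  It is enough to show that Gamma
   preserves the value of the canonical forms on these T_b, since the irreducible
   characters of a split semisimple algebra are linearly independent.
   Both facts needed about t(T_b) come from the uniqueness of t.  Twisting t by
   the automorphism u_(C, j) |-> x^N u_(C, j), with N = |W| and x a parameter of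
   degree 0 which becomes 1 in the group algebra, shows that t(T_b) is homogeneous
   in each family u_(C, -), of degree the number of letters of b in S_C.  Hence
   permuting cyclically the u_(C, j) multiplies the specialization of t(T_b) to
   the group algebra by a root of unity, equal to 1 for b = 1; so the form
   obtained from t by this permutation is again canonical, and t(T_b) is
   invariant under it.  The specializations m and g.m of t(T_b) then differ by
   the product of the zeta_(e_C)^(g_C) over the letters of b, exactly as T_b and
   its image by Gamma do. *)
From HB Require Import structures.
Require Import Defs.
From mathcomp Require Import all_boot all_order all_algebra all_fingroup.
From mathcomp Require Import all_character all_field finmap monalg.
From mathcomp Require Import all_classical all_reals all_analysis.
From mathcomp Require Import generic_quotient fraction complex.
From mathcomp Require Import ring lra zify.

Set Implicit Arguments.
Unset Strict Implicit.
Unset Printing Implicit Defensive.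

Import Order.TTheory GRing.Theory Num.Theory.
Import numFieldNormedType.Exports.

Local Open Scope classical_set_scope.
Local Open Scope ring_scope.
Local Open Scope quotient_scope.

(** * Quotients of monoid algebras and extension of scalars *)

(** It is not obvious that the number of letters of a braid in S_C is well defined. It is read from
    determinants of the regular representation of the generic algebra, which has rank N = |W|, so a
    letter weighs N instead of 1: this is the origin of the exponent N in the twist and of the
    factors N in front of all degrees. Such a weight need not be known to be a multiple of N for
    every braid; when it is not, t(T_b) is 0.

    The delicate point about the permuted form is a braid b other than 1 with trivial image in W:
    homogeneity gives its value in the group algebra only up to a root of unity. That root is
    removed by linear algebra. The semilinear automorphism permuting the parameters fixes every T_b,
    hence fixes, up to denominators, the coordinates of T_b on the T_(b_i). The matrix of the
    t(T_(b_i) T_(b_j)^-1) becomes the identity under the usual specialization and under the permuted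
    one, so both give t(T_b) the same value. *)

Section MonalgLift.
Variables (A : comNzRingType) (M : monoidType) (V : zmodType).
Variable F : A -> M -> V.
Hypothesis FD : forall a b x, F (a + b) x = F a x + F b x.

(** [F] is required to be additive in the coefficient only, so that semilinear maps and ring
    morphisms are both obtained from it. *)
Definition mlift (f : monalg A M) : V := \sum_(x <- msupp f) F f@_x x.

Let F0 x : F 0 x = 0.
Proof. by apply: (addrI (F 0 x)); rewrite -FD !addr0. Qed.

Lemma mliftEw (D : {fset M}) (f : monalg A M) :
  (msupp f `<=` D)%fset -> mlift f = \sum_(x <- D) F f@_x x.
Proof.
by move=> le; apply: big_fset_incl => // x _ /mcoeff_outdom ->; rewrite F0.
Qed.

Lemma mliftU a x : mlift << a *g x >> = F a x.
Proof. by rewrite (mliftEw msuppU_le) big_seq_fset1 mcoeffUU. Qed.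

Lemma mliftD f g : mlift (f + g) = mlift f + mlift g.
Proof.
rewrite (mliftEw (msuppD_le f g)) (mliftEw (fsubsetUl _ (msupp g))).
rewrite (mliftEw (fsubsetUr (msupp f) _)) -big_split /=.
by apply: eq_bigr => x _; rewrite mcoeffD FD.
Qed.

Lemma mlift0 : mlift 0 = 0.
Proof. by rewrite /mlift msupp0 big_seq_fset0. Qed.

Lemma mliftN f : mlift (- f) = - mlift f.
Proof. by apply: (addrI (mlift f)); rewrite -mliftD !subrr mlift0. Qed.

Lemma mlift_sum I (r : seq I) (P : pred I) (G : I -> monalg A M) :
  mlift (\sum_(i <- r | P i) G i) = \sum_(i <- r | P i) mlift (G i).
Proof. exact: (big_morph mlift mliftD mlift0). Qed.
End MonalgLift.

Lemma mliftZ (A A' : comNzRingType) (M : monoidType) (V : lmodType A')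
    (F : A -> M -> V) (phi : A -> A') (f : monalg A M) c :
  (forall a b x, F (a + b) x = F a x + F b x) ->
  (forall a b x, F (a * b) x = phi a *: F b x) ->
  mlift F (c *: f) = phi c *: mlift F f.
Proof.
move=> FD FZ; rewrite (mliftEw FD (msuppZ_le _ _)) /mlift scaler_sumr.
by apply: eq_bigr => x _; rewrite mcoeffZ FZ.
Qed.

Lemma mliftM (A : comNzRingType) (M : monoidType) (V : pzRingType)
    (F : A -> M -> V) :
  (forall a b x, F (a + b) x = F a x + F b x) ->
  (forall a b x y, F (a * b) (x * y)%g = F a x * F b y) ->
  forall f g : monalg A M, mlift F (f * g) = mlift F f * mlift F g.
Proof.
move=> FD FM f g; rewrite [f * g]/(monalg_mul f g) /monalg_mul mlift_sum //.
rewrite [in RHS]/mlift mulr_suml; apply: eq_bigr => x _.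
rewrite mlift_sum // mulr_sumr; apply: eq_bigr => y _.
by rewrite mliftU.
Qed.

Section QuotAlg.
Variables (A : comNzRingType) (E : algType A) (S : set E).
Local Notation H := (quot_alg S).

Lemma quot_scalerAl a (h k : H) : a *: (h * k) = (a *: h) * k.
Proof.
elim/quot_projW: h => x; elim/quot_projW: k => y.
by rewrite -quot_projZ -!quot_projM -quot_projZ scalerAl.
Qed.

Lemma quot_scalerAr a (h k : H) : a *: (h * k) = h * (a *: k).
Proof.
elim/quot_projW: h => x; elim/quot_projW: k => y.
by rewrite -quot_projZ -!quot_projM -quot_projZ scalerAr.
Qed.

Lemma quot_proj0 : quot_proj S 0 = 0. Proof. by []. Qed.

Lemma quot_proj_sum I (r : seq I) (P : pred I) (G : I -> E) :
  quot_proj S (\sum_(i <- r | P i) G i) = \sum_(i <- r | P i) quot_proj S (G i).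
Proof. exact: (big_morph _ (@quot_projD _ _ S) quot_proj0). Qed.

Lemma quot_proj_prod I (r : seq I) (P : pred I) (G : I -> E) :
  quot_proj S (\prod_(i <- r | P i) G i) = \prod_(i <- r | P i) quot_proj S (G i).
Proof. exact: (big_morph _ (@quot_projM _ _ S) (quot_proj1 S)). Qed.

Lemma quot_projN x : quot_proj S (- x) = - quot_proj S x.
Proof. by rewrite -scaleN1r quot_projZ scaleN1r. Qed.

Lemma quot_proj_rel x : S x -> quot_proj S x = 0.
Proof.
move=> Sx; rewrite -quot_proj0; apply/quot_projP.
exists 1, (fun=> 1), (fun=> x), (fun=> 1); split=> // .
by rewrite big_ord1 subr0 mul1r mulr1.
Qed.

Lemma quot_lift (V : pzRingType) (F : E -> V) :
  (forall x y, F (x + y) = F x + F y) -> (forall x y, F (x * y) = F x * F y) ->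
  (forall x, S x -> F x = 0) ->
  exists F' : H -> V, forall x, F' (quot_proj S x) = F x.
Proof.
move=> FD FM FS; have F0 : F 0 = 0.
  by apply: (addrI (F 0)); rewrite -FD !addr0.
exists (fun h => F (repr h)) => x.
have : ideal_gen S (repr (quot_proj S x) - x) by apply/quot_projP/reprK.
move=> [k [a [s [b [Ss e]]]]].
have -> : repr (quot_proj S x) = x + \sum_(i < k) a i * s i * b i.
  by rewrite -e addrC subrK.
rewrite FD (big_morph F FD F0) big1 ?addr0 // => i _.
by rewrite !FM (FS _ (Ss i)) mulr0 mul0r.
Qed.

End QuotAlg.

Section MonalgQuot.
Variables (A : comNzRingType) (M : monoidType) (S : set (monalg A M)).
Local Notation H := (quot_alg S).

Lemma monalg_quot_span (h : H) : exists n (a : 'I_n -> A) (x : 'I_n -> M),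
  h = \sum_(i < n) a i *: quot_proj S (monalg_of A (x i)).
Proof.
elim/quot_projW: h => f.
exists #|`msupp f|%fset, (fun i => f@_(nth 1%g (msupp f) i)),
  (fun i => nth 1%g (msupp f) i).
rewrite [f in LHS]monalgE quot_proj_sum (big_nth 1%g) big_mkord.
apply: eq_bigr => i _; rewrite -quot_projZ; congr quot_proj.
by apply/malgP => k; rewrite mcoeffZ !mcoeffU mulrnAr mulr1.
Qed.

Variables (A' : comNzRingType) (E' : algType A') (S' : set E').
Variables (tau : A -> A') (chi : M -> quot_alg S').
Hypothesis tauD : forall a b, tau (a + b) = tau a + tau b.
Hypothesis tauM : forall a b, tau (a * b) = tau a * tau b.
Hypothesis tau1 : tau 1 = 1.
Hypothesis chiM : forall x y, chi (x * y)%g = chi x * chi y.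
Hypothesis chi1 : chi 1%g = 1.

(** The coefficients change along [tau]: an automorphism for the twists of the Hecke algebra, the
    identity for scalar extension. *)
Definition qlift (f : monalg A M) : quot_alg S' :=
  mlift (fun a x => tau a *: chi x) f.

Lemma qliftD f g : qlift (f + g) = qlift f + qlift g.
Proof. by apply: mliftD => a b x; rewrite tauD scalerDl. Qed.

Lemma qliftZ a f : qlift (a *: f) = tau a *: qlift f.
Proof.
by apply: mliftZ => [c b x|c b x]; rewrite ?tauD ?scalerDl// tauM scalerA.
Qed.

Lemma qliftM f g : qlift (f * g) = qlift f * qlift g.
Proof.
apply: mliftM => [a b x|a b x y]; first by rewrite tauD scalerDl.
by rewrite tauM chiM -quot_scalerAl -quot_scalerAr scalerA.
Qed.

Lemma qlift_of x : qlift (monalg_of A x) = chi x.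
Proof.
by rewrite /qlift mliftU ?tau1 ?scale1r // => a b y; rewrite tauD scalerDl.
Qed.

Lemma qlift1 : qlift 1 = 1.
Proof. by rewrite -chi1 -qlift_of. Qed.

Lemma qliftN f : qlift (- f) = - qlift f.
Proof. by apply: mliftN => a b y; rewrite tauD scalerDl. Qed.

Lemma monalg_quot_lift : (forall z, S z -> qlift z = 0) ->
  exists F : H -> quot_alg S',
  [/\ forall a h k, F (a *: h + k) = tau a *: F h + F k,
     forall h k, F (h * k) = F h * F k, F 1 = 1 &
     forall x, F (quot_proj S (monalg_of A x)) = chi x].
Proof.
move=> qS; have [F FE] := quot_lift qliftD qliftM qS; exists F; split.
- move=> a h k; elim/quot_projW: h => x; elim/quot_projW: k => y.
  by rewrite -quot_projZ -quot_projD !FE qliftD qliftZ.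
- move=> h k; elim/quot_projW: h => x; elim/quot_projW: k => y.
  by rewrite -quot_projM !FE qliftM.
- by rewrite -(quot_proj1 S) FE qlift1.
- by move=> x; rewrite FE qlift_of.
Qed.
End MonalgQuot.

Section ScalarExt.
Variables (A B : comNzRingType) (phi : A -> B) (E : algType A) (S : set E).
Local Notation H := (quot_alg S).
Local Notation X := (scalar_ext phi S).

Lemma tens1M (h k : H) : tens1 phi (h * k) = tens1 phi h * tens1 phi k.
Proof.
rewrite -quot_projM; congr (quot_proj _ _).
by rewrite monalgUM mulr1.
Qed.

Lemma tens11 : tens1 phi (1 : H) = 1 :> X.
Proof. by []. Qed.

Lemma tens1D (h k : H) : tens1 phi (h + k) = tens1 phi h + tens1 phi k.
Proof.
have := @quot_proj_rel _ _ (@scalar_ext_rel _ _ phi _ S) _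
  (or_introl (ex_intro _ h (ex_intro _ k erefl))).
rewrite quot_projD quot_projN quot_projD quot_projN => /eqP.
by rewrite -addrA -opprD subr_eq0 => /eqP.
Qed.

Lemma tens1Z a (h : H) : tens1 phi (a *: h) = phi a *: tens1 phi h.
Proof.
have := @quot_proj_rel _ _ (@scalar_ext_rel _ _ phi _ S) _
  (or_intror (ex_intro _ a (ex_intro _ h erefl))).
by rewrite quot_projD quot_projN quot_projZ => /eqP; rewrite subr_eq0 => /eqP.
Qed.

Lemma tens1_span (x : X) : exists n (a : 'I_n -> B) (h : 'I_n -> H),
  x = \sum_(i < n) a i *: tens1 phi (h i).
Proof.
exact: (@monalg_quot_span B (mulmonoid H) (@scalar_ext_rel _ _ phi _ S) x).
Qed.

Variables (E' : algType B) (S' : set E').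
Local Notation Y := (quot_alg S').

(** Universal property of the scalar extension; it serves to extend [Gamma] to K(y). *)
Lemma scalar_ext_lift (f : H -> Y) :
  (forall h k, f (h + k) = f h + f k) -> (forall a h, f (a *: h) = phi a *: f h) ->
  (forall h k, f (h * k) = f h * f k) -> f 1 = 1 ->
  exists F : X -> Y, alg_morphism F /\ forall h, F (tens1 phi h) = f h.
Proof.
move=> fD fZ fM f1.
have eD := @qliftD B (mulmonoid H) B E' S' id f (fun _ _ => erefl).
have eN := @qliftN B (mulmonoid H) B E' S' id f (fun _ _ => erefl).
have eZ := @qliftZ B (mulmonoid H) B E' S' id f (fun _ _ => erefl)
  (fun _ _ => erefl).
have eE := @qlift_of B (mulmonoid H) B E' S' id f (fun _ _ => erefl) erefl.
have S0 z : scalar_ext_rel (S := S) phi z -> qlift id (f : mulmonoid H -> Y) z = 0.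
  move=> [[h [k ->]]|[a [h ->]]].
    by rewrite !eD !eN !eE fD addrAC addrK subrr.
  by rewrite eD eN eZ !eE fZ subrr.
have [F [FL FM F1 FE]] := @monalg_quot_lift B (mulmonoid H) _ B E' S' id f
  (fun _ _ => erefl) (fun _ _ => erefl) erefl fM f1 S0.
by exists F.
Qed.
End ScalarExt.

(** * Laurent polynomials *)

Lemma exprzMu (S : comUnitRingType) (x y : S) (n : int) :
  x \is a GRing.unit -> y \is a GRing.unit -> (x * y) ^ n = x ^ n * y ^ n.
Proof. by move=> xU yU; rewrite exprMz_comm //; apply: mulrC. Qed.

Section LaurentEval.
Variables (A : comNzRingType) (I : finType) (S : comUnitRingType).
Variables (phi : {rmorphism A -> S}) (x : I -> S).
Hypothesis xU : forall i, x i \is a GRing.unit.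

(** The proof of invertibility is an argument so that the ring morphism structure, which depends on
    it, can be attached to the term. *)
Definition leval of (forall i, x i \is a GRing.unit) : laurent A I -> S :=
  laurent_eval phi x.
Local Notation ev := (leval xU).

Let F (a : A) (k : expo I) := phi a * \prod_i x i ^ (k : {ffun I -> int}) i.
Let FD a b k : F (a + b) k = F a k + F b k.
Proof. by rewrite /F rmorphD mulrDl. Qed.
Let FM a b k l : F (a * b) (k * l)%g = F a k * F b l.
Proof.
rewrite /F rmorphM mulrACA -big_split; congr (_ * _).
by apply: eq_bigr => i _; rewrite ffunE exprzDr.
Qed.

Lemma levalU a k : ev << a *g k >> = phi a * \prod_i x i ^ (k : {ffun I -> int}) i.
Proof. exact: (mliftU FD). Qed.

Let ev1 : ev 1 = 1.
Proof.
rewrite levalU rmorph1 big1 ?mulr1 // => i _.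
by rewrite [(1%g : expo I) i]ffunE expr0z.
Qed.

Let evB : {morph ev : f g / f - g}.
Proof. by move=> f g; rewrite -(mliftN FD) -(mliftD FD). Qed.
Let evM : {morph ev : f g / f * g}.
Proof. exact: (mliftM FD FM). Qed.

HB.instance Definition _ := GRing.isZmodMorphism.Build _ _ (leval xU) evB.
HB.instance Definition _ := GRing.isMonoidMorphism.Build _ _ (leval xU) (conj ev1 evM).

Lemma leval_lvar i : ev (lvar i) = x i.
Proof.
rewrite levalU rmorph1 mul1r (bigD1 i) //= ffunE eqxx expr1z.
by rewrite big1 ?mulr1 // => j /negPf ji; rewrite ffunE ji expr0z.
Qed.

Lemma levalZ a f : ev (a *: f) = phi a * ev f.
Proof.
have aE : a *: f = (a *: (1 : laurent A I)) * f by rewrite -scalerAl mul1r.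
rewrite aE (rmorphM (leval xU)); congr (_ * _).
have -> : a *: (1 : laurent A I) = << a *g 1%g >>.
  by apply/malgP => k; rewrite mcoeffZ !mcoeffU mulrnAr mulr1.
transitivity (F a 1%g); first exact: (mliftU FD).
rewrite /F big1 ?mulr1 // => i _.
by rewrite [(1%g : expo I) i]ffunE expr0z.
Qed.
End LaurentEval.

Section Laurent.
Variables (A : comNzRingType) (I : finType).

Definition lmon (k : {ffun I -> int}) : laurent A I := << 1 *g (k : expo I) >>.

Lemma lmonD k l : lmon (k + l) = lmon k * lmon l.
Proof. by rewrite [RHS]monalgUM mulr1. Qed.

Lemma lmon0 : lmon 0 = 1.
Proof. by []. Qed.

Lemma lmon_unit k : lmon k \is a GRing.unit.
Proof. by apply/unitrPr; exists (lmon (- k)); rewrite -lmonD subrr lmon0. Qed.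

Lemma lmonV k : (lmon k)^-1 = lmon (- k).
Proof.
by rewrite -[LHS]mulr1 -lmon0 -(subrr k) lmonD mulKr // lmon_unit.
Qed.

Lemma lmonX k z : lmon k ^ z = lmon (k *~ z).
Proof.
have lX n : lmon k ^+ n = lmon (k *+ n).
  elim: n => [|n IH]; first by rewrite mulr0n.
  by rewrite exprS IH -lmonD mulrS.
by case: z => n; rewrite /exprz lX // lmonV.
Qed.

Lemma lmon_prod (J : finType) (k : J -> {ffun I -> int}) :
  \prod_j lmon (k j) = lmon (\sum_j k j).
Proof. by rewrite (big_morph lmon lmonD lmon0). Qed.

Lemma lvar_unit i : (lvar i : laurent A I) \is a GRing.unit.
Proof. exact: (lmon_unit [ffun j => (j == i)%:Z]). Qed.

Lemma lvarE i : lvar i = lmon [ffun j => (j == i)%:Z]. Proof. by []. Qed.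

Lemma lmonE k : lmon k = \prod_i (lvar i : laurent A I) ^ (k i).
Proof.
under eq_bigr do rewrite lvarE lmonX.
rewrite lmon_prod; congr lmon; apply/ffunP => i.
rewrite sum_ffunE (bigD1 i) //= big1 ?addr0 => [|j ji].
  by rewrite ffunMzE ffunE eqxx intz.
by rewrite ffunMzE ffunE eq_sym (negPf ji) mul0rz.
Qed.

Lemma laurentE (f : laurent A I) : f = \sum_(k <- msupp f) f@_k *: lmon k.
Proof.
rewrite [LHS]monalgE; apply: eq_bigr => k _.
by apply/malgP => l; rewrite mcoeffZ !mcoeffU mulrnAr mulr1.
Qed.

Lemma rmorph_prodXz (S S' : comUnitRingType) (psi : {rmorphism S -> S'})
    (x : I -> S) (k : I -> int) : (forall i, x i \is a GRing.unit) ->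
  psi (\prod_i x i ^ k i) = \prod_i psi (x i) ^ k i.
Proof.
by move=> xU; rewrite rmorph_prod; apply: eq_bigr => i _; rewrite rmorphXz.
Qed.

Lemma rmorph_laurent_eval (S S' : comUnitRingType) (phi : A -> S) (phi' : A -> S')
    (psi : {rmorphism S -> S'}) (x : I -> S) f :
  (forall i, x i \is a GRing.unit) -> (forall a, psi (phi a) = phi' a) ->
  psi (laurent_eval phi x f) = laurent_eval phi' (psi \o x) f.
Proof.
move=> xU pp; rewrite /laurent_eval rmorph_sum; apply: eq_bigr => k _.
by rewrite rmorphM pp rmorph_prodXz.
Qed.

Lemma eq_laurent_eval (S : comUnitRingType) (phi phi' : A -> S) (x x' : I -> S) f :
  phi =1 phi' -> x =1 x' -> laurent_eval phi x f = laurent_eval phi' x' f.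
Proof. by move=> /funext -> /funext ->. Qed.

Lemma laurent_eval_id (f : laurent A I) :
  laurent_eval (fun a => a *: 1) (fun i => lvar i) f = f.
Proof.
rewrite [RHS]laurentE; apply: eq_bigr => k _.
by rewrite -lmonE -scalerAl mul1r.
Qed.

(** Every monomial of [f] picks up the same factor. In use, [p] sends a parameter u_(C, j) to its
    orbit C and [d] is the degree in each family. *)
Lemma laurent_eval_scale (S : comUnitRingType) (phi : A -> S) (x : I -> S)
    (T : finType) (p : I -> T) (z : T -> S) (d : T -> int) f :
  (forall i, x i \is a GRing.unit) -> (forall c, z c \is a GRing.unit) ->
  (forall k : expo I, k \in msupp f -> forall c,
     \sum_(i | p i == c) (k : {ffun I -> int}) i = d c) ->
  laurent_eval phi (fun i => z (p i) * x i) f =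
    (\prod_c z c ^ d c) * laurent_eval phi x f.
Proof.
move=> xU zU fd; rewrite /laurent_eval mulr_sumr [LHS]big_seq [RHS]big_seq.
apply: eq_bigr => k kf; rewrite mulrCA; congr (_ * _).
have -> : \prod_i (z (p i) * x i) ^ (k : {ffun I -> int}) i =
    \prod_i (z (p i) ^ (k : {ffun I -> int}) i * x i ^ (k : {ffun I -> int}) i).
  by apply: eq_bigr => i _; rewrite exprzMu.
rewrite big_split /=; congr (_ * _).
transitivity (\prod_c \prod_(i | p i == c) z (p i) ^ (k : {ffun I -> int}) i).
  exact: partition_big.
apply: eq_bigr => c _; rewrite -(fd k kf c).
have zD : {morph (fun n => z c ^ n) : m n / m + n >-> m * n}.
  by move=> m n; rewrite exprzDr.
rewrite (big_morph _ zD (expr0z _)).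
by apply: eq_bigr => i /eqP ->.
Qed.
End Laurent.

(** Provides the extremal exponent in [lsubst_homogeneous], where [P] selects one degree. *)
Lemma seq_argmax (X : eqType) (s : seq X) (P : pred X) (F : X -> int) :
  has P s -> exists2 k, (k \in s) && P k & forall l, l \in s -> P l -> F l <= F k.
Proof.
elim: s => // y s IH /=; case: (boolP (has P s)) => [/IH [k /andP[ks Pk] km] _|nP].
  case: (boolP (P y && (F k <= F y))) => [/andP[Py ky]|nPy].
    exists y; first by rewrite mem_head.
    by move=> l /predU1P[->//|ls] Pl; apply: le_trans (km l ls Pl) ky.
  exists k; first by rewrite inE ks orbT.
  move=> l /predU1P[->|ls] Pl; last exact: km.
  by move: nPy; rewrite Pl /= -ltNge => /ltW.
rewrite orbF => Py; exists y; first by rewrite mem_head.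
move=> l /predU1P[->//|ls] Pl; by case/hasPn/(_ l ls)/negP: nP.
Qed.

Section IntLaurent.
Variable I : finType.
Local Notation Z := {ffun I -> int}.
Implicit Types (f : laurent int I) (k l v : Z).

Definition lsubst (w : I -> Z) f : laurent int I :=
  laurent_eval intr (fun i => lmon int (w i)) f.

Lemma intr_lmon a k : (a%:~R : laurent int I) * lmon int k = << a *g (k : expo I) >>.
Proof.
rewrite mulrzl /lmon; case: a => n; rewrite /intmul.
  by rewrite -monalgUMn natz.
by rewrite -monalgUMNn natz NegzE.
Qed.

Lemma lsubst_coef (w : I -> Z) f l :
  (lsubst w f)@_(l : expo I) =
    \sum_(k <- msupp f) f@_k *+ (\sum_i w i *~ (k : Z) i == l).
Proof.
rewrite /lsubst /laurent_eval (raddf_sum (mcoeff (l : expo I))).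
apply: eq_bigr => k _.
under eq_bigr do rewrite lmonX.
by rewrite lmon_prod intr_lmon; exact: mcoeffU.
Qed.

Lemma lmonM_coef k f l : (lmon int k * f)@_(l : expo I) = f@_(l - k : expo I).
Proof.
have -> : f@_(l - k : expo I) = \sum_(m <- msupp f) f@_m *+ (m == (l - k : expo I)).
  rewrite [in LHS](monalgE f) (raddf_sum (mcoeff (l - k : expo I))).
  by apply: eq_bigr => m _; exact: mcoeffU.
rewrite [in LHS](monalgE f) mulr_sumr (raddf_sum (mcoeff (l : expo I))).
apply: eq_bigr => m _.
transitivity (<< 1 * f@_m *g ((k : expo I) * m)%g >>@_(l : expo I)).
  by congr (_@_ _); exact: monalgUM.
transitivity (f@_m *+ (((k : expo I) * m)%g == (l : expo I))).
  by rewrite mul1r; exact: mcoeffU.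
congr (_ *+ nat_of_bool _); apply/eqP/eqP => [<-|->].
  by rewrite [((k : expo I) * m)%g]addrC addrK.
by rewrite [LHS]addrC subrK.
Qed.

Variables (T : finType) (p : I -> T) (c : T).

Definition pdeg (k : Z) : int := \sum_(i | p i == c) k i.

(** Exponents of the substitution u_i |-> x^N u_i for the variables above [c], where x is the
    monomial of exponent [v]. *)
Definition degshift (v : Z) (N : int) (i : I) : Z :=
  [ffun j => (j == i)%:Z] + (if p i == c then v *~ N else 0).

Lemma pdegD k l : pdeg (k + l) = pdeg k + pdeg l.
Proof. by rewrite /pdeg -big_split; apply: eq_bigr => i _; rewrite ffunE. Qed.

Lemma pdegMz k z : pdeg (k *~ z) = pdeg k * z.
Proof.
rewrite /pdeg mulr_suml; apply: eq_bigr => i _.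
by rewrite ffunMzE -mulrzr intz.
Qed.

Lemma pdeg_delta i : pdeg [ffun j => (j == i)%:Z] = (p i == c)%:Z.
Proof.
rewrite /pdeg; case: eqP => pi.
  rewrite (bigD1 i) /= ?pi // ffunE eqxx big1 ?addr0 // => j /andP[_ /negPf ji].
  by rewrite ffunE ji.
by rewrite big1 // => j /eqP pj; rewrite ffunE; case: eqP => // ji; rewrite -ji in pi.
Qed.

Lemma degshift_sum v N (k : Z) :
  \sum_i degshift v N i *~ k i = k + v *~ (N * pdeg k).
Proof.
under eq_bigr do rewrite mulrzDl.
rewrite big_split /=; congr (_ + _).
  apply/ffunP => i; rewrite sum_ffunE (bigD1 i) //= big1 ?addr0 => [|j ji].
    by rewrite ffunMzE ffunE eqxx intz.
  by rewrite ffunMzE ffunE eq_sym (negPf ji) mul0rz.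
rewrite (bigID (fun i => p i == c)) /= [X in _ + X]big1 ?addr0; last first.
  by move=> i /negPf ->; rewrite mul0rz.
rewrite /pdeg mulr_sumr (big_morph (fun z => v *~ z) (id1 := 0) (op1 := +%R)).
- by apply: eq_bigr => i ->; rewrite mulrzA.
- by move=> a b; rewrite mulrzDr.
- exact: mulr0z.
Qed.

Variables (v : Z) (i1 : I) (N D : int).
Hypothesis v_deg0 : pdeg v = 0.
Hypothesis v_i1 : v i1 != 0.

(* The substitution translates an exponent k by N (pdeg k) v.  If N d <> D, then the
   exponent of degree d extremal in the direction of v has its translate by
   (N d - D) v in the support. *)
Lemma lsubst_homogeneous f : lsubst (degshift v N) f = lmon int (v *~ D) * f ->
  forall k : expo I, k \in msupp f -> N * pdeg k = D.
Proof.
have degDv k z : pdeg (k + v *~ z) = pdeg k.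
  by rewrite pdegD pdegMz v_deg0 mul0r addr0.
move=> fE k0 k0f; apply/eqP/negPn/negP => ne.
pose d := pdeg k0; pose a := N * d - D.
have a0 : a != 0 by rewrite subr_eq0.
have hk0 : has (fun k : expo I => pdeg k == d) (msupp f).
  by apply/hasP; exists k0.
(* Translation by [a] times [v] keeps the degree and raises this weight by the square of [a * v i1],
   so the translate of a maximal [k] cannot be in the support. *)
have [k /andP[kf /eqP kd] kmax] := seq_argmax
  (fun k : expo I => a * v i1 * (k : Z) i1) hk0.
have := congr1 (mcoeff ((k + v *~ (N * d) : Z) : expo I)) fE.
rewrite lsubst_coef lmonM_coef.
(* Exponents move along [v], which has degree 0; one that arrives at the same place as [k] therefore
   has the degree of [k], is moved by the same vector, and equals [k]. *)
rewrite (bigD1_seq k) ?fset_uniq //= degshift_sum [pdeg k]kd eqxx big1; last first.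
  move=> m mk; rewrite degshift_sum; case: eqP => // e.
  have dm : pdeg m = d by rewrite -[LHS](degDv _ (N * pdeg m)) e degDv.
  by move: e mk; rewrite dm => /addIr ->; rewrite eqxx.
rewrite addr0 mulr1n => kE.
have lE : (k : Z) + v *~ (N * d) - v *~ D = k + v *~ a.
  by rewrite -addrA -mulrzBr.
have l_in : (k + v *~ a : Z) \in msupp f.
  by rewrite -lE -mcoeff_neq0 -kE mcoeff_neq0.
have := kmax _ l_in; rewrite degDv [pdeg k]kd eqxx => /(_ isT).
rewrite ffunE ffunMzE -mulrzr intz mulrDr gerDl leNgt => /negP; apply.
by rewrite [X in _ * X]mulrC -expr2 exprn_even_gt0 //= mulf_neq0.
Qed.
End IntLaurent.

(** * Paths and monodromy generators *)

Section ComplexContinuity.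
Variable R : realType.
Local Notation C := R[i].

Lemma ofreal_continuous : continuous ((fun r => r%:C%C) : R -> C).
Proof.
move=> r; apply/cvgrPdist_lt => e e0.
have [eI eR] : complex.Im e = 0 /\ 0 < complex.Re e by move: e0; rewrite ltcE /= => /andP[/eqP ->].
near=> s; rewrite -rmorphB normc_def /= expr0n addr0 sqrtr_sqr.
rewrite ltcE /= eI eqxx /=.
near: s; exact: cvgr_dist_lt.
Unshelve. all: by end_near. Qed.

Lemma continuous_expi : continuous (@expi R).
Proof.
have -> : @expi R = fun t => (cos t)%:C%C + 'i%C * (sin t)%:C%C.
  by apply/funext => t; rewrite [LHS]complexE.
move=> t; apply: cvgD.
  apply: (@cvg_comp _ _ _ (@cos R) (fun r => r%:C%C)); last exact: ofreal_continuous.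
  exact: continuous_cos.
apply: cvgM; first exact: cvg_cst.
apply: (@cvg_comp _ _ _ (@sin R) (fun r => r%:C%C)); last exact: ofreal_continuous.
exact: continuous_sin.
Qed.

Lemma cvg_mx (T : topologicalType) (U : Type) m n (F : set_system U) (FF : Filter F)
    (f : U -> 'M[T]_(m, n)) (M : 'M[T]_(m, n)) :
  (forall i j, (fun x => f x i j) @ F --> M i j) -> f @ F --> M.
Proof.
move=> fM A [P MP PA]; rewrite /fmap /=.
have FP : F [set x | forall i j, P i j (f x i j)].
  apply: (filter_forall (f := fun i => [set x | forall j, P i j (f x i j)])) => i.
  by apply: (filter_forall (f := fun j => [set x | P i j (f x i j)])) => j; exact: fM.
by change (F (f @^-1` A)); apply: filterS FP => x Px; exact: PA.
Qed.

Lemma cvg_mx_coef (T : topologicalType) (U : Type) m n (F : set_system U) (FF : Filter F)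
    (f : U -> 'M[T]_(m, n)) (M : 'M[T]_(m, n)) i j :
  f @ F --> M -> (fun x => f x i j) @ F --> M i j.
Proof.
move=> fM A MA; rewrite /fmap /=.
have : nbhs M [set N : 'M[T]_(m, n) | A (N i j)].
  exists (fun i' j' => if (i' == i) && (j' == j) then A else setT).
    move=> i' j'; case: ifP => [/andP[/eqP-> /eqP->]//|_]; exact: filterT.
  by move=> N /(_ i j); rewrite !eqxx.
by move/fM.
Qed.

Lemma expiD (a b : R) : expi (a + b) = expi a * expi b.
Proof.
by rewrite /expi; simpc; rewrite cosD sinD addrC [cos a * sin b + _]addrC.
Qed.

Lemma expi0 : expi (0 : R) = 1.
Proof. by rewrite /expi cos0 sin0. Qed.

Lemma expiX (a : R) n : expi a ^+ n = expi (a * n%:R).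
Proof.
elim: n => [|n IH]; first by rewrite mulr0 expi0.
by rewrite exprS IH -expiD mulrSr mulrDr mulr1 addrC.
Qed.

Lemma expi_norm (a : R) : `|expi a| = 1.
Proof. by rewrite normc_def /= cos2Dsin2 sqrtr1. Qed.

Lemma expi_2pi : expi (2 * trigo.pi) = 1 :> C.
Proof. by rewrite /expi mulr_natl cos2pi sin2pi. Qed.

(** Because cos a = 1 - 2 sin(a/2)^2 and sin(a/2) > 0 in this range. *)
Lemma expi_neq1 (a : R) : 0 < a < 2 * trigo.pi -> expi a != 1.
Proof.
move=> /andP[a0 a2]; apply/eqP => -[ca _].
have : 0 < sin (a / 2).
  by apply: sin_gt0_pi; rewrite divr_gt0 //= ltr_pdivrMr // mulrC.
have := cosD (a / 2) (a / 2); rewrite -splitr ca.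
have := cos2Dsin2 (a / 2); rewrite -!expr2 => h1 h2 h3.
have : sin (a / 2) ^+ 2 > 0 by rewrite exprn_gt0.
lra.
Qed.

Lemma expi_prim e : (0 < e)%N -> e.-primitive_root (expi (2 * trigo.pi / e%:R : R)).
Proof.
move=> e0; have e0R : (0 : R) < e%:R by rewrite ltr0n.
rewrite /primitive_root_of_unity e0 /=; apply/forallP => i.
rewrite unity_rootE expiX; have [->|ie] := eqVneq i.+1 e.
  have -> : 2 * trigo.pi / e%:R * e%:R = 2 * trigo.pi :> R.
    by rewrite divfK ?gt_eqF.
  by rewrite eqb_id; apply/eqP; exact: expi_2pi.
rewrite eqbF_neg; apply: expi_neq1.
have ilt : (i.+1 < e)%N by rewrite ltn_neqAle ie ltn_ord.
have p0 := @pi_gt0 R.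
rewrite mulrAC -mulrA; apply/andP; split.
  apply: mulr_gt0; first exact: mulr_gt0.
  by apply: divr_gt0; rewrite ?ltr0n.
rewrite gtr_pMr; last exact: mulr_gt0.
by rewrite ltr_pdivrMr // mul1r ltr_nat.
Qed.
End ComplexContinuity.

(** * Stability of V^reg under W *)

Section Reflections.
Variables (R : realType) (K : fieldType) (iota : {rmorphism K -> R[i]}).
Variables (gT : finGroupType) (W : {group gT}) (n : nat).
Variable rW : mx_representation K W n.
Local Notation VC := 'rV[R[i]]_n.
Local Notation act := (wact iota rW).
Implicit Types (H : hplane rW) (z : VC).

Lemma wactM z v w : v \in W -> w \in W -> act (act z v) w = act z (v * w)%g.
Proof. by move=> vW wW; rewrite /wact -mulmxA -map_mxM -repr_mxM. Qed.

Lemma wact1 z : act z 1%g = z.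
Proof. by rewrite /wact repr_mx1 map_mx1 mulmx1. Qed.

Lemma hplane_refl H : exists r, [/\ r \in W, is_refl rW r &
  hmx H = <<kermx (rW r - 1%:M)>>%MS].
Proof.
case: H => A /=; rewrite mem_undup => /mapP[r].
by rewrite mem_filter mem_enum => /andP[rr rW'] ->; exists r.
Qed.

Lemma refl_hplane r : r \in W -> is_refl rW r ->
  exists H, hmx H = <<kermx (rW r - 1%:M)>>%MS.
Proof.
move=> rW' rr; have rA : <<kermx (rW r - 1%:M)>>%MS \in arrangement rW.
  rewrite mem_undup; apply/mapP; exists r => //.
  by rewrite mem_filter rr mem_enum.
by exists (SeqSub rA).
Qed.

Lemma on_hplaneE r H z : hmx H = <<kermx (rW r - 1%:M)>>%MS ->
  on_hplane iota z H = (act z r == z).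
Proof.
move=> HE; rewrite /on_hplane HE map_genmx genmxE map_kermx; apply/sub_kermxP/eqP.
  by rewrite map_mxB map_mx1 mulmxBr mulmx1 => /eqP; rewrite subr_eq0 => /eqP.
by move=> e; rewrite map_mxB map_mx1 mulmxBr mulmx1 -[X in X - _]/(act z r) e subrr.
Qed.

(** Phrased with reflections instead of hyperplanes, membership is seen to be stable under W by
    conjugation. *)
Lemma VregP z : Vreg iota rW z <->
  forall r, r \in W -> is_refl rW r -> act z r != z.
Proof.
split=> [zV r rW' rr|zV H].
  by have [H HE] := refl_hplane rW' rr; rewrite -(on_hplaneE _ HE); exact: zV.
by have [r [rW' rr HE]] := hplane_refl H; rewrite (on_hplaneE _ HE) zV.
Qed.

Lemma is_reflJ r w : r \in W -> w \in W -> is_refl rW r ->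
  is_refl rW (w * r * w^-1)%g.
Proof.
move=> rW' wW; rewrite /is_refl => rr.
rewrite !repr_mxM ?groupM ?groupV //.
have -> : rW w *m rW r *m rW w^-1%g - 1%:M = rW w *m (rW r - 1%:M) *m rW w^-1%g.
  rewrite mulmxBr mulmxBl mulmx1; congr (_ - _).
  by rewrite -repr_mxM ?groupV // mulgV repr_mx1.
rewrite mxrankMfree; last by rewrite row_free_unit repr_mx_unit ?groupV.
by rewrite eqmxMfull // row_full_unit repr_mx_unit.
Qed.

Lemma Vreg_wact z w : w \in W -> Vreg iota rW z -> Vreg iota rW (act z w).
Proof.
move=> wW /VregP zV; apply/VregP => r rW' rr.
have := zV _ _ (is_reflJ rW' wW rr); rewrite !groupM ?groupV // => /(_ isT).
apply: contra_neq => e; rewrite -!wactM ?groupM ?groupV //.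
by rewrite [act (act z w) r]e wactM ?groupV // mulgV wact1.
Qed.
End Reflections.

(** * Paths in V^reg and their classes in the braid group *)

Section Lifts.
Variables (R : realType) (K : fieldType) (iota : {rmorphism K -> R[i]}).
Variables (gT : finGroupType) (W : {group gT}) (n : nat).
Variables (rW : mx_representation K W n) (x0 : Vreg iota rW).
Local Notation VC := 'rV[R[i]]_n.
Local Notation act := (wact iota rW).
Local Notation VW := (VregW iota rW).
Local Notation proj z := (\pi_VW (insubd x0 z) : VW).
Implicit Types (z : VC) (c d : R -> VC).

Lemma within01P (X : topologicalType) (f : R -> X) :
  {within `[0, 1], continuous f} <->
  forall t : R, t \in `[0, 1] -> f x @[x --> within `[0, 1]%classic (nbhs t)] --> f t.
Proof. exact: subspace_continuousP. Qed.

Lemma val_x0 : Vreg iota rW (val x0).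
Proof. exact: set_valP. Qed.

Lemma val_insubd z : Vreg iota rW z -> val (insubd x0 z) = z.
Proof. by move=> zV; rewrite insubdK // inE. Qed.

Lemma insubd_val : insubd x0 (val x0) = x0.
Proof. exact: valKd. Qed.

Lemma proj_wact z w : w \in W -> Vreg iota rW z -> proj (act z w) = proj z.
Proof.
move=> wW zV; apply/esym.
change (insubd x0 z = insubd x0 (act z w) %[mod {eq_quot (wequiv iota rW)}]).
apply/eqP; rewrite eqmodE; apply/existsP; exists w.
by rewrite wW /= (val_insubd zV) val_insubd //; exact: Vreg_wact.
Qed.

(** Continuity is obtained first into the subspace V^reg, then composed with the quotient map.
    [insubd] replaces points outside V^reg by [x0], which can only happen for parameters outside
    [0, 1]. *)
Lemma proj_path (a b : VC) c : Vreg_path iota rW a b c ->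
  is_path (proj a) (proj b) (fun t => proj (c t)).
Proof.
move=> [[cc c0 c1] cV]; split; rewrite ?c0 ?c1 //.
have cI : {within `[0, 1], continuous (fun t => insubd x0 (c t) : Vreg iota rW)}.
  apply/within01P => t tI A [_ [[B oB <-] Bt BA]].
  have := (within01P _).1 cc t tI B.
  rewrite /fmap /= nbhsE /= => h.
  have : within `[0, 1] (nbhs t) (c @^-1` B).
    apply: h; exists B => //; split => //.
    by have e := val_insubd (cV _ tI); rewrite -e; exact: Bt.
  rewrite /within /=; apply: filterS => s /= Bs sI; apply: BA.
  by have e := val_insubd (cV _ sI); rewrite -e in Bs; exact: Bs.
apply/within01P => t tI.
apply: (@cvg_comp _ _ _ (fun t => insubd x0 (c t) : Vreg iota rW) (\pi_VW : _ -> VW)).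
  exact: (within01P _).1 cI t tI.
exact: pi_continuous.
Qed.

Lemma Vreg_path_cat (a b d : VC) c c' : Vreg_path iota rW a b c ->
  Vreg_path iota rW b d c' -> Vreg_path iota rW a d (path_cat c c').
Proof.
move=> [pc cV] [pc' cV']; split; first exact: path_catP pc pc'.
move=> t; rewrite in_itv /= => /andP[t0 t1]; rewrite /path_cat; case: leP => th.
  by apply: cV; rewrite in_itv /=; lra.
by apply: cV'; rewrite in_itv /=; lra.
Qed.

Lemma Vreg_path_rev (a b : VC) c : Vreg_path iota rW a b c ->
  Vreg_path iota rW b a (path_rev c).
Proof.
move=> [pc cV]; split; first exact: path_revP pc.
by move=> t; rewrite in_itv /= => ?; apply: cV; rewrite in_itv /=; lra.
Qed.

Lemma cvg_mulmxr p (U : Type) (F : set_system U) (FF : Filter F)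
    (f : U -> VC) (z : VC) (M : 'M[R[i]]_(n, p)) :
  f @ F --> z -> (fun x => f x *m M) @ F --> z *m M.
Proof.
move=> fz; apply: cvg_mx => i j; rewrite !mxE.
under eq_fun do rewrite mxE.
apply: (@cvg_big _ _ +%R 0 xpredT _ _ F _ (fun k x => f x i k * M k j)).
  by move=> x; exact: add_continuous.
by move=> k _; apply: cvgM; [exact: cvg_mx_coef|exact: cvg_cst].
Qed.

Lemma Vreg_path_wact (a b : VC) c w : w \in W -> Vreg_path iota rW a b c ->
  Vreg_path iota rW (act a w) (act b w) (fun t => act (c t) w).
Proof.
move=> wW [[cc c0 c1] cV]; split; last by move=> t tI; apply: Vreg_wact; auto.
split; [|by rewrite c0|by rewrite c1].
apply/within01P => t tI; apply: cvg_mulmxr; exact: ((within01P _).1 cc t tI).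
Qed.

(** A relation standing for the morphism from the braid group to W, whose construction would need
    lifting of homotopies; compatibility with 1, products and inverses is all that is asked of
    it. *)
Definition path_lift (b : braid_group x0) (w : gT) : Prop :=
  w \in W /\ exists c, Vreg_path iota rW (val x0) (act (val x0) w) c /\
    b = braid_of x0 c.

Lemma proj_x0 w : w \in W -> proj (act (val x0) w) = \pi_VW x0.
Proof. by move=> wW; rewrite proj_wact ?insubd_val //; exact: val_x0. Qed.

Lemma braid_path c w : w \in W ->
  Vreg_path iota rW (val x0) (act (val x0) w) c ->
  is_path (\pi_VW x0 : VW) (\pi_VW x0) (fun t => proj (c t)).
Proof.
move=> wW /proj_path; rewrite proj_x0 //.
by rewrite insubd_val.
Qed.

Lemma lift1 : path_lift 1%g 1%g.
Proof.
split; first exact: group1.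
exists (fun=> val x0); rewrite wact1; split.
  split; first exact: path_cst.
  by move=> t _; exact: val_x0.
rewrite /braid_of; congr (pi1_class _ _).
by apply/funext => t; rewrite insubd_val.
Qed.

(** The product runs through [c'] first, which ends at x0 w', so [c] has to be translated by w'; the
    translate has the same image in V^reg/W. *)
Lemma liftM b b' w w' : path_lift b w -> path_lift b' w' -> path_lift (b * b')%g (w * w')%g.
Proof.
move=> [wW [c [pc ->]]] [wW' [c' [pc' ->]]]; split; first exact: groupM.
exists (path_cat c' (fun t => act (c t) w')); split.
  apply: Vreg_path_cat pc' _.
  by rewrite -wactM //; exact: Vreg_path_wact.
rewrite /braid_of [LHS](pi1_mulE (braid_path wW pc) (braid_path wW' pc')).
apply/pi1_classP.
- exact: path_catP (braid_path wW' pc') (braid_path wW pc).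
- have := Vreg_path_cat pc' (Vreg_path_wact wW' pc).
  by rewrite wactM // => /(braid_path (groupM wW wW')).
rewrite (_ : (fun t => proj (path_cat c' _ t)) =
    path_cat (fun t => proj (c' t)) (fun t => proj (act (c t) w'))); last first.
  by apply/funext => t; rewrite /path_cat; case: ifP.
apply: homotopic_cat; first exact: homotopic_refl (braid_path wW' pc').
(* The two functions agree on [0, 1] but perhaps not outside, where [c] may leave V^reg; so they are
   not equal, but one homotopy serves for both. *)
have [F [cF F01 Fab]] := homotopic_refl (braid_path wW pc).
exists F; split => // t tI; have [-> ->] := F01 t tI; split => //.
by rewrite proj_wact //; exact: pc.2.
Qed.

(** The reversed path goes from x0 w to x0; translated by w^-1 it goes from x0 to x0 w^-1. *)
Lemma liftV b w : path_lift b w -> path_lift b^-1%g w^-1%g.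
Proof.
move=> [wW [c [pc ->]]].
have pr : Vreg_path iota rW (val x0) (act (val x0) w^-1%g)
    (fun t => act (path_rev c t) w^-1%g).
  have := Vreg_path_wact (groupVr wW) (Vreg_path_rev pc).
  by rewrite wactM ?groupV // mulgV wact1.
have l' : path_lift (braid_of x0 (fun t => act (path_rev c t) w^-1%g)) w^-1%g.
  by split; [rewrite groupV | exists (fun t => act (path_rev c t) w^-1%g)].
suff <- : braid_of x0 (fun t => act (path_rev c t) w^-1%g) = (braid_of x0 c)^-1%g.
  by [].
apply: (mulgI (braid_of x0 c)); rewrite mulgV.
rewrite /braid_of [LHS](pi1_mulE (braid_path wW pc) (braid_path (groupVr wW) pr)).
apply/pi1_classP.
- exact: path_catP (braid_path (groupVr wW) pr) (braid_path wW pc).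
- exact: path_cst.
have := homotopic_cat_rev (path_revP (braid_path wW pc)).
apply: homotopic_trans.
have -> : path_rev (path_rev (fun t => proj (c t))) = (fun t => proj (c t)).
  by apply/funext => t; rewrite /path_rev subKr.
apply: homotopic_cat; last exact: homotopic_refl (braid_path wW pc).
have [F [cF F01 Fab]] := homotopic_refl (path_revP (braid_path wW pc)).
exists F; split => // t tI; have [-> ->] := F01 t tI; split => //.
rewrite proj_wact ?groupV //; exact: ((Vreg_path_rev pc).2 t tI).
Qed.
End Lifts.

Section RankOne.
Variables (F : fieldType) (n : nat).
Implicit Types A : 'M[F]_n.

Lemma rank1_factor A : (\rank A <= 1)%N ->
  exists (u : 'cV[F]_n) (v : 'rV[F]_n), A = u *m v.
Proof.
case: (posnP (\rank A)) => [/eqP|r0 r1].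
  by rewrite mxrank_eq0 => /eqP -> _; exists 0, 0; rewrite mul0mx.
have e : \rank A = 1%N by apply/eqP; rewrite eqn_leq r1.
move: (col_base A) (row_base A) (mulmx_base A); rewrite e => u v <-.
by exists u, v.
Qed.

(** Matrix determinant lemma, from two block triangular factorizations of the same matrix of size 1
    + n. *)
Lemma det_1_add_colrow (u : 'cV[F]_n) (v : 'rV[F]_n) :
  \det (1%:M + u *m v) = 1 + \tr (u *m v).
Proof.
have E : block_mx 1%:M 0 u 1%:M *m block_mx 1%:M (- v) 0 (1%:M + u *m v) =
    block_mx 1%:M (- v) 0 1%:M *m block_mx (1%:M + v *m u) 0 u 1%:M
    :> 'M[F]_(1 + n).
  rewrite !mulmx_block !(mul0mx, mulmx0, mul1mx, mulmx1, addr0, add0r).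
  by rewrite mulNmx addrK mulmxN addrCA addNr addr0.
have := congr1 determinant E; rewrite !det_mulmx !det_ublock !det_lblock !det1.
rewrite !mul1r !mulr1 => ->; rewrite det_mx11 mxE mxE eqxx mxtrace_mulC.
by rewrite [\tr (v *m u)]/mxtrace big_ord1.
Qed.

Lemma rank1_det A : (\rank A <= 1)%N -> \det (1%:M + A) = 1 + \tr A.
Proof. by move=> /rank1_factor[u [v ->]]; exact: det_1_add_colrow. Qed.

Lemma rank1_sqr A : (\rank A <= 1)%N -> A *m A = \tr A *: A.
Proof.
move=> /rank1_factor[u [v ->]]; rewrite mulmxA -(mulmxA u v u).
rewrite [v *m u]mx11_scalar mul_mx_scalar -scalemxAl mxtrace_mulC.
by rewrite [\tr (v *m u)]/mxtrace big_ord1.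
Qed.
End RankOne.

(** * The stabilizers W_H and their distinguished generators *)

Section Monodromy.
Variables (R : realType) (K : fieldType) (iota : {rmorphism K -> R[i]}).
Variables (gT : finGroupType) (W : {group gT}) (n : nat).
Variable rW : mx_representation K W n.
Hypothesis rW_faithful : mx_faithful rW.
Local Notation C := R[i].
Local Notation VC := 'rV[R[i]]_n.
Local Notation act := (wact iota rW).
Implicit Types (H : hplane rW) (z : VC).

Lemma pchar0_iota m : (m%:R == 0 :> K) = (m == 0%N).
Proof. by rewrite -(fmorph_eq0 iota) rmorph_nat pnatr_eq0. Qed.

Lemma repr_faithful w : w \in W -> rW w = 1%:M -> w = 1%g.
Proof.
move=> wW w1; have : w \in rker rW by apply/rkerP.
by move/(fintype.subsetP rW_faithful)/set1P.
Qed.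

Lemma rank_hmx H : (\rank (hmx H) = n.-1)%N.
Proof.
have [r [rW' /eqP rr ->]] := hplane_refl H.
by rewrite genmxE mxrank_ker rr subn1.
Qed.

Lemma n_gt0 H : (0 < n)%N.
Proof.
have [r [rW' /eqP rr _]] := hplane_refl H.
by rewrite -rr rank_leq_col.
Qed.

Lemma hstabP H w : reflect (w \in W /\ hmx H *m rW w = hmx H) (w \in hstab H).
Proof. by rewrite inE; apply: (iffP andP) => -[wW /eqP]. Qed.

Lemma hstab_group_set H : group_set (hstab H).
Proof.
apply/group_setP; split=> [|v w /hstabP[vW vH] /hstabP[wW wH]].
  by apply/hstabP; rewrite group1 repr_mx1 mulmx1.
by apply/hstabP; rewrite groupM // repr_mxM // mulmxA vH wH.
Qed.

Canonical hstab_group H := Group (hstab_group_set H).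

Lemma rank_hstab H w : w \in hstab H -> (\rank (rW w - 1%:M)%R <= 1)%N.
Proof.
move=> /hstabP[wW wH]; have : (hmx H <= kermx (rW w - 1%:M))%MS.
  by apply/sub_kermxP; rewrite mulmxBr mulmx1 wH subrr.
move/mxrankS; rewrite rank_hmx mxrank_ker; have := n_gt0 H.
have := rank_leq_row (rW w - 1%:M); lia.
Qed.

(** The part A = w - 1 has rank at most 1, and trace 0 by the determinant, so A^2 = 0 and w^k = 1 +
    k A. Finite order and characteristic 0 force A = 0. *)
Lemma hstab_det1 H w : w \in hstab H -> \det (rW w) = 1 -> w = 1%g.
Proof.
move=> wH d1; have wW : w \in W by have /hstabP[] := wH.
have rk := rank_hstab wH.
have tr0 : \tr (rW w - 1%:M) = 0.
  apply: (addrI 1); rewrite -rank1_det // addrC subrK d1 addr0 //.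
have A2 := rank1_sqr rk; rewrite tr0 scale0r in A2.
set A := rW w - 1%:M in A2.
have wk k : rW (w ^+ k)%g = 1%:M + A *+ k.
  elim: k => [|k IH]; first by rewrite expg0 repr_mx1 mulr0n addr0.
  rewrite expgSr repr_mxM ?groupX // IH -[rW w](subrK 1%:M) -/A mulmxDl mul1mx.
  rewrite mulmxDr mulmx1 -scaler_nat -scalemxAl A2 scaler0 add0r scaler_nat.
  by rewrite -addrA addrCA addrA -addrA -mulrS.
have := wk #[w]%g; rewrite expg_order repr_mx1 -[LHS]addr0 => /addrI/esym.
rewrite -scaler_nat => /eqP; rewrite scaler_eq0 pchar0_iota.
rewrite -leqn0 leqNgt order_gt0 /= subr_eq0 => /eqP.
exact: repr_faithful.
Qed.

Lemma hstab_det_inj H : {in hstab H &, injective (fun w => \det (rW w))}.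
Proof.
move=> v w vH wH /= e; have [vW _] := hstabP _ _ vH; have [wW _] := hstabP _ _ wH.
apply/eqP; rewrite eq_mulgV1; apply/eqP.
apply: (@hstab_det1 H); first by rewrite groupM ?groupV.
by rewrite repr_mxM ?groupV // det_mulmx e -det_mulmx -repr_mxM ?groupV //
  mulgV repr_mx1 det1.
Qed.

(** The determinant is injective on W_H, so it takes e distinct values among the e-th roots of
    unity, hence all of them. *)
Lemma hstab_gen H : exists2 s, s \in hstab H &
  iota (\det (rW s)) = expi (2 * trigo.pi / #|hstab H|%:R).
Proof.
set e := #|hstab H|; have e0 : (0 < e)%N by exact: cardG_gt0.
pose rs := [seq iota (\det (rW s)) | s <- enum (hstab H)].
have rsU : uniq rs.
  rewrite map_inj_in_uniq ?enum_uniq // => v w; rewrite !mem_enum => vH wH.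
  by move=> /fmorph_inj e1; exact: (hstab_det_inj vH wH e1).
have detX w k : w \in W -> \det (rW (w ^+ k)%g) = \det (rW w) ^+ k.
  move=> wW; elim: k => [|k IH]; first by rewrite repr_mx1 det1.
  by rewrite expgS repr_mxM ?groupX // det_mulmx IH exprS.
case: (boolP (expi (2 * trigo.pi / e%:R) \in rs)) => [/mapP[s sH ->]|nrs].
  by exists s => //; rewrite -mem_enum.
have : (size (expi (2 * trigo.pi / e%:R) :: rs) <= e)%N.
  apply: max_unity_roots => //=; last by rewrite nrs.
  rewrite unity_rootE (prim_expr_order (expi_prim _ e0)) eqxx /=.
  apply/seq.allP => x /mapP[w]; rewrite mem_enum => wH ->.
  have [wW _] := hstabP _ _ wH.
  rewrite unity_rootE -rmorphXn -detX //.
  have -> : (w ^+ e)%g = 1%g.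
    have /cardSg/dvdnP[k ek] : <[w]>%g \subset hstab_group H by rewrite cycle_subG.
    rewrite -orderE in ek; by rewrite /e ek mulnC expgM expg_order expg1n.
  by rewrite repr_mx1 det1 rmorph1.
by rewrite /= size_map -cardE ltnn.
Qed.

Lemma hstab_cycle H s : s \in hstab H ->
  iota (\det (rW s)) = expi (2 * trigo.pi / #|hstab H|%:R) ->
  hstab H = [set (s ^+ (i : 'I_#|hstab H|))%g | i : 'I_#|hstab H|] /\
  injective (fun i : 'I_#|hstab H| => (s ^+ i)%g).
Proof.
move=> sH ds; have [sW _] := hstabP _ _ sH.
have detX k : \det (rW (s ^+ k)%g) = \det (rW s) ^+ k.
  elim: k => [|k IH]; first by rewrite repr_mx1 det1.
  by rewrite expgS repr_mxM ?groupX // det_mulmx IH exprS.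
have inj : injective (fun i : 'I_#|hstab H| => (s ^+ i)%g).
  move=> i j /(congr1 (fun w => iota (\det (rW w)))).
  rewrite !detX !rmorphXn ds => /eqP.
  rewrite (eq_prim_root_expr (expi_prim _ (cardG_gt0 _))).
  by rewrite !modn_small // => /eqP/val_inj.
split=> //; apply/esym/eqP; rewrite eqEcard card_imset // card_ord leqnn andbT.
by apply/fintype.subsetP => _ /imsetP[i _ ->]; rewrite groupX.
Qed.

Lemma hstab_gt1 H : (1 < #|hstab H|)%N.
Proof.
have [r [rW' rr HE]] := hplane_refl H.
have rH : r \in hstab H.
  apply/hstabP; split=> //; apply/eqP; rewrite -subr_eq0.
  rewrite -[X in _ - X]mulmx1 -mulmxBr HE; apply/eqP/sub_kermxP.
  by rewrite genmxE.
rewrite cardG_gt1; apply/trivgPn; exists r => //.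
by apply: contraTneq rr => ->; rewrite /is_refl repr_mx1 subrr mxrank0.
Qed.

Lemma hproj_eigen H s z : s \in hstab H ->
  iota (\det (rW s)) = expi (2 * trigo.pi / #|hstab H|%:R) ->
  let l := iota (\det (rW s)) in let A := map_mx iota (rW s - 1%:M) in
  [/\ l != 1, A *m A = (l - 1) *: A & hproj iota H z = z - (l - 1)^-1 *: (z *m A)].
Proof.
move=> sH ds l A; set e := #|hstab H| in ds.
have [sW _] := hstabP _ _ sH.
have e1 : (1 < e)%N by exact: hstab_gt1.
have e0 : (0 < e)%N by exact: ltnW.
have lp : e.-primitive_root l by rewrite /l ds; exact: expi_prim.
have l1 : l != 1.
  by rewrite -[l]expr1 -[1](expr0 l) (eq_prim_root_expr lp) !modn_small.
have lS1 : l - 1 != 0 by rewrite subr_eq0.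
have A2 : A *m A = (l - 1) *: A.
  rewrite -map_mxM rank1_sqr ?(rank_hstab sH) // map_mxZ; congr (_ *: _).
  apply: (addrI 1); rewrite [RHS]addrC subrK /l -[1](rmorph1 iota) -rmorphD.
  by rewrite -rank1_det ?(rank_hstab sH) // addrC subrK.
have sX k : map_mx iota (rW (s ^+ k)%g) = 1%:M + (\sum_(i < k) l ^+ i) *: A.
  elim: k => [|k IH]; first by rewrite repr_mx1 map_mx1 big_ord0 scale0r addr0.
  rewrite expgSr repr_mxM ?groupX // map_mxM IH -[rW s](subrK 1%:M).
  rewrite map_mxD map_mx1 -/A mulmxDr mulmx1 mulmxDl mul1mx -scalemxAl A2.
  rewrite big_ord_recr /= scalerA addrCA; congr (_ + _).
  rewrite -[l ^+ k](subrK 1) subrX1 !scalerDl scale1r.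
  by rewrite [_ * (l - 1)]mulrC addrC [A + _]addrC.
split => //; have [hE hI] := hstab_cycle sH ds.
rewrite /hproj [in X in \sum_(w in X) _]hE big_imset /=; last by move=> i j _ _ /hI.
under eq_bigr do rewrite /wact sX mulmxDr mulmx1 -scalemxAr.
rewrite big_split /= sumr_const card_ord -/e -[z *+ _]scaler_nat scalerDr scalerA.
rewrite mulVf ?pnatr_eq0 -?lt0n // scale1r -scaler_suml scalerA -scaleNr.
congr (_ + _ *: _).
have c_ k : \sum_(i < k) l ^+ i = (l ^+ k - 1) / (l - 1).
  by rewrite subrX1 mulrC mulKf.
under eq_bigr do rewrite c_.
rewrite -mulr_suml sumrB c_ (prim_expr_order lp) subrr mul0r sumr_const card_ord.
by rewrite sub0r mulrA mulrN mulVf ?pnatr_eq0 -?lt0n // mulN1r.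
Qed.

Lemma on_hplane_fix H s z : s \in hstab H -> s != 1%g ->
  on_hplane iota z H = (z *m map_mx iota (rW s - 1%:M) == 0).
Proof.
move=> sH s1; have [sW sHE] := hstabP _ _ sH.
have Hk : (hmx H == kermx (rW s - 1%:M))%MS.
  rewrite -mxrank_leqif_eq; last by apply/sub_kermxP; rewrite mulmxBr mulmx1 sHE subrr.
  rewrite rank_hmx mxrank_ker; have := rank_hstab sH.
  case: (posnP (\rank (rW s - 1%:M)%R)) => [/eqP|]; last by lia.
  rewrite mxrank_eq0 subr_eq0 => /eqP /(repr_faithful sW) s1'.
  by rewrite s1' eqxx in s1.
rewrite /on_hplane -(sameP sub_kermxP eqP) -map_kermx.
have : (map_mx iota (hmx H) == map_mx iota (kermx (rW s - 1%:M)))%MS.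
  by rewrite !map_submx.
by move/eqmxP => ->.
Qed.

Lemma expi_frac_neq1 H s : s \in hstab H ->
  iota (\det (rW s)) = expi (2 * trigo.pi / #|hstab H|%:R) -> s != 1%g.
Proof.
move=> sH ds; apply: contraTneq (hstab_gt1 H) => s1.
have [l1 _ _] := hproj_eigen 0 sH ds.
by move: l1; rewrite s1 repr_mx1 det1 rmorph1 eqxx.
Qed.

Variable x0 : Vreg iota rW.

(** The part of x1 that turns is an eigenvector of s for l outside H, so the path avoids H and ends
    at x1 s, the last factor being l; [close_to] takes care of the other hyperplanes. *)
Lemma turn_path H s x1 : s \in hstab H ->
  iota (\det (rW s)) = expi (2 * trigo.pi / #|hstab H|%:R) ->
  Vreg iota rW x1 -> close_to iota H x1 ->
  Vreg_path iota rW x1 (act x1 s) (partial_turn iota H x1).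
Proof.
move=> sH ds x1V x1c; have [sW _] := hstabP _ _ sH.
have [l1 A2 hpE] := hproj_eigen x1 sH ds.
set l := iota _ in l1 A2 hpE; set A := map_mx _ _ in A2 hpE.
have lS1 : l - 1 != 0 by rewrite subr_eq0.
have s1 := expi_frac_neq1 sH ds.
set p := hproj iota H x1 in hpE *.
have dE : x1 - p = (l - 1)^-1 *: (x1 *m A) by rewrite hpE opprB addrC subrK.
split; last first.
  move=> t tI H'; have [->|H'H] := eqVneq H' H.
    rewrite (on_hplane_fix _ sH s1) -/A mulmxDl.
    have -> : p *m A = 0.
      by rewrite hpE mulmxBl -scalemxAl -mulmxA A2 -scalemxAr scalerA mulVf // scale1r subrr.
    rewrite add0r -scalemxAl scaler_eq0 negb_or.
    rewrite -normr_eq0 expi_norm oner_eq0 /= dE -scalemxAl -mulmxA A2 -scalemxAr.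
    rewrite scalerA mulVf // scale1r -(on_hplane_fix _ sH s1); exact: x1V.
  by apply: x1c => //; rewrite expi_norm.
split.
- apply: continuous_subspaceT => t; apply: cvg_mx => i j; rewrite /partial_turn.
  rewrite !mxE; under eq_fun do rewrite !mxE.
  apply: cvgD; first exact: cvg_cst.
  apply: cvgM; last exact: cvg_cst.
  apply: (@cvg_comp _ _ _ (fun t : R => 2 * trigo.pi * t / #|hstab H|%:R) (@expi R));
    last exact: continuous_expi.
  by apply: cvgM; [apply: cvgM; [exact: cvg_cst|exact: cvg_id]|exact: cvg_cst].
- by rewrite /partial_turn mulr0 mul0r expi0 scale1r addrC subrK.
- rewrite /partial_turn mulr1 -ds -/l -/p dE /wact -[rW s](subrK 1%:M).
  rewrite map_mxD map_mx1 -/A mulmxDr mulmx1 addrC [in RHS]addrC hpE.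
  rewrite addrCA; congr (_ + _); rewrite scalerA -scalerBl -[RHS]scale1r.
  by congr (_ *: _); rewrite -[X in _ - X]mul1r -mulrBl divff.
Qed.

End Monodromy.

(** * Existence of monodromy generators and lifting of W *)

Section MonodromyExists.
Variables (R : realType) (K : fieldType) (iota : {rmorphism K -> R[i]}).
Variables (gT : finGroupType) (W : {group gT}) (n : nat).
Variable rW : mx_representation K W n.
Hypothesis rW_faithful : mx_faithful rW.
Local Notation C := R[i].
Local Notation VC := 'rV[R[i]]_n.
Local Notation act := (wact iota rW).
Implicit Types (H : hplane rW) (z : VC).

Definition lin (u : 'cV[C]_n) z : C := (z *m u) 0 0.

Lemma linD u y z : lin u (y + z) = lin u y + lin u z.
Proof. by rewrite /lin mulmxDl mxE. Qed.

Lemma linZ u a z : lin u (a *: z) = a * lin u z.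
Proof. by rewrite /lin -scalemxAl mxE. Qed.

Lemma lin_sum u I (r : seq I) (P : pred I) (F : I -> VC) :
  lin u (\sum_(i <- r | P i) F i) = \sum_(i <- r | P i) lin u (F i).
Proof.
apply: (big_morph (lin u) (linD u)).
by rewrite -(scale0r (0 : VC)) linZ mul0r.
Qed.

Lemma hplane_lin H : exists u, forall z, on_hplane iota z H = (lin u z == 0).
Proof.
have [r [rW' /eqP rr HE]] := hplane_refl H.
have [u [v uv]] : exists (u : 'cV[C]_n) (v : 'rV[C]_n),
    map_mx iota (rW r - 1%:M) = u *m v.
  by apply: rank1_factor; rewrite mxrank_map rr.
have v0 : v != 0.
  apply: contra_eq_neq rr => v0; rewrite -(mxrank_map iota) uv v0 mulmx0 mxrank0.
  by [].
exists u => z; rewrite (on_hplaneE _ _ HE) -subr_eq0.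
have -> : act z r - z = z *m map_mx iota (rW r - 1%:M).
  by rewrite map_mxB map_mx1 mulmxBr mulmx1.
rewrite uv mulmxA [z *m u]mx11_scalar mul_scalar_mx scaler_eq0 (negPf v0) orbF.
by [].
Qed.

(** Otherwise H is contained in H', of the same dimension, and their canonical matrices coincide. *)
Lemma hplane_sep H H' : H' != H -> exists z, on_hplane iota z H && ~~ on_hplane iota z H'.
Proof.
move=> HH'; apply/not_existsP => h; move/eqP: HH'; apply.
have sub : (map_mx iota (hmx H) <= map_mx iota (hmx H'))%MS.
  apply/row_subP => i; have := h (row i (map_mx iota (hmx H))).
  by rewrite /on_hplane row_sub /= => /negP/negPn.
rewrite map_submx in sub.
have [r [_ _ HE]] := hplane_refl H; have [r' [_ _ HE']] := hplane_refl H'.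
apply: val_inj; change (hmx H' = hmx H).
have gH : <<hmx H>>%MS = hmx H by rewrite HE genmx_id.
have gH' : <<hmx H'>>%MS = hmx H' by rewrite HE' genmx_id.
rewrite -gH -gH'; apply/esym.
apply/eq_genmx/eqmxP; rewrite sub /=.
by have [_ <-] := mxrank_leqif_sup sub; rewrite !rank_hmx.
Qed.

(* A Vandermonde-type combination of points separating H from each other
   hyperplane: its value on each linear form is a nonzero polynomial in x. *)
Lemma generic_point H : exists p, on_hplane iota p H /\
  forall H', H' != H -> ~~ on_hplane iota p H'.
Proof.
have [u uE] := choice (hplane_lin).
have [p pE] : exists p : hplane rW -> VC, forall H', H' != H ->
    on_hplane iota (p H') H && ~~ on_hplane iota (p H') H'.
  suff : forall H', exists p, H' != H -> on_hplane iota p H && ~~ on_hplane iota p H'.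
    by move=> /choice[p pE]; exists p.
  move=> H'; have [->|/hplane_sep[z zE]] := eqVneq H' H; first by exists 0.
  by exists z.
pose q H' : {poly C} := \sum_(J | J != H) lin (u H') (p J) *: 'X^(enum_rank J).
have qx H' x : (q H').[x] = lin (u H') (\sum_(J | J != H) x ^+ enum_rank J *: p J).
  rewrite lin_sum horner_sum; apply: eq_bigr => J _.
  by rewrite linZ hornerZ hornerXn mulrC.
have q0 : \prod_(H' | H' != H) q H' != 0.
  apply/prodf_neq0 => H' H'H; apply/eqP => /(congr1 (coefp (enum_rank H'))).
  rewrite /= coef0 coef_sum (bigD1 H') //= big1 ?addr0 => [|J /andP[_ JH']].
    rewrite coefZ coefXn eqxx mulr1 => /eqP.
    by have /andP[_] := pE _ H'H; rewrite uE => /negPf ->.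
  rewrite coefZ coefXn (inj_eq val_inj) (inj_eq enum_rank_inj) eq_sym.
  by rewrite (negPf JH') mulr0.
have [x xr] := closed_nonrootP _ q0.
exists (\sum_(J | J != H) x ^+ enum_rank J *: p J); split.
  rewrite uE lin_sum big1 // => J JH; rewrite linZ.
  by have /andP[+ _] := pE _ JH; rewrite uE => /eqP ->; rewrite mulr0.
move=> H' H'H; rewrite uE -qx; apply: contra xr => q'0.
by rewrite /root horner_prod (bigD1 H') //= (eqP q'0) mul0r.
Qed.

Variable x0 : Vreg iota rW.

(** The point is p + eps v, with p generic on H and v an eigenvector of s outside H: its projection
    onto H is p, and eps v is the part that turns. *)
Lemma close_point H : exists x1, Vreg iota rW x1 /\ close_to iota H x1.
Proof.
have [u uE] := choice (hplane_lin).
have [p [pH pH']] := generic_point H.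
have [s sH ds] := hstab_gen iota rW_faithful H.
have [l1 A2 _] := hproj_eigen rW_faithful 0 sH ds.
have hpE z := (hproj_eigen rW_faithful z sH ds).
set l := iota _ in l1 A2 hpE; set A := map_mx _ _ in A2 hpE.
have s1 := expi_frac_neq1 rW_faithful sH ds.
have lS1 : l - 1 != 0 by rewrite subr_eq0.
have [v vA] : exists v : VC, v *m A = (l - 1) *: v /\ ~~ on_hplane iota v H.
  have A0 : A != 0.
    rewrite map_mx_eq0 subr_eq0; apply: contra_neqN s1 => /eqP.
    by have [sW _] := hstabP _ _ sH; exact: repr_faithful.
  have [i iA] : exists i, row i A != 0.
    apply/not_existsP => h; case/negP: A0; apply/eqP/row_matrixP => i.
    by rewrite row0; have /negP/negPn/eqP := h i.
  exists (row i A); have e : row i A *m A = (l - 1) *: row i A.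
    by rewrite -row_mul A2; apply/rowP => j; rewrite !mxE.
  split=> //; rewrite (on_hplane_fix iota rW_faithful _ sH s1) -/A e.
  by rewrite scaler_eq0 negb_or lS1.
case: vA => vA vH.
(* This ratio lies in ]0, 1] and its product with |u(v)| is less than |u(p)|, even if u(v) = 0. The
   product [eps] of the ratios is positive and at most each of them. *)
pose del H' : C := `|lin (u H') p| / (`|lin (u H') p| + `|lin (u H') v|).
have lp H' : H' != H -> 0 < `|lin (u H') p|.
  by move=> /pH'; rewrite uE normr_gt0.
have den H' : H' != H -> 0 < `|lin (u H') p| + `|lin (u H') v|.
  by move=> /lp h; rewrite ltr_wpDr.
have del01 H' : H' != H -> 0 < del H' <= 1.
  move=> h; rewrite divr_gt0 ?lp ?den //= ler_pdivrMr ?den // mul1r lerDl.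
  exact: normr_ge0.
pose eps := \prod_(H' | H' != H) del H'.
have eps0 : 0 < eps by apply: prodr_gt0 => H' /del01/andP[].
have epsd H' : H' != H -> eps <= del H'.
  move=> h; rewrite /eps (bigD1 H') //= ger_pMr; last by have /andP[] := del01 _ h.
  apply: prodr_ile1 => J /andP[/del01/andP[d0 d1] _].
  by rewrite (ltW d0).
have hp1 : hproj iota H (p + eps *: v) = p.
  have [_ _ ->] := hpE (p + eps *: v).
  rewrite mulmxDl -scalemxAl vA.
  move: pH; rewrite (on_hplane_fix iota rW_faithful _ sH s1) -/A => /eqP ->.
  have -> : eps *: ((l - 1) *: v) = (l - 1) *: (eps *: v) by rewrite !scalerA mulrC.
  by rewrite add0r scalerA mulVf // scale1r addrK.
have far (z : C) H' : `|z| <= 1 -> H' != H -> ~~ on_hplane iota (p + z *: (eps *: v)) H'.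
  move=> z1 h; rewrite uE linD linZ linZ addrC addr_eq0.
  apply/eqP => /(congr1 Num.Def.normr); rewrite normrN => e.
  have : `|z * (eps * lin (u H') v)| < `|lin (u H') p|.
    rewrite !normrM (gtr0_norm eps0).
    apply: (@le_lt_trans _ _ (del H' * `|lin (u H') v|)).
      rewrite mulrA ler_wpM2r ?normr_ge0 // -[del H']mul1r.
      by apply: ler_pM; rewrite ?normr_ge0 ?(ltW eps0) ?epsd.
    rewrite /del mulrAC ltr_pdivrMr ?den // ltr_pM2l ?lp //.
    by rewrite ltrDr lp.
  by rewrite e ltxx.
exists (p + eps *: v); split.
  move=> H'; have [->|h] := eqVneq H' H; last first.
    by have := far 1 H'; rewrite normr1 scale1r; apply.
  rewrite uE linD linZ; move: pH; rewrite uE => /eqP ->.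
  by rewrite add0r; apply: mulf_neq0; [rewrite gt_eqF|rewrite -uE].
move=> z z1 H' h; rewrite hp1.
have -> : p + eps *: v - p = eps *: v by rewrite addrAC subrr add0r.
exact: far.
Qed.

(* In the complex line through x0 and x1, each hyperplane excludes one parameter;
   the parabola t + i a t (1 - t) from 0 to 1 avoids all of them for a suitable a. *)
Lemma path_exists x1 : Vreg iota rW x1 ->
  exists c, Vreg_path iota rW (val x0) x1 c.
Proof.
move=> x1V; have [u uE] := choice (hplane_lin).
pose y0 := val x0; pose bet H := lin (u H) y0 / (lin (u H) y0 - lin (u H) x1).
(* The value of [a] for which the parabola meets the parameter [bet H], at t = Re [bet H]. The
   quotient is 0 by convention if this t is 0 or 1, but then the point is [y0] or [x1], already
   known to be off the hyperplanes. *)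
pose bad H : R := complex.Im (bet H) / (complex.Re (bet H) * (1 - complex.Re (bet H))).
pose a : R := 1 + \sum_H `|bad H|.
have abad H : a != bad H.
  rewrite gt_eqF // /a (bigD1 H) //=; apply: le_lt_trans (ler_norm _) _.
  rewrite addrCA ltrDl ltr_wpDr // sumr_ge0 // => J _; exact: normr_ge0.
pose zt (t : R) : C := Complex t (a * (t * (1 - t))).
exists (fun t => y0 + zt t *: (x1 - y0)); split; last first.
  move=> t; rewrite in_itv /= => /andP[t0 t1] H.
  rewrite uE linD linZ -scaleN1r linD linZ mulN1r.
  have u0 : lin (u H) y0 != 0 by rewrite -uE; exact: (val_x0 x0).
  have u1 : lin (u H) x1 != 0 by rewrite -uE.
  apply/eqP => e.
  have d0 : lin (u H) y0 - lin (u H) x1 != 0.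
    apply: contra_neq u0 => /eqP; rewrite subr_eq0 => /eqP d.
    by move: e; rewrite d subrr mulr0 addr0.
  have ztE : zt t = bet H.
    apply: (mulIf d0); rewrite /bet divfK //.
    by apply/eqP; rewrite eq_sym -subr_eq0 -mulrN opprB; apply/eqP.
  have tE : t = complex.Re (bet H) by rewrite -ztE.
  have iE : a * (t * (1 - t)) = complex.Im (bet H) by rewrite -ztE.
  have tt0 : t * (1 - t) != 0.
    rewrite mulf_eq0 negb_or subr_eq0; apply/andP; split.
      apply: contra_neq u0 => tt; move: e.
      rewrite /zt tt mul0r mulr0 (_ : Complex 0 0 = 0) // mul0r addr0.
      by [].
    apply: contra_neq u1 => tt; move: e.
    rewrite /zt -tt subrr !mulr0 (_ : Complex 1 0 = 1) // mul1r addrC subrK.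
    by [].
  by case/eqP: (abad H); rewrite /bad -iE -tE mulfK.
have zt_cont : continuous zt.
  have -> : zt = fun t => t%:C%C + 'i%C * (a * (t * (1 - t)))%:C%C.
    by apply/funext => t; rewrite [LHS]complexE.
  move=> t; apply: cvgD; first exact: ofreal_continuous.
  apply: cvgM; first exact: cvg_cst.
  apply: (@cvg_comp _ _ _ (fun t : R => a * (t * (1 - t))) (fun r => r%:C%C));
    last exact: ofreal_continuous.
  apply: cvgM; first exact: cvg_cst.
  by apply: cvgM; [exact: cvg_id|apply: cvgB; [exact: cvg_cst|exact: cvg_id]].
split.
- apply: continuous_subspaceT => t; apply: cvg_mx => i j.
  rewrite !mxE; under eq_fun do rewrite !mxE.
  apply: cvgD; first exact: cvg_cst.
  by apply: cvgM; [exact: zt_cont|exact: cvg_cst].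
- by rewrite /zt mul0r mulr0 (_ : Complex 0 0 = 0) // scale0r addr0.
- rewrite /zt subrr !mulr0 (_ : Complex 1 0 = 1) // scale1r addrC subrK.
  by [].
Qed.

Lemma monodromy_exists H : exists (Cl : horbit rW) b s,
  [/\ H \in val Cl, monodromy x0 Cl b, s \in hstab H,
    iota (\det (rW s)) = expi (2 * trigo.pi / #|hstab H|%:R) & path_lift b s].
Proof.
have HC : [exists H', horbit_of H == horbit_of H'] by apply/existsP; exists H.
pose Cl : horbit rW := exist _ (horbit_of H) HC.
have HCl : H \in val Cl.
  rewrite inE; apply/existsP; exists 1%g; rewrite group1 /= repr_mx1 mulmx1.
  by have [r [_ _ HE]] := hplane_refl H; rewrite HE genmx_id.
have [s sH ds] := hstab_gen iota rW_faithful H.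
have [x1 [x1V x1c]] := close_point H.
have [c pc] := path_exists x1V.
pose b := braid_of x0 (path_cat c (path_cat (partial_turn iota H x1)
                                         (fun t => act (path_rev c t) s))).
have [sW _] := hstabP _ _ sH.
exists Cl, b, s; split => //; first by exists H, s, x1, c; split.
split => //; exists (path_cat c (path_cat (partial_turn iota H x1)
                                         (fun t => act (path_rev c t) s))).
split=> //; apply: (Vreg_path_cat pc).
apply: (Vreg_path_cat (b := act x1 s)); first exact: turn_path.
exact: Vreg_path_wact (Vreg_path_rev pc).
Qed.

Hypothesis refl_gen : W :=: <<[set w in W | is_refl rW w]>>%g.

(** Each reflection is a power of the distinguished generator of the stabilizer of its hyperplane,
    which lifts to a monodromy generator. As W is finite, products without inverses suffice. *)
Lemma monodromy_gen w : w \in W ->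
  exists (k : nat) (Cl : 'I_k -> horbit rW) (b : 'I_k -> braid_group x0),
  (forall i, monodromy x0 (Cl i) (b i)) /\ path_lift (\prod_i b i)%g w.
Proof.
pose S : {set gT} := [set v in W | `[< exists Cl b, monodromy x0 Cl b /\ path_lift b v >]].
have WS : W \subset <<S>>%g.
  suff: <<[set w in W | is_refl rW w]>>%g \subset <<S>>%g by rewrite -refl_gen.
  rewrite gen_subG; apply/fintype.subsetP => r.
  rewrite inE => /andP[rW' rr]; have [H HE] := refl_hplane rW' rr.
  have [Cl [b [s [HC mb sH ds lb]]]] := monodromy_exists H.
  have sS : s \in S.
    by rewrite inE (hstabP _ _ sH).1; apply/asboolP; exists Cl, b.
  have rH : r \in hstab H.
    apply/hstabP; split=> //; apply/eqP; rewrite -subr_eq0.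
    rewrite -[X in _ - X]mulmx1 -mulmxBr HE; apply/eqP/sub_kermxP.
    by rewrite genmxE.
  have [hE _] := hstab_cycle sH ds.
  by move: rH; rewrite hE => /imsetP[i _ ->]; rewrite groupX // mem_gen.
move=> /(fintype.subsetP WS) /gen_prodgP[k [c cS ->]].
have cE i : exists Cb : horbit rW * braid_group x0,
    monodromy x0 Cb.1 Cb.2 /\ path_lift Cb.2 (c i).
  have := cS i; rewrite inE => /andP[_ /asboolP[Cl [b [mb lb]]]].
  by exists (Cl, b).
have [Cb CbE] := choice cE.
exists k, (fun i => (Cb i).1), (fun i => (Cb i).2); split.
  by move=> i; case: (CbE i).
elim/big_ind2: _ => [|b v b' v'|i _]; [exact: lift1|exact: liftM|].
by case: (CbE i).
Qed.
End MonodromyExists.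

(** * Free algebras with a trace form *)

Section FreeAlgebra.
Variables (A : comNzRingType) (E : algType A) (S : set E) (r : nat).
Local Notation H := (quot_alg S).
Hypothesis H_free : free_of_rank S r.

Lemma free_basis : exists (e : 'I_r -> H) (co : H -> 'I_r -> A),
  [/\ forall h, h = \sum_i co h i *: e i &
      forall c : 'I_r -> A, co (\sum_i c i *: e i) =1 c].
Proof.
case: H_free => e eP.
have eE h : exists c : {ffun 'I_r -> A}, h = \sum_i c i *: e i.
  by case: (eP h) => c [hc _]; exists c.
have [co coP] := choice eE; exists e, (fun h => co h); split=> // c i.
have [c0 [_ c0U]] := eP (\sum_i c i *: e i).
have h1 := c0U _ (coP (\sum_i c i *: e i)).
rewrite -h1 (c0U [ffun j => c j]) ?ffunE //.
by apply: eq_bigr => j _; rewrite ffunE.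
Qed.

(** The regular representation by right multiplication; with coordinates as rows, the order of
    products is kept. *)
Lemma free_rep : exists rL : H -> 'M[A]_r,
  [/\ forall a h k, rL (a *: h + k) = a *: rL h + rL k,
      forall h k, rL (h * k) = rL h *m rL k & rL 1 = 1%:M].
Proof.
have [e [co [coE coU]]] := free_basis.
have coL a h k i : co (a *: h + k) i = a * co h i + co k i.
  rewrite {1}(coE h) {1}(coE k) scaler_sumr -big_split /=.
  under eq_bigr do rewrite scalerA -scalerDl.
  by rewrite coU.
have coS J (s : seq J) (F : J -> H) i : co (\sum_(j <- s) F j) i = \sum_(j <- s) co (F j) i.
  have co0 : co 0 i = 0.
    apply: (addrI (co 0 i)); rewrite addr0 -{1}[co 0 i]mul1r -coL.
    by rewrite scale1r addr0.
  apply: (big_morph (fun h => co h i) _ co0) => h k.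
  by rewrite -[h in LHS]scale1r coL mul1r.
have coZ a h i : co (a *: h) i = a * co h i.
  rewrite -[a *: h]addr0 coL.
  by have := coS _ [::] (fun i : nat => 0) i; rewrite !big_nil => ->; rewrite addr0.
exists (fun h => \matrix_(i, j) co (e i * h) j); split.
- move=> a h k; apply/matrixP => i j; rewrite !mxE mulrDr.
  by rewrite -quot_scalerAr coL.
- move=> h k; apply/matrixP => i j; rewrite !mxE mulrA {1}(coE (e i * h)) mulr_suml.
  rewrite coS; apply: eq_bigr => l _; rewrite !mxE -quot_scalerAl coZ.
  by [].
- apply/matrixP => i j; rewrite !mxE mulr1.
  have -> : e i = \sum_k (k == i)%:R *: e k.
    rewrite (bigD1 i) //= eqxx scale1r big1 ?addr0 // => k /negPf ->.
    by rewrite scale0r.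
  by rewrite coU eq_sym.
Qed.

(** The Gram matrix of x and y is the product of the coordinate matrices of x and y with the Gram
    matrix of a basis. Adjugates replace inverses, as A is any commutative ring. *)
Lemma gram_torsion (t : {scalar H}) (x y : 'I_r -> H) h :
  (forall j, t (h * y j) = 0) -> \det (\matrix_(i, j) t (x i * y j)) *: h = 0.
Proof.
have [e [co [coE coU]]] := free_basis => hy.
pose cm (z : 'I_r -> H) := \matrix_(i, j) co (z i) j.
pose M := \matrix_(i, j) t (e i * e j).
have tE z z' : t (z * z') = \sum_i co z i * \sum_j co z' j * t (e i * e j).
  rewrite {1}(coE z) mulr_suml linear_sum; apply: eq_bigr => i _.
  rewrite -quot_scalerAl linearZ /= {1}(coE z') mulr_sumr linear_sum; congr (_ * _).
  by apply: eq_bigr => j _; rewrite -quot_scalerAr linearZ.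
have -> : \matrix_(i, j) t (x i * y j) = cm x *m M *m (cm y)^T.
  apply/matrixP => i j; rewrite !mxE tE; under [RHS]eq_bigr do rewrite !mxE mulr_suml.
  rewrite exchange_big; apply: eq_bigr => k _; rewrite mulr_sumr.
  by apply: eq_bigr => l _; rewrite !mxE mulrCA mulrC.
pose c := \row_i co h i.
have cM : c *m M *m (cm y)^T = 0.
  apply/rowP => j; rewrite [RHS]mxE -[RHS](hy j) !mxE tE.
  under eq_bigr do rewrite !mxE mulr_suml.
  rewrite exchange_big; apply: eq_bigr => k _; rewrite mulr_sumr.
  by apply: eq_bigr => l _; rewrite !mxE mulrCA mulrC.
have cM0 : (\det M * \det (cm y)) *: c = 0.
  have := congr1 (mulmxr (\adj (cm y)^T)) cM; rewrite /= mul0mx -(mulmxA (c *m M)) mul_mx_adj.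
  rewrite det_tr mul_mx_scalar => /(congr1 (mulmxr (\adj M))) /=.
  by rewrite mul0mx -scalemxAl -(mulmxA c) mul_mx_adj mul_mx_scalar scalerA mulrC.
rewrite !det_mulmx det_tr (coE h) scaler_sumr big1 // => i _.
rewrite scalerA -mulrA -mulrA; have := congr1 (fun u : 'rV_r => u 0 i) cM0.
by rewrite !mxE => ->; rewrite mulr0 scale0r.
Qed.

(** Cramer's rule gives an element orthogonal to all the [y j], the difference of \det G h and a
    combination of the [x i]. It need not vanish, but [gram_torsion] kills it with a second factor
    \det G. *)
Lemma gram_span (t : {scalar H}) (x y : 'I_r -> H) h :
  let G := \matrix_(i, j) t (x i * y j) in
  let v := \row_j t (h * y j) in
  \det G ^+ 2 *: h = \sum_i (\det G * (v *m \adj G) 0 i) *: x i.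
Proof.
move=> G v; apply/eqP; rewrite -subr_eq0; apply/eqP.
pose k := \det G *: h - \sum_i (v *m \adj G) 0 i *: x i.
rewrite -[RHS](@gram_torsion t x y k); last first.
  move=> j; rewrite /k mulrBl mulr_suml linearB /= -quot_scalerAl linearZ linear_sum.
  have := congr1 (fun u : 'rV_r => u 0 j) (mulmxA v (\adj G) G).
  rewrite mul_adj_mx mul_mx_scalar mxE [v 0 j]mxE mxE.
  move=> /= ->; apply/eqP; rewrite subr_eq0; apply/eqP.
  by apply: eq_bigr => i _; rewrite -quot_scalerAl linearZ /= [G i j]mxE.
rewrite -/G /k scalerBr scalerA -expr2; congr (_ - _).
by rewrite scaler_sumr; apply: eq_bigr => i _; rewrite scalerA.
Qed.

Lemma gram_indep (t : {scalar H}) (x y : 'I_r -> H) (c : 'I_r -> A) :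
  \sum_i c i *: x i = 0 ->
  forall i, \det (\matrix_(i, j) t (x i * y j)) * c i = 0.
Proof.
set G := \matrix_(i, j) _ => cx i; pose v := \row_i c i.
have vG : v *m G = 0.
  apply/rowP => j; rewrite !mxE -[RHS](linear0 t) -[X in t X](mul0r (y j)) -cx.
  rewrite mulr_suml linear_sum; apply: eq_bigr => k _.
  by rewrite -quot_scalerAl linearZ !mxE.
have := congr1 (mulmxr (\adj G)) vG.
rewrite /= mul0mx -mulmxA mul_mx_adj mul_mx_scalar => /(congr1 (fun u : 'rV_r => u 0 i)).
by rewrite !mxE.
Qed.
End FreeAlgebra.

(** * The degree on K(y) *)

Section FractionDegree.
Variable K : fieldType.
Local Notation F := {fraction {poly K}}.
Local Notation num f := (fraction.frac (repr f)).1.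
Local Notation den f := (fraction.frac (repr f)).2.

Lemma frac_repr (f : F) : f = tofrac (num f) / tofrac (den f).
Proof.
have d0 : tofrac (den f) != 0 by rewrite tofrac_eq0 denom_ratioP.
apply: (mulIf d0); rewrite divfK //; set x := repr f; rewrite -[f]reprK -/x.
rewrite /GRing.mul /= !piE.
apply/eqP; rewrite FracField.equivf_def /= /FracField.mulf.
rewrite !numden_Ratio ?oner_neq0 ?mulr1 ?mulf_neq0 ?denom_ratioP //.
by rewrite mulrC.
Qed.

(** Degree of a rational function. Sizes are degrees plus one, which cancels as long as f is
    nonzero; the product rules below assume this. *)
Definition vdeg (f : F) : int := (size (num f))%:Z - (size (den f))%:Z.

Lemma vdegE (p q : {poly K}) : p != 0 -> q != 0 ->
  vdeg (tofrac p / tofrac q) = (size p)%:Z - (size q)%:Z.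
Proof.
move=> p0 q0; set f := _ / _; rewrite /vdeg.
have q0' : tofrac q != 0 by rewrite tofrac_eq0.
have := frac_repr f; set n := num f; set d := den f => fE.
have d0 : d != 0 by exact: denom_ratioP.
have d0' : tofrac d != 0 by rewrite tofrac_eq0.
have e : p * d = n * q.
  have cross (L : fieldType) (a b c k : L) :
      b != 0 -> k != 0 -> a / b = c / k -> a * k = c * b.
    by move=> b0 k0 /eqP; rewrite eqr_div // => /eqP.
  apply/eqP; rewrite -tofrac_eq; apply/eqP; rewrite !tofracM.
  exact: (cross _ _ _ _ _ q0' d0' fE).
have n0 : n != 0.
  apply/eqP => n0; move/eqP: e; rewrite n0 mul0r mulf_eq0 (negPf p0).
  by rewrite (negPf d0).
have := congr1 (fun r : {poly K} => size r) e; rewrite !size_mul //.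
move: p0 q0 n0 d0; rewrite -!size_poly_gt0.
move: (size p) (size q) (size n) (size d) => a b c e' ? ? ? ?; lia.
Qed.

Lemma vdegM f g : f != 0 -> g != 0 -> vdeg (f * g) = vdeg f + vdeg g.
Proof.
rewrite (frac_repr f) (frac_repr g); set a := num f; set b := den f.
set c := num g; set d := den g => f0 g0.
have b0 : b != 0 by exact: denom_ratioP.
have d0 : d != 0 by exact: denom_ratioP.
have a0 : a != 0 by move: f0; apply: contra_neq => ->; rewrite tofrac0 mul0r.
have c0 : c != 0 by move: g0; apply: contra_neq => ->; rewrite tofrac0 mul0r.
rewrite mulf_div -!tofracM !vdegE ?mulf_neq0 // !size_mul //.
move: a0 b0 c0 d0; rewrite -!size_poly_gt0.
by move: (size a) (size b) (size c) (size d) => k l m p ? ? ? ?; lia.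
Qed.

Lemma vdeg1 : vdeg 1 = 0.
Proof. by rewrite -[1](divr1 1) -tofrac1 vdegE ?oner_neq0 // subrr. Qed.

Lemma vdegX f k : f != 0 -> vdeg (f ^+ k) = vdeg f * k%:Z.
Proof.
move=> f0; elim: k => [|k IH]; first by rewrite mulr0 vdeg1.
by rewrite exprS vdegM ?expf_neq0 // IH; lia.
Qed.

Lemma vdeg_X : vdeg (tofrac 'X) = 1.
Proof.
rewrite -[tofrac _]divr1 -tofrac1 vdegE ?polyX_eq0 ?oner_neq0 //.
by rewrite size_polyX size_poly1.
Qed.
End FractionDegree.

Section SubstTheory.
Variable I : finType.
Local Notation Z := {ffun I -> int}.
Local Notation L := (laurent int I).

Lemma lmon_units (w : I -> Z) i : (lmon int (w i) : L) \is a GRing.unit.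
Proof. exact: lmon_unit. Qed.

Definition lsubstm (w : I -> Z) : {rmorphism L -> L} :=
  leval intr (lmon_units w).

Lemma lsubstmE w f : lsubstm w f = lsubst w f.
Proof. by []. Qed.

Lemma lsubst_lmon (w : I -> Z) k : lsubst w (lmon int k) = lmon int (\sum_i w i *~ k i).
Proof.
rewrite -lsubstmE lmonE rmorph_prod /= -lmon_prod; apply: eq_bigr => i _.
rewrite (rmorphXz (lsubstm w)); last exact: lvar_unit.
by rewrite /= leval_lvar lmonX.
Qed.

Lemma lsubst_lvar (w : I -> Z) i : lsubst w (lvar i) = lmon int (w i).
Proof. exact: (leval_lvar intr (lmon_units w)). Qed.

Lemma leval_lsubst (S : comUnitRingType) (x : I -> S) (xU : forall i, x i \is a GRing.unit)
    (w : I -> Z) f :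
  laurent_eval intr x (lsubst w f) =
  laurent_eval intr (fun i => laurent_eval intr x (lmon int (w i))) f.
Proof.
pose ev : {rmorphism L -> S} := leval intr xU.
apply: (rmorph_laurent_eval (psi := ev)); first exact: lmon_units.
by move=> a; rewrite rmorph_int.
Qed.

Lemma laurent_eval_lmon (S : comUnitRingType) (x : I -> S) k :
  laurent_eval intr x (lmon int k) = \prod_i x i ^ k i.
Proof. by rewrite /laurent_eval msuppU oner_eq0 big_seq_fset1 mcoeffUU mul1r. Qed.

Lemma lsubst_comp (w w' : I -> Z) f :
  lsubst w' (lsubst w f) = lsubst (fun i => \sum_j w' j *~ w i j) f.
Proof.
rewrite /lsubst (leval_lsubst (lmon_units w')).
by apply: eq_laurent_eval => // i; exact: lsubst_lmon.
Qed.

Lemma lsubst_id (f : L) : lsubst (fun i : I => [ffun j => (j == i)%:Z]) f = f.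
Proof.
rewrite -[RHS]laurent_eval_id /lsubst; apply: eq_laurent_eval => // a.
by rewrite /= -[a in RHS]intz scaler_int.
Qed.

Lemma eq_lsubst (w w' : I -> Z) f : w =1 w' -> lsubst w f = lsubst w' f.
Proof. by move=> /funext ->. Qed.

Lemma sum_delta (k : Z) : \sum_j [ffun i => (i == j)%:Z] *~ k j = k.
Proof.
apply/ffunP => i; rewrite sum_ffunE (bigD1 i) //= big1 ?addr0 => [|j ji].
  by rewrite ffunMzE ffunE eqxx intz.
by rewrite ffunMzE ffunE eq_sym (negPf ji) mul0rz.
Qed.
End SubstTheory.

(** * The root of unity zeta_(e_C) *)

Section HeckeConstants.
Variables (R : realType) (K : fieldType) (iota : {rmorphism K -> R[i]}).
Variables (gT : finGroupType) (W : {group gT}) (n : nat).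
Variables (rW : mx_representation K W n).
Hypothesis rW_faithful : mx_faithful rW.
Implicit Types C : horbit rW.
Local Notation zeta := (zeta iota).

Lemma horder_attained C : exists2 H, H \in val C & #|hstab H| = horder C.
Proof.
have [H0 H0C] : exists H, H \in val C.
  have /existsP[H /eqP ->] := valP C; exists H.
  rewrite inE; apply/existsP; exists 1%g; rewrite group1 /= repr_mx1 mulmx1.
  by have [r [_ _ HE]] := hplane_refl H; rewrite HE genmx_id.
have [|H HC e] := @eq_bigmax_cond _ (mem (val C)) (fun H => #|hstab H|).
  by apply/card_gt0P; exists H0.
by exists H.
Qed.

Lemma horder_gt1 C : (1 < horder C)%N.
Proof. by have [H _ <-] := horder_attained C; exact: hstab_gt1. Qed.

(** A generator of a W_H of order e_C supplies the root of unity: its determinant is a root of X^e -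
    1, hence integral over Z, so the default 0 of [zeta] does not occur. *)
Lemma zeta_spec C : iota (val (zeta (horder C))) = expi (2 * trigo.pi / (horder C)%:R).
Proof.
have [H _ e] := horder_attained C; have [s sH ds] := hstab_gen iota rW_faithful H.
rewrite /zeta; case: xgetP => // no; exfalso.
rewrite e in ds; have e0 : (0 < horder C)%N := ltnW (horder_gt1 C).
have zi : ZKpred (\det (rW s)).
  apply/asboolP; exists ('X^(horder C) - 1); first exact: monicXnsubC.
  rewrite rmorphB rmorph1 /= map_polyXn rootE !hornerE.
  rewrite subr_eq0 -(inj_eq (fmorph_inj iota)) rmorphXn ds.
  by rewrite (prim_expr_order (expi_prim _ e0)) rmorph1.
by have := no (exist _ (\det (rW s)) zi); apply.
Qed.

Lemma zeta_prim C : (horder C).-primitive_root (val (zeta (horder C))).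
Proof.
rewrite -(fmorph_primitive_root iota) zeta_spec.
exact/expi_prim/ltnW/horder_gt1.
Qed.

Lemma zeta_order C : zeta (horder C) ^+ horder C = 1.
Proof.
apply: val_inj; rewrite rmorphXn /= (prim_expr_order (zeta_prim C)).
by [].
Qed.
End HeckeConstants.

(** * The canonical form of the generic Hecke algebra *)

(** E is not commutative, but the factors are values at [h] of polynomials in one variable, whose
    product can be reordered. *)
Lemma prod_linear_perm (A : comNzRingType) (E : algType A) (h : E) e (c : 'I_e -> A)
    (p : 'I_e -> 'I_e) : injective p ->
  \prod_j (h - (c (p j))%:A) = \prod_j (h - (c j)%:A).
Proof.
move=> pI; have lin a : h - a%:A = horner_alg h ('X - a%:P).
  by rewrite rmorphB /= horner_algX horner_algC.
under eq_bigr do rewrite lin; under [RHS]eq_bigr do rewrite lin.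
rewrite -!(rmorph_prod (horner_alg h)); congr (horner_alg h _).
by rewrite [RHS](reindex_inj pI).
Qed.

Lemma quot_prodZ (A : comNzRingType) (E : algType A) (S : set E) e (a : A)
    (F : 'I_e -> quot_alg S) :
  \prod_j (a *: F j) = a ^+ e *: \prod_j F j.
Proof.
elim: e F => [|e IH] F; first by rewrite !big_ord0 scale1r.
rewrite !big_ord_recl IH -quot_scalerAl -quot_scalerAr scalerA exprS.
by [].
Qed.

Section Semilinear.
Variables (A A' : pzRingType) (V : lmodType A) (V' : lmodType A').
Variables (tau : A -> A') (F : V -> V').
Hypothesis FL : forall a h k, F (a *: h + k) = tau a *: F h + F k.
Hypothesis tau1 : tau 1 = 1.

Lemma semilinear0 : F 0 = 0.
Proof.
have := FL 1 0 0; rewrite scale1r addr0 tau1 scale1r.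
by move=> /(congr1 (fun z => z - F 0)); rewrite subrr addrK.
Qed.

Lemma semilinearZ a h : F (a *: h) = tau a *: F h.
Proof. by rewrite -[a *: h]addr0 FL semilinear0 addr0. Qed.

Lemma semilinear_sum k (a : 'I_k -> A) (h : 'I_k -> V) :
  F (\sum_i a i *: h i) = \sum_i tau (a i) *: F (h i).
Proof.
elim: k a h => [|k IH] a h; first by rewrite !big_ord0 semilinear0.
by rewrite !big_ord_recl FL IH.
Qed.
End Semilinear.

Lemma scalar_of_linear (A : comNzRingType) (V : lmodType A) (f : V -> A) :
  linear_for *%R f -> exists g : {scalar V}, forall v, g v = f v.
Proof.
move=> fL; pose g : {scalar V} := HB.pack f (GRing.isLinear.Build _ _ _ _ f fL).
by exists g.
Qed.

(** To represent a linear form f by t', pull it back to the linear form tau' f Th; if t represents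
    this one by h0, then t' represents f by [Th h0]. *)
Lemma symmetrizing_twist (A : comNzRingType) (E : algType A) (S : set E)
    (t : {scalar quot_alg S}) (tau tau' : {rmorphism A -> A})
    (Th Th' : quot_alg S -> quot_alg S) :
  symmetrizing t -> cancel tau tau' -> cancel tau' tau ->
  cancel Th Th' -> cancel Th' Th ->
  (forall a h k, Th (a *: h + k) = tau a *: Th h + Th k) ->
  (forall a h k, Th' (a *: h + k) = tau' a *: Th' h + Th' k) ->
  (forall h k, Th' (h * k) = Th' h * Th' k) ->
  exists t' : {scalar quot_alg S},
    symmetrizing t' /\ forall h, t' h = tau (t (Th' h)).
Proof.
move=> [tC tN] tK tK' ThK' ThK ThL ThL' ThM'.
have t0L : linear_for *%R (fun h => tau (t (Th' h))).
  by move=> a h k; rewrite ThL' linearP rmorphD rmorphM /= tK'.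
have [t' t'E] := scalar_of_linear t0L; exists t'; split=> //.
split=> [h k|f]; first by rewrite !t'E !ThM' tC.
have f0L : linear_for *%R (fun h => tau' (f (Th h))).
  by move=> a h k; rewrite ThL linearP rmorphD rmorphM /= tK.
have [f' f'E] := scalar_of_linear f0L.
have [h0 [h0P h0U]] := tN f'; exists (Th h0); split.
  by move=> k; rewrite t'E ThM' ThK' -h0P f'E ThK tK'.
move=> h1 h1P; rewrite -[h1]ThK; congr Th; apply: h0U => k.
by rewrite f'E h1P t'E ThM' ThK' tK.
Qed.

Section MonalgSpan.
Variables (A : comNzRingType) (M : monoidType) (S : set (monalg A M)).
Local Notation H := (quot_alg S).
Local Notation T x := (quot_proj S (monalg_of A x)).
Variables (tau tau' : {rmorphism A -> A}) (Th Th' : H -> H) (chi chi' : M -> A).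

Lemma semilinear_cancel : cancel tau' tau ->
  (forall a h k, Th (a *: h + k) = tau a *: Th h + Th k) ->
  (forall a h k, Th' (a *: h + k) = tau' a *: Th' h + Th' k) ->
  (forall x, Th (T x) = chi x *: T x) -> (forall x, Th' (T x) = chi' x *: T x) ->
  (forall x, tau (chi' x) * chi x = 1) -> cancel Th' Th.
Proof.
move=> tK' ThL ThL' ThT ThT' cc h; have [k [a [x ->]]] := monalg_quot_span h.
rewrite (semilinear_sum ThL' (rmorph1 tau')) (semilinear_sum ThL (rmorph1 tau)).
apply: eq_bigr => i _; rewrite tK' ThT' (semilinearZ ThL (rmorph1 tau)) ThT.
by congr (_ *: _); rewrite scalerA cc scale1r.
Qed.

Hypothesis chi1 : chi 1%g = 1.
Hypothesis chiM : forall x y, chi (x * y)%g = chi x * chi y.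

(** A relation of degree e at x is sent to [chi x ^+ e] times the same relation with its factors
    permuted by [p]. *)
Lemma monalg_semilinear :
  (forall z, S z -> exists x e (c : 'I_e -> A) (p : 'I_e -> 'I_e),
    [/\ injective p, z = \prod_j (monalg_of A x - (c j)%:A),
      S (\prod_j (monalg_of A x - (c j)%:A)) &
      forall j, tau (c j) = chi x * c (p j)]) ->
  exists F : H -> H,
  [/\ forall a h k, F (a *: h + k) = tau a *: F h + F k,
     forall h k, F (h * k) = F h * F k, F 1 = 1 &
     forall x, F (T x) = chi x *: T x].
Proof.
move=> SP; pose X x : H := chi x *: T x.
have TM x y : T (x * y)%g = T x * T y.
  by rewrite -quot_projM; congr quot_proj; rewrite [RHS]monalgUM mulr1.
have XM x y : X (x * y)%g = X x * X y.
  by rewrite /X TM chiM -quot_scalerAl -quot_scalerAr scalerA.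
have X1 : X 1%g = 1 by rewrite /X chi1 scale1r.
have tD := rmorphD tau; have tM := rmorphM tau; have t1 := rmorph1 tau.
apply: (monalg_quot_lift tD tM t1 XM X1) => z /SP [x [e [c [p [pI -> Sz tc]]]]].
rewrite (big_morph _ (qliftM tD tM XM) (qlift1 tD t1 X1)).
have z0 : \prod_j (T x - c (p j) *: (1 : H)) = 0.
  rewrite -[RHS](quot_proj_rel Sz) -(prod_linear_perm _ c pI) quot_proj_prod.
  by apply: eq_bigr => j _; rewrite quot_projD quot_projN quot_projZ.
rewrite -[RHS](scaler0 _ (chi x ^+ e)) -z0 -quot_prodZ; apply: eq_bigr => j _.
rewrite (qliftD X tD) (qliftN X tD) (qliftZ _ tD tM) (qlift_of _ tD t1).
by rewrite (qlift1 tD t1 X1) tc scalerBr scalerA.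
Qed.
End MonalgSpan.

(** The identity t(b^-1)^* t(pi) = t(b pi) is kept by a twist: x1, x2, x3 are the new values at
    b^-1, pi and b pi, and f1, f2, f3 the old ones. *)
Lemma star_twist (A : comNzRingType) (star : A -> A) (tau : {rmorphism A -> A})
    (a a' c d f1 f2 f3 x1 x2 x3 : A) :
  {morph star : x y / x * y} -> star a = a' -> star (tau f1) = tau (star f1) ->
  star f1 * f2 = f3 -> d = a' * c ->
  x1 = a * tau f1 -> x2 = c * tau f2 -> x3 = d * tau f3 ->
  star x1 * x2 = x3.
Proof. by move=> sM <- e <- -> -> -> ->; rewrite sM e mulrACA rmorphM. Qed.

Section Hecke.
Variables (R : realType) (K : fieldType) (iota : {rmorphism K -> R[i]}).
Variables (gT : finGroupType) (W : {group gT}) (n : nat).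
Variables (rW : mx_representation K W n) (x0 : Vreg iota rW).
Local Notation B := (braid_group x0).
Local Notation ZU := (Zu rW).
Local Notation H := (quot_alg (hecke_rel x0)).
Local Notation T := (@hecke_T R K iota gT W n rW x0).
Implicit Types (C : horbit rW) (b : B).

Lemma hecke_T1 : T 1%g = 1.
Proof. by []. Qed.

Lemma hecke_TM b b' : T (b * b')%g = T b * T b'.
Proof.
rewrite /hecke_T -quot_projM; congr quot_proj.
by rewrite [RHS]monalgUM mulr1.
Qed.

Lemma ustarE (f : ZU) :
  ustar f = lsubst (fun i : paramidx rW => - [ffun j => (j == i)%:Z]) f.
Proof.
by apply: eq_laurent_eval => // i; rewrite -lmonV.
Qed.

Lemma ustarM (f g : ZU) : ustar (f * g) = ustar f * ustar g :> ZU.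
Proof. by rewrite !ustarE -lsubstmE; exact: rmorphM. Qed.

Lemma ustar_lsubst (w : paramidx rW -> {ffun paramidx rW -> int}) (f : ZU) :
  ustar (lsubst w f : ZU) = lsubst w (ustar f).
Proof.
rewrite !ustarE !lsubst_comp; apply: eq_lsubst => i.
under [RHS]eq_bigr do rewrite ffunE mulrNz.
rewrite sumrN; under eq_bigr do rewrite mulNrz.
rewrite sumrN sum_delta; congr (- _); rewrite (bigD1 i) //= ffunE eqxx mulr1z.
by rewrite big1 ?addr0 // => j /negPf ji; rewrite ffunE ji mulr0z.
Qed.

Lemma ustar_lmon k : ustar (lmon int k : ZU) = lmon int (- k) :> ZU.
Proof.
rewrite ustarE lsubst_lmon; congr lmon; under eq_bigr do rewrite mulNrz.
by rewrite sumrN sum_delta.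
Qed.

Lemma hecke_semilinear (tau : {rmorphism ZU -> ZU}) (chi : B -> ZU)
    (p : forall C, 'I_(horder C) -> 'I_(horder C)) :
  (forall C, injective (p C)) ->
  chi 1%g = 1 -> (forall b b', chi (b * b')%g = chi b * chi b') ->
  (forall C b j, monodromy x0 C b -> tau (uvar j) = chi b * uvar (p C j)) ->
  exists Th : H -> H,
  [/\ forall a h k, Th (a *: h + k) = tau a *: Th h + Th k,
     forall h k, Th (h * k) = Th h * Th k, Th 1 = 1 &
     forall b, Th (T b) = chi b *: T b].
Proof.
move=> pI chi1 chiM taup.
apply: (monalg_semilinear chi1 chiM) => z [C [b [mb ->]]].
exists b, (horder C), (fun j => uvar j), (p C); split=> //.
  by exists C, b.
by move=> j; exact: taup.
Qed.

Variable t : {scalar H}.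
Hypothesis t_hecke : hecke_form t.
Hypothesis t_uniq : forall t' : {scalar H}, hecke_form t' -> t' =1 t.

(* The form tau t Th^-1, with Th the tau-semilinear automorphism T_b |-> chi b T_b,
   is again canonical, hence equal to t. *)
Lemma hecke_twist (tau tau' : {rmorphism ZU -> ZU}) (chi chi' : B -> ZU)
    (p p' : forall C, 'I_(horder C) -> 'I_(horder C)) :
  cancel tau tau' -> cancel tau' tau ->
  (forall C, injective (p C)) -> (forall C, injective (p' C)) ->
  chi 1%g = 1 -> (forall b b', chi (b * b')%g = chi b * chi b') ->
  chi' 1%g = 1 -> (forall b b', chi' (b * b')%g = chi' b * chi' b') ->
  (forall C b j, monodromy x0 C b -> tau (uvar j) = chi b * uvar (p C j)) ->
  (forall C b j, monodromy x0 C b -> tau' (uvar j) = chi' b * uvar (p' C j)) ->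
  (forall b, tau (chi' b) * chi b = 1) -> (forall b, tau' (chi b) * chi' b = 1) ->
  (forall f, ustar (tau f) = tau (ustar f)) ->
  (forall b, ustar (tau (chi' b^-1%g)) = tau (chi' b)) ->
  (forall b w, path_lift b w ->
     group_spec iota (tau (chi' b) * tau (t (T b))) = (w == 1%g)%:R) ->
  forall b, tau (t (T b)) = chi b * t (T b).
Proof.
move=> tK tK' pI pI' c1 cM c1' cM' taup taup' cc cc' us uspsi gs b.
have [tS _ tpi0 tstar] := t_hecke.
have [Th [ThL ThM _ ThT]] := hecke_semilinear pI c1 cM taup.
have [Th' [ThL' ThM' _ ThT']] := hecke_semilinear pI' c1' cM' taup'.
have ThK : cancel Th' Th := semilinear_cancel tK' ThL ThL' ThT ThT' cc.
have ThK' : cancel Th Th' := semilinear_cancel tK ThL' ThL ThT' ThT cc'.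
have [t' [t'S t'E]] := symmetrizing_twist tS tK tK' ThK' ThK ThL ThL' ThM'.
have t'T b' : t' (T b') = tau (chi' b') * tau (t (T b')).
  by rewrite t'E ThT' linearZ; exact: rmorphM.
have psi1 b' : chi b' * tau (chi' b') = 1 by rewrite mulrC; exact: cc.
have psiM b1 b2 : tau (chi' (b1 * b2)%g) = tau (chi' b1) * tau (chi' b2).
  by rewrite cM'; exact: rmorphM.
have psiK b' f : chi b' * (tau (chi' b') * f) = f.
  by rewrite mulrA psi1 mul1r.
have hf : hecke_form t'.
  split=> //.
  - move=> w c wW pc; rewrite t'T; apply: gs; split=> //.
    by exists c.
  - apply/eqP => e0; case/eqP: tpi0; apply: (can_inj tK); rewrite rmorph0.
    by rewrite -(psiK (full_turn x0) (tau _)) -t'T e0 mulr0.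
  - move=> b'.
    exact: (star_twist (@ustarM) (uspsi b') (us (t (T b'^-1%g))) (tstar b')
      (psiM b' (full_turn x0)) (t'T b'^-1%g) (t'T (full_turn x0))
      (t'T (b' * full_turn x0)%g)).
have e : chi b * t' (T b) = tau (t (T b)) by rewrite t'T psiK.
exact: etrans (esym e) (congr1 ( *%R (chi b)) (t_uniq hf (T b))).
Qed.
End Hecke.

(** The z^j are all the e-th roots of unity, so the relation says M^e = x^e; take determinants. *)
Lemma det_scaled_roots (F : fieldType) r e (M : 'M[F]_r.+1) (z x : F) :
  e.-primitive_root z -> x != 0 ->
  \prod_(j < e) (M - (z ^+ j * x)%:M) = 0 -> \det M ^+ e = x ^+ (e * r.+1).
Proof.
move=> zp x0 h; pose M' := x^-1 *: M.
have ME : M = x *: M' by rewrite scalerA divff // scale1r.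
have h' : \prod_(j < e) (M' - (z ^+ j)%:M) = 0.
  apply: (@scalerI _ _ (x ^+ e)); first exact: expf_neq0.
  rewrite scaler0 -[RHS]h -[X in _ ^+ X]card_ord -prodr_const -scaler_prod.
  apply: eq_bigr => j _; rewrite scalerBr -ME; congr (_ - _).
  by rewrite scale_scalar_mx mulrC.
have M'e : M' ^+ e = 1.
  apply/eqP; rewrite -subr_eq0.
  have -> : M' ^+ e - 1 = horner_mx M' ('X^e - 1).
    by rewrite rmorphB rmorphXn /= horner_mx_X rmorph1.
  rewrite -(factor_Xn_sub_1 zp) big_mkord.
  rewrite rmorph_prod -[X in _ == X]h'; apply/eqP; apply: eq_bigr => j _.
  by rewrite rmorphB /= horner_mx_X horner_mx_C.
have -> : \det M = x ^+ r.+1 * \det M' by rewrite ME detZ.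
have detX k : \det (M' ^+ k) = \det M' ^+ k.
  by elim: k => [|k IH]; rewrite ?det1 // exprS det_mulmx IH exprS.
by rewrite exprMn -exprM mulnC -detX M'e det1 mulr1.
Qed.

Lemma rep_linear_rel (A : comNzRingType) (E : algType A) (S : set E) r
    (rL : quot_alg S -> 'M[A]_r.+1) (F : comNzRingType) (ds : {rmorphism A -> F})
    (x : E) e (c : 'I_e -> A) :
  (forall a h k, rL (a *: h + k) = a *: rL h + rL k) ->
  (forall h k, rL (h * k) = rL h *m rL k) -> rL 1 = 1%:M ->
  S (\prod_j (x - (c j)%:A)) ->
  \prod_j (map_mx ds (rL (quot_proj S x)) - (ds (c j))%:M) = 0.
Proof.
move=> rLL rLM rL1 Sx; have rL0 : rL 0 = 0 by exact: semilinear0 rLL erefl.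
have rLZ a h : rL (a *: h) = a *: rL h by exact: semilinearZ rLL erefl _ _.
have rLN h : rL (- h) = - rL h by rewrite -scaleN1r rLZ scaleN1r.
have rLD h k : rL (h + k) = rL h + rL k by rewrite -[h]scale1r rLL !scale1r.
have := congr1 (fun h => map_mx ds (rL h)) (quot_proj_rel Sx).
rewrite quot_proj_prod rL0 map_mx0 => <-.
have mM (h k : quot_alg S) : map_mx ds (rL (h * k)) = map_mx ds (rL h) * map_mx ds (rL k).
  by rewrite rLM map_mxM.
have m1 : map_mx ds (rL 1) = 1 by rewrite rL1 map_mx1.
rewrite (big_morph (fun h => map_mx ds (rL h)) mM m1); apply: eq_bigr => j _.
rewrite quot_projD quot_projN quot_projZ rLD rLN rLZ rL1 map_mxD map_mxN map_mxZ.
by rewrite map_mx1 scale_scalar_mx mulr1.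
Qed.

(** * The weight of a braid in an orbit of hyperplanes *)

Section HeckeDegree.
Variables (R : realType) (K : fieldType) (iota : {rmorphism K -> R[i]}).
Variables (gT : finGroupType) (W : {group gT}) (n : nat).
Variables (rW : mx_representation K W n) (x0 : Vreg iota rW).
Hypothesis rW_faithful : mx_faithful rW.
Local Notation B := (braid_group x0).
Local Notation ZU := (Zu rW).
Local Notation H := (quot_alg (hecke_rel x0)).
Local Notation T := (@hecke_T R K iota gT W n rW x0).
Local Notation e_ := (@horder K gT W n rW).
Local Notation zeta := (zeta iota).
Implicit Types (C : horbit rW) (b : B).

(* At u_(C', j) = zeta^j, and zeta^j X if C' = C, the regular representation M
   satisfies det (M b) ^ e = X ^ (e (r + 1)) or 1, so that D b is the X-degree of
   det (M b); this makes D well defined on the braid group. *)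
Lemma hecke_degree r C : free_of_rank (hecke_rel x0) r.+1 ->
  exists D : B -> int, (forall b b', D (b * b')%g = D b + D b') /\
    forall C' b, monodromy x0 C' b -> D b = if C' == C then r.+1%:Z else 0.
Proof.
move=> Hfree; have [rL [rLL rLM rL1]] := free_rep Hfree.
pose F := {fraction {poly K}}.
pose kF : {rmorphism K -> F} := @FracField.tofrac _ \o polyC.
pose zf C' : F := kF (val (zeta (e_ C'))).
pose xf C' : F := if C' == C then tofrac 'X else 1.
have zfp C' : (e_ C').-primitive_root (zf C').
  by rewrite fmorph_primitive_root; exact: zeta_prim.
have xf0 C' : xf C' != 0.
  by rewrite /xf; case: ifP => _; rewrite ?oner_neq0 // tofrac_eq0 polyX_eq0.
have e0 C' : (0 < e_ C')%N by apply: ltnW; exact: horder_gt1.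
have zf0 C' : zf C' != 0.
  apply/eqP => z0; have := prim_expr_order (zfp C'); rewrite z0 expr0n.
  by rewrite gtn_eqF // => /eqP; rewrite eq_sym oner_eq0.
pose y (i : paramidx rW) : F := zf (tag i) ^+ tagged i * xf (tag i).
have yU i : y i \is a GRing.unit by rewrite unitfE mulf_neq0 ?expf_neq0.
pose ds : {rmorphism ZU -> F} := leval intr yU.
pose M b : 'M[F]_r.+1 := map_mx ds (rL (T b)).
have MM b b' : M (b * b')%g = M b *m M b'.
  by rewrite /M hecke_TM rLM map_mxM.
have M1 : M 1%g = 1%:M by rewrite /M hecke_T1 rL1 map_mx1.
have M0 b : \det (M b) != 0.
  have e1 : M b *m M b^-1%g = 1%:M.
    by rewrite -M1 -(mulgV b); apply/esym; exact: MM.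
  by have [+ _] := mulmx1_unit e1; rewrite unitmxE unitfE.
exists (fun b => vdeg (\det (M b))); split.
  by move=> b b'; rewrite MM det_mulmx vdegM.
move=> C' b mb.
have rel : \prod_(j < e_ C') (M b - (zf C' ^+ j * xf C')%:M) = 0.
  have z0 : hecke_rel x0 (\prod_(j < e_ C') (monalg_of ZU b - (uvar j)%:A)).
    by exists C', b.
  rewrite -[RHS](rep_linear_rel ds rLL rLM rL1 z0); apply: eq_bigr => j _.
  have yj : ds (uvar j) = zf C' ^+ j * xf C'.
    exact: (leval_lvar intr yU (Tagged (fun C => 'I_(e_ C)) j)).
  by rewrite yj.
have := det_scaled_roots (zfp C') (xf0 C') rel.
move=> /(congr1 (@vdeg K)); rewrite vdegX // vdegX //.
have -> : vdeg (xf C') = (C' == C)%:Z.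
  by rewrite /xf; case: ifP => _; rewrite ?vdeg1 ?vdeg_X.
move: (vdeg _) => d; case: (C' == C); rewrite PoszM ?mul1r ?mul0r => dE.
  by apply: (@mulIf _ (e_ C')%:Z); rewrite ?eqz_nat -?lt0n // dE mulrC.
by move/eqP: dE; rewrite mulf_eq0 eqz_nat gtn_eqF // orbF => /eqP.
Qed.
End HeckeDegree.

Section RootVector.
Variables (I T : finType) (p : I -> T) (c : T) (i1 i0 : I) (e : int).
Hypotheses (i10 : i1 != i0) (p1 : p i1 = c) (p0 : p i0 = c).
Local Notation Z := {ffun I -> int}.

(** Exponent of the monomial (u_i1 / u_i0)^e, which has degree 0 when i1 and i0 lie in the same
    family. *)
Definition root_vec : Z :=
  [ffun j => if j == i1 then e else if j == i0 then - e else 0].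

Lemma pdeg_root_vec : pdeg p c root_vec = 0.
Proof.
rewrite /pdeg (bigD1 i1) ?p1 //= (bigD1 i0) /=; last by rewrite p0 eqxx eq_sym.
rewrite !ffunE !eqxx eq_sym (negPf i10) big1 ?addr0 ?subrr // => j.
by move=> /andP[/andP[_ /negPf j1] /negPf j0]; rewrite ffunE j1 j0.
Qed.

Lemma root_vec_i1 : root_vec i1 = e.
Proof. by rewrite ffunE eqxx. Qed.

Lemma laurent_eval_root_vec (S : comUnitRingType) (x : I -> S) :
  laurent_eval intr x (lmon int root_vec) = x i1 ^ e * x i0 ^ - e.
Proof.
rewrite laurent_eval_lmon (bigD1 i1) //= (bigD1 i0) 1?eq_sym //=.
rewrite !ffunE !eqxx eq_sym (negPf i10) big1 ?mulr1 // => j /andP[/negPf j1 /negPf j0].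
by rewrite ffunE j1 j0.
Qed.
End RootVector.

(** As [v] has degree 0, its monomial is fixed by the substitution, which is therefore undone by the
    opposite power of that monomial. *)
Lemma degshift_cancel (I T : finType) (p : I -> T) c (v : {ffun I -> int}) z
    (f : laurent int I) : pdeg p c v = 0 ->
  lsubst (degshift p c v (- z)) (lsubst (degshift p c v z) f) = f.
Proof.
move=> v0; rewrite lsubst_comp -[RHS]lsubst_id; apply: eq_lsubst => i.
rewrite degshift_sum pdegD pdeg_delta /degshift.
case: (p i == c).
  by rewrite pdegMz v0 mul0r addr0 mulr1 -addrA -mulrzDr subrr mulr0z addr0.
have -> : pdeg p c 0 = 0 by rewrite /pdeg big1 // => j _; rewrite ffunE.
by rewrite !addr0 mulr0 mulr0z addr0.
Qed.

Lemma degshift_lmon (I T : finType) (p : I -> T) c (v : {ffun I -> int}) z a :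
  pdeg p c v = 0 ->
  lsubst (degshift p c v z) (lmon int (v *~ a)) = lmon int (v *~ a).
Proof.
by move=> v0; rewrite lsubst_lmon degshift_sum pdegMz v0 mul0r mulr0 mulr0z addr0.
Qed.

(** * Homogeneity of the values t(T_b) *)

Section HomogeneousForm.
Variables (R : realType) (K : fieldType) (iota : {rmorphism K -> R[i]}).
Variables (gT : finGroupType) (W : {group gT}) (n : nat).
Variables (rW : mx_representation K W n) (x0 : Vreg iota rW).
Hypothesis rW_faithful : mx_faithful rW.
Local Notation B := (braid_group x0).
Local Notation ZU := (Zu rW).
Local Notation H := (quot_alg (hecke_rel x0)).
Local Notation T := (@hecke_T R K iota gT W n rW x0).
Local Notation e_ := (@horder K gT W n rW).
Local Notation zeta := (zeta iota).
Local Notation I := (paramidx rW).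
Local Notation Z := {ffun I -> int}.
Local Notation cdeg := (pdeg (fun i : I => tag i)).
Local Notation idx j := (Tagged (fun C => 'I_(e_ C)) j).
Implicit Types (C : horbit rW) (b : B).

Definition zroot (i : I) : K := val (zeta (e_ (tag i)) ^+ tagged i).

Lemma zroot_unit i : zroot i \is a GRing.unit.
Proof.
rewrite unitfE /zroot rmorphXn; apply: expf_neq0; apply/eqP => z0.
have := prim_expr_order (zeta_prim iota rW_faithful (tag i)).
rewrite z0 expr0n gtn_eqF ?(ltnW (horder_gt1 _)) //.
by move=> /eqP; rewrite eq_sym oner_eq0.
Qed.

Definition gspec : {rmorphism ZU -> K} := leval intr zroot_unit.

Lemma gspecE f : group_spec iota f = gspec f. Proof. by []. Qed.

Lemma gspec_lsubst (w : I -> Z) (f : ZU) :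
  gspec (lsubst w f) = laurent_eval intr (fun i => gspec (lmon int (w i))) f.
Proof. exact: leval_lsubst zroot_unit w f. Qed.

Variable t : {scalar H}.
Hypothesis t_hecke : hecke_form t.
Hypothesis t_uniq : forall t' : {scalar H}, hecke_form t' -> t' =1 t.

(* Twist by u_(C, j) |-> x^N u_(C, j), where x = (u_(C, 1) / u_(C, 0)) ^ e_C has
   degree 0 and specializes to 1 in the group algebra of W. *)
Lemma hecke_homogeneous C (N : nat) (D : B -> int) :
  (forall b b', D (b * b')%g = D b + D b') ->
  (forall C' b, monodromy x0 C' b -> D b = if C' == C then N%:Z else 0) ->
  forall b (k : Z), (k : expo I) \in msupp (t (T b)) -> N%:Z * cdeg C k = D b.
Proof.
(* W_H contains a reflection, so e_C > 1 and the parameter u_(C, 1) exists. *)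
move=> DM Dm; have e1 : (1 < e_ C)%N := horder_gt1 C.
pose i1 : I := idx (Ordinal e1); pose i0 : I := idx (Ordinal (ltnW e1)).
have i10 : i1 != i0 by rewrite eq_Tagged.
pose v : Z := root_vec i1 i0 (e_ C)%:Z.
have v0 : cdeg C v = 0 by apply: pdeg_root_vec.
have v1 : v i1 != 0 by rewrite root_vec_i1 eqz_nat -lt0n ltnW.
have D1 : D 1%g = 0 by apply: (addrI (D 1%g)); rewrite -DM mulg1 addr0.
have DV b : D b^-1%g = - D b.
  by apply: (addrI (D b)); rewrite -DM mulgV D1 subrr.
have gv1 : gspec (lmon int v) = 1.
  have z1 : zroot i1 = val (zeta (e_ C)) by [].
  have z0 : zroot i0 = 1 by [].
  transitivity (zroot i1 ^ (e_ C)%:Z * zroot i0 ^ - (e_ C)%:Z).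
    exact: laurent_eval_root_vec.
  rewrite z1 z0 exp1rz mulr1.
  by rewrite -exprnP (prim_expr_order (zeta_prim iota rW_faithful C)).
have gv z : gspec (lmon int (v *~ z)) = 1.
  by rewrite -lmonX (rmorphXz gspec) ?lmon_unit // gv1 exp1rz.
pose w z := degshift (fun i : I => tag i) C v z.
have lv a z : lsubst (w z) (lmon int (v *~ a)) = lmon int (v *~ a).
  exact: degshift_lmon.
pose chi b : ZU := lmon int (v *~ D b); pose chi' b : ZU := lmon int (v *~ - D b).
have lmonDz a c : lmon int (v *~ (a + c)) = lmon int (v *~ a) * lmon int (v *~ c).
  by rewrite mulrzDr lmonD.
have uE z a C' (j : 'I_(e_ C')) : a = (if C' == C then z else 0) ->
   lsubst (w z) (uvar j) = lmon int (v *~ a) * uvar j :> ZU.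
  move=> ->; rewrite /uvar lsubst_lvar /w /degshift /= lmonD mulrC.
  by case: ifP => _; rewrite ?mulr0z.
suff tw b : lsubstm (w N%:Z) (t (T b)) = chi b * t (T b).
  move=> b k kf; apply: (lsubst_homogeneous v0 v1 (f := t (T b)) _ kf).
  exact: tw.
apply: (hecke_twist t_hecke t_uniq (tau := lsubstm (w N%:Z))
   (tau' := lsubstm (w (- N%:Z))) (chi := chi) (chi' := chi')
   (p := fun _ => id) (p' := fun _ => id)).
- by move=> f; exact: degshift_cancel.
- move=> f; have := @degshift_cancel _ _ (fun i : I => tag i) C v (- N%:Z) f v0.
  by rewrite opprK.
- by move=> C0 x y.
- by move=> C0 x y.
- by rewrite /chi D1 mulr0z.
- by move=> b1 b2; rewrite /chi DM lmonDz.
- by rewrite /chi' D1 oppr0 mulr0z.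
- by move=> b1 b2; rewrite /chi' DM opprD lmonDz.
- by move=> C' b' j mb; apply: uE; exact: Dm mb.
- move=> C' b' j mb; apply: uE; rewrite (Dm C' b' mb).
  by case: ifP => _; rewrite ?oppr0.
- move=> b'; rewrite lsubstmE /chi' lv /chi -lmonDz addNr mulr0z.
  exact: lmon0.
- move=> b'; rewrite lsubstmE /chi lv /chi' -lmonDz subrr mulr0z.
  exact: lmon0.
- by move=> f; exact: ustar_lsubst.
- by move=> b'; rewrite !lsubstmE /chi' !lv ustar_lmon DV opprK -mulrNz.
(* Since x specializes to 1, neither the substitution nor the factor [chi'] is visible in the group
   algebra. *)
- move=> b' w' lw; rewrite gspecE rmorphM !lsubstmE /chi' lv gv mul1r gspec_lsubst.
  have [_ gs _ _] := t_hecke; case: lw => wW [c [pc bE]].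
  rewrite -(gs w' c wW pc) -bE gspecE; apply: eq_laurent_eval => // i.
  rewrite /w /degshift; case: (tag i == C).
    rewrite lmonD rmorphM gv mulr1; exact: leval_lvar.
  rewrite addr0; exact: leval_lvar.
Qed.
End HomogeneousForm.

(* If a family has identity Gram matrix under both specializations, the
   coordinates of h on it, which sigma fixes up to denominators, agree. *)
Lemma gram_two_specs (A : comNzRingType) (E : algType A) (S : set E) r
    (t : {scalar quot_alg S}) (x y : 'I_r -> quot_alg S) (h : quot_alg S)
    (sigma : {rmorphism A -> A}) (Th : quot_alg S -> quot_alg S)
    (F : comNzRingType) (sp : {rmorphism A -> F}) :
  free_of_rank S r ->
  (forall a h k, Th (a *: h + k) = sigma a *: Th h + Th k) ->
  (forall i, Th (x i) = x i) -> Th h = h ->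
  (forall i j, sp (t (x i * y j)) = (i == j)%:R) ->
  (forall i j, sp (sigma (t (x i * y j))) = (i == j)%:R) ->
  forall i, sp (sigma (t (h * y i))) = sp (t (h * y i)).
Proof.
move=> Sfree ThL Thx Thh sp1 sps1 i.
set G := \matrix_(i, j) t (x i * y j); set v := \row_j t (h * y j).
pose f i := (v *m \adj G) 0 i.
have E1 : \det G ^+ 2 *: h = \sum_i (\det G * f i) *: x i := gram_span Sfree t x y h.
have E2 : sigma (\det G ^+ 2) *: h = \sum_i sigma (\det G * f i) *: x i.
  have := congr1 Th E1; rewrite (semilinearZ ThL (rmorph1 _)) Thh => ->.
  rewrite (semilinear_sum ThL (rmorph1 _)); apply: eq_bigr => j _; exact: (congr1 _ (Thx j)).
have detG (psi : {rmorphism A -> F}) :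
    (forall i j, psi (t (x i * y j)) = (i == j)%:R) ->
    psi (\det G) = 1 /\ forall i, psi (f i) = psi (v 0 i).
  move=> psi1; have GE : map_mx psi G = 1%:M.
    by apply/matrixP => j k; rewrite !mxE psi1.
  split; first by rewrite -det_map_mx GE det1.
  move=> j; have e : map_mx psi (v *m \adj G) = map_mx psi v.
    by rewrite map_mxM map_mx_adj GE adj1 mulmx1.
  transitivity (map_mx psi (v *m \adj G) 0 j); first by rewrite [RHS]mxE.
  by rewrite e [LHS]mxE.
have [d1 f1] := detG sp sp1.
have [d2 f2] := detG (sp \o sigma) sps1.
(* The equation [E1] and its image [E2] express multiples of the same [h]; crossing them gives a
   linear relation between the [x j], whose coefficients are killed by \det G, and \det G becomes 1
   under [sp]. *)
pose c j := sigma (\det G) ^+ 2 * (\det G * f j) - \det G ^+ 2 * sigma (\det G * f j).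
have c0 : \sum_j c j *: x j = 0.
  have -> : \sum_j c j *: x j = sigma (\det G) ^+ 2 *: \sum_j (\det G * f j) *: x j
      - \det G ^+ 2 *: \sum_j sigma (\det G * f j) *: x j.
    rewrite !scaler_sumr -sumrB; apply: eq_bigr => j _.
    by rewrite scalerBl !scalerA.
  by rewrite -E1 -E2 rmorphXn !scalerA mulrC subrr.
have := congr1 sp (gram_indep t y c0 i); rewrite -/G rmorphM d1 mul1r rmorph0.
rewrite /c rmorphB !rmorphM d1 /=.
move: d2 (f2 i) (f1 i) => /= -> -> ->; rewrite !mul1r !mxE.
by move/eqP; rewrite subr_eq0 => /eqP.
Qed.

(** * Invariance of t(T_b) under cyclic permutation of the parameters *)

Section PermSubst.
Variables (I : finType).
Local Notation Z := {ffun I -> int}.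

Definition psubst (s : I -> I) (i : I) : Z := [ffun j => (j == s i)%:Z].

Lemma psubst_comp (s s' : I -> I) (f : laurent int I) :
  lsubst (psubst s') (lsubst (psubst s) f) = lsubst (psubst (s' \o s)) f.
Proof.
rewrite lsubst_comp; apply: eq_lsubst => i.
rewrite (bigD1 (s i)) //= ffunE eqxx mulr1z big1 ?addr0 // => j /negPf ji.
by rewrite ffunE ji mulr0z.
Qed.

Lemma psubst_id (s : I -> I) (f : laurent int I) : s =1 id -> lsubst (psubst s) f = f.
Proof. by move=> sE; rewrite -[RHS]lsubst_id; apply: eq_lsubst => i; rewrite /psubst sE. Qed.
End PermSubst.

Section PermutationInvariance.
Variables (R : realType) (K : fieldType) (iota : {rmorphism K -> R[i]}).
Variables (gT : finGroupType) (W : {group gT}) (n : nat).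
Variables (rW : mx_representation K W n) (x0 : Vreg iota rW).
Hypothesis rW_faithful : mx_faithful rW.
Local Notation B := (braid_group x0).
Local Notation ZU := (Zu rW).
Local Notation H := (quot_alg (hecke_rel x0)).
Local Notation T := (@hecke_T R K iota gT W n rW x0).
Local Notation e_ := (@horder K gT W n rW).
Local Notation zeta := (zeta iota).
Local Notation I := (paramidx rW).
Local Notation Z := {ffun I -> int}.
Local Notation cdeg := (pdeg (fun i : I => tag i)).
Local Notation idx j := (Tagged (fun C => 'I_(e_ C)) j).
Implicit Types (C : horbit rW) (b : B).

Variables (t : {scalar H}) (N : nat) (D : horbit rW -> B -> int).
Hypothesis t_hecke : hecke_form t.
Hypothesis t_uniq : forall t' : {scalar H}, hecke_form t' -> t' =1 t.
Hypothesis N_gt0 : (0 < N)%N.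
Hypothesis DM : forall C b b', D C (b * b')%g = D C b + D C b'.
Hypothesis Dm : forall C C' b, monodromy x0 C' b -> D C b = if C' == C then N%:Z else 0.

Lemma hecke_eval_scale (S : comUnitRingType) (x : I -> S) (z : horbit rW -> S) b
    (d : horbit rW -> int) :
  (forall i, x i \is a GRing.unit) -> (forall C, z C \is a GRing.unit) ->
  (forall C, N%:Z * d C = D C b) ->
  laurent_eval intr (fun i => z (tag i) * x i) (t (T b)) =
    (\prod_C z C ^ d C) * laurent_eval intr x (t (T b)).
Proof.
move=> xU zU dE; apply: laurent_eval_scale => // k kt C.
have N0 : N%:Z != 0 by rewrite eqz_nat -lt0n.
apply: (mulfI N0); rewrite dE.
exact: (hecke_homogeneous rW_faithful t_hecke t_uniq (@DM C) (@Dm C) kt).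
Qed.

(** An exponent in the support would provide the quotients of the weights of b by N. *)
Lemma hecke_trace0 b : (forall d : horbit rW -> int, exists C, N%:Z * d C != D C b) ->
  t (T b) = 0.
Proof.
move=> nd; apply/malgP => k; rewrite mcoeff0; apply/eqP/negPn/negP.
rewrite mcoeff_neq0 => kt; have [C /eqP] := nd (fun C => cdeg C k); apply.
exact: (hecke_homogeneous rW_faithful t_hecke t_uniq (@DM C) (@Dm C) kt).
Qed.

(** If the weights of b are not all multiples of N, both sides are 0 and any [c] would do. *)
Lemma hecke_eval_scale_ex (S : comUnitRingType) (x : I -> S) (z : horbit rW -> S) b :
  (forall i, x i \is a GRing.unit) -> (forall C, z C \is a GRing.unit) ->
  exists c, laurent_eval intr (fun i => z (tag i) * x i) (t (T b)) =
    c * laurent_eval intr x (t (T b)).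
Proof.
move=> xU zU; case: (pselect (exists d : horbit rW -> int, forall C, N%:Z * d C = D C b)).
  by move=> [d dE]; exists (\prod_C z C ^ d C); exact: hecke_eval_scale.
move=> nd; exists 0; rewrite hecke_trace0.
  by rewrite /laurent_eval msupp0 big_seq_fset0 mul0r.
move=> d; apply: contrapT => h; apply: nd; exists d => C.
by apply/eqP/negPn/negP => hC; apply: h; exists C.
Qed.

Variable g : cyclic_prod rW.

Definition param_rot (i : I) : I := idx (ord_add (tagged i) (g (tag i))).

Lemma ord_add_inj C : injective (fun j : 'I_(e_ C) => ord_add j (g C)).
Proof.
move=> i j /(congr1 val) /= /eqP; rewrite eqn_modDr !modn_small // => /eqP.
exact: val_inj.
Qed.

Lemma zroot_rot i : zroot iota (param_rot i) = val (zeta (e_ (tag i))) ^+ g (tag i) * zroot iota i.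
Proof.
rewrite /zroot !rmorphXn /= (prim_expr_mod (zeta_prim iota rW_faithful _)).
by rewrite exprD mulrC.
Qed.

Local Notation gs := (@gspec R K iota gT W n rW rW_faithful).
Local Notation rot := (lsubst (psubst param_rot)).

(** After rotation, the specialization to the group algebra is the usual one rescaled by one
    constant per orbit, so homogeneity applies to it. *)
Lemma gspec_rot (f : ZU) : gs (rot f) =
  laurent_eval intr (fun i : I => val (zeta (e_ (tag i))) ^+ g (tag i) * zroot iota i) f.
Proof.
rewrite gspec_lsubst; apply: eq_laurent_eval => // i.
by rewrite -zroot_rot; exact: leval_lvar.
Qed.

Lemma zetag_unit C : val (zeta (e_ C)) ^+ g C \is a GRing.unit.
Proof.
rewrite unitfE; apply: expf_neq0; apply/eqP => z0.
have := prim_expr_order (zeta_prim iota rW_faithful C).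
rewrite z0 expr0n gtn_eqF ?(ltnW (horder_gt1 _)) //.
by move=> /eqP; rewrite eq_sym oner_eq0.
Qed.

Lemma gspec_lift b w : path_lift b w -> gs (t (T b)) = (w == 1%g)%:R.
Proof. by move=> [wW [c [pc ->]]]; have [_ h _ _] := t_hecke; exact: h. Qed.

Lemma gspec_rot0 b : gs (t (T b)) = 0 -> gs (rot (t (T b))) = 0.
Proof.
move=> g0; have [c cE] := hecke_eval_scale_ex b (zroot_unit iota rW_faithful) zetag_unit.
by rewrite gspec_rot cE -[laurent_eval _ _ _]/(gs (t (T b))) g0 mulr0.
Qed.

Lemma gspec_rot1 : gs (rot (t (T 1%g))) = 1.
Proof.
have D1 C : D C 1%g = 0 by apply: (addrI (D C 1%g)); rewrite -DM mulg1 addr0.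
rewrite gspec_rot (@hecke_eval_scale K (@zroot R K iota gT W n rW)
  (fun C => val (zeta (e_ C)) ^+ g C) 1%g (fun=> 0)).
- rewrite -[laurent_eval _ _ _]/(gs (t (T 1%g))) (gspec_lift (lift1 x0)) eqxx mulr1.
  by rewrite big1 // => C _; rewrite expr0z.
- exact: zroot_unit.
- exact: zetag_unit.
- by move=> C; rewrite mulr0 D1.
Qed.

Variables (w_ : 'I_N -> gT) (b_ : 'I_N -> B).
Hypothesis Hfree : free_of_rank (hecke_rel x0) N.
Hypothesis w_inj : injective w_.
Hypothesis b_lift : forall i, path_lift (b_ i) (w_ i).

Lemma gspec_gram i j : gs (t (T (b_ i) * T (b_ j)^-1%g)) = (i == j)%:R.
Proof.
rewrite -hecke_TM (gspec_lift (liftM (b_lift i) (liftV (b_lift j)))).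
by rewrite -eq_mulgV1 (inj_eq w_inj).
Qed.

(** Homogeneity settles w different from 1 and the braid 1. The Gram matrix of the T_(b_i) and their
    inverses involves only these cases, its diagonal being t(T_1), and [gram_two_specs] transfers
    the result to the remaining braids. *)
Lemma gspec_rot_lift b w : path_lift b w -> gs (rot (t (T b))) = (w == 1%g)%:R.
Proof.
move=> lb; pose i0 : 'I_N := Ordinal N_gt0.
(* [gram_two_specs] compares the values of t at [h * y i]; the factor [b_ i0] is there to be
   cancelled by [y i0]. *)
pose h := (b * b_ i0)%g.
have lh : path_lift h (w * w_ i0)%g by exact: liftM.
have [Th [ThL _ _ ThT]] : exists Th : H -> H,
  [/\ forall a h k, Th (a *: h + k) = lsubstm (psubst param_rot) a *: Th h + Th k,
     forall h k, Th (h * k) = Th h * Th k, Th 1 = 1 &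
     forall b, Th (T b) = 1 *: T b].
  apply: (@hecke_semilinear _ _ _ _ _ _ _ x0 (lsubstm (psubst param_rot))
    (fun=> 1) (fun C j => ord_add j (g C))).
  - exact: ord_add_inj.
  - by [].
  - by move=> *; rewrite mul1r.
  - by move=> C b' j _; rewrite mul1r lsubstmE /uvar lsubst_lvar.
have ThT1 b' : Th (T b') = T b' by rewrite ThT scale1r.
have := @gram_two_specs _ _ _ N t (fun i => T (b_ i)) (fun i => T (b_ i)^-1%g) (T h)
  (lsubstm (psubst param_rot)) Th _ gs Hfree ThL (fun i => ThT1 _) (ThT1 _)
  gspec_gram.
have rotG i j : gs (lsubstm (psubst param_rot) (t (T (b_ i) * T (b_ j)^-1%g))) = (i == j)%:R.
  rewrite -hecke_TM lsubstmE; case: eqVneq => [->|ij]; first by rewrite mulgV gspec_rot1.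
  by apply: gspec_rot0; rewrite hecke_TM gspec_gram (negPf ij).
move=> /(_ rotG i0); rewrite -hecke_TM lsubstmE.
rewrite (gspec_lift (liftM lh (liftV (b_lift i0)))) (mulgK (w_ i0)).
by rewrite /h (mulgK (b_ i0)).
Qed.

(** The permutation only reorders the factors of the defining relations, so the twist applies with
    trivial [chi]. *)
Lemma hecke_rot b : rot (t (T b)) = t (T b).
Proof.
pose p' C := invF (@ord_add_inj C).
pose rot' (i : I) : I := idx (p' (tag i) (tagged i)).
have rotK : cancel param_rot rot'.
  by case=> C j; rewrite /rot' /param_rot /= /p' invF_f.
have rotK' : cancel rot' param_rot.
  by case=> C j; rewrite /rot' /param_rot /= /p' (f_invF (@ord_add_inj C)).
have := @hecke_twist _ _ _ _ _ _ _ x0 t t_hecke t_uniq (lsubstm (psubst param_rot))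
  (lsubstm (psubst rot')) (fun=> 1) (fun=> 1) (fun C j => ord_add j (g C)) p'.
move=> h; transitivity (1 * t (T b)); last exact: mul1r.
apply: h.
- by move=> f; rewrite !lsubstmE psubst_comp psubst_id.
- by move=> f; rewrite !lsubstmE psubst_comp psubst_id.
- exact: ord_add_inj.
- by move=> C; exact: (can_inj (f_invF (@ord_add_inj C))).
- by [].
- by move=> *; rewrite mulr1.
- by [].
- by move=> *; rewrite mulr1.
- by move=> C b' j _; rewrite mul1r lsubstmE /uvar lsubst_lvar.
- by move=> C b' j _; rewrite mul1r lsubstmE /uvar lsubst_lvar.
- by move=> b'; rewrite mulr1 rmorph1.
- by move=> b'; rewrite mulr1 rmorph1.
- by move=> f; exact: ustar_lsubst.
- by move=> b'; rewrite rmorph1 -(lmon0 int _) ustar_lmon oppr0.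
- by move=> b' w lw; rewrite rmorph1 mul1r gspecE lsubstmE; exact: gspec_rot_lift.
Qed.
End PermutationInvariance.

(** * Cyclotomic specializations *)

Lemma lscale_unit (A : comNzRingType) (I : finType) (a a' : A) (f : laurent A I) :
  a * a' = 1 -> f \is a GRing.unit -> a *: f \is a GRing.unit.
Proof.
move=> aa' fU; rewrite -[f]mul1r scalerAl unitrM fU andbT.
by apply/unitrPr; exists a'%:A; rewrite -scalerAl mul1r scalerA aa' scale1r.
Qed.

Lemma prod_exprz_count (T : finType) (S : comUnitRingType) (z : T -> S) k (c : 'I_k -> T) :
  (forall x, z x \is a GRing.unit) ->
  \prod_x z x ^ (\sum_i (c i == x)%:Z) = \prod_i z (c i).
Proof.
move=> zU; transitivity (\prod_x \prod_(i < k) z x ^ (c i == x)%:Z).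
  apply: eq_bigr => x _; apply: (big_morph (fun j => z x ^ j)) => [i j|].
    by rewrite exprzDr.
  exact: expr0z.
rewrite exchange_big; apply: eq_bigr => i _; rewrite (bigD1 (c i)) //= eqxx expr1z.
by rewrite big1 ?mulr1 // => x /negPf cx; rewrite eq_sym cx expr0z.
Qed.

Lemma twisted_prod (A : comNzRingType) (E : algType A) (S : set E) (M : monoidType)
    (F F' : M -> quot_alg S) k (z : 'I_k -> A) (b : 'I_k -> M) :
  F 1%g = 1 -> F' 1%g = 1 -> (forall x y, F (x * y)%g = F x * F y) ->
  (forall x y, F' (x * y)%g = F' x * F' y) ->
  (forall i, F (b i) = z i *: F' (b i)) ->
  F (\prod_i b i)%g = (\prod_i z i) *: F' (\prod_i b i)%g.
Proof.
move=> F1 F'1 FM F'M; elim: k z b => [|k IH] z b Fb.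
  by rewrite !big_ord0 F1 F'1 scale1r.
rewrite !big_ord_recl FM F'M Fb (IH (fun i => z (lift ord0 i))) //.
by rewrite -quot_scalerAl -quot_scalerAr scalerA.
Qed.

Lemma scaled_form_eq (A : comNzRingType) (V V' : lmodType A) (f : {scalar V})
    (f' : {scalar V'}) a v v1 v' x : v1 = a *: v -> f v = x -> f' v' = a * x ->
  f v1 = f' v'.
Proof. by move=> -> <- ->; rewrite linearZ. Qed.

Section CyclotomicTrace.
Variables (R : realType) (K : fieldType) (iota : {rmorphism K -> R[i]}).
Variables (gT : finGroupType) (W : {group gT}) (n : nat).
Variables (rW : mx_representation K W n) (x0 : Vreg iota rW).
Hypothesis rW_faithful : mx_faithful rW.
Local Notation B := (braid_group x0).
Local Notation ZU := (Zu rW).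
Local Notation ZKq := (laurent1 (ZK K)).
Local Notation H := (quot_alg (hecke_rel x0)).
Local Notation T := (@hecke_T R K iota gT W n rW x0).
Local Notation e_ := (@horder K gT W n rW).
Local Notation zeta := (zeta iota).
Local Notation I := (paramidx rW).
Implicit Types (C : horbit rW) (b : B) (m : multiplicity rW).

Definition cparam m (i : I) : ZKq :=
  zeta (e_ (tag i)) ^+ tagged i *: lvar tt ^ m (tag i) (tagged i).

Lemma zeta_inv C j : zeta (e_ C) ^+ j * zeta (e_ C) ^+ (j * (e_ C).-1) = 1.
Proof.
rewrite -exprD -mulnS prednK ?(ltnW (horder_gt1 _)) // mulnC exprM.
by rewrite (zeta_order iota rW_faithful) expr1n.
Qed.

Lemma cparam_unit m i : cparam m i \is a GRing.unit.
Proof.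
apply: lscale_unit (zeta_inv _ _) _; rewrite unitrXz //.
exact: lvar_unit.
Qed.

Variable g : cyclic_prod rW.

Definition zscale C : ZKq := (zeta (e_ C) ^+ g C)%:A.

Lemma zscale_unit C : zscale C \is a GRing.unit.
Proof. by apply: lscale_unit (zeta_inv _ _) _; exact: unitr1. Qed.

(** The action on multiplicities absorbs the shift of the exponent of q; the shift of the exponent
    of zeta remains as a constant depending on the orbit only. *)
Lemma cparam_rot m i :
  cparam m (param_rot g i) = zscale (tag i) * cparam (cyclic_act g m) i.
Proof.
rewrite /cparam /zscale /= -scalerAl mul1r scalerA.
congr (_ *: _); rewrite -exprD addnC; apply/esym.
by rewrite (expr_mod _ (zeta_order iota rW_faithful (tag i))).
Qed.

Variables (t : {scalar H}) (N : nat) (D : horbit rW -> B -> int).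
Hypothesis t_hecke : hecke_form t.
Hypothesis t_uniq : forall t' : {scalar H}, hecke_form t' -> t' =1 t.
Hypothesis N_gt0 : (0 < N)%N.
Hypothesis DM : forall C b b', D C (b * b')%g = D C b + D C b'.
Hypothesis Dm : forall C C' b, monodromy x0 C' b -> D C b = if C' == C then N%:Z else 0.
Variables (w_ : 'I_N -> gT) (b_ : 'I_N -> B).
Hypothesis Hfree : free_of_rank (hecke_rel x0) N.
Hypothesis w_inj : injective w_.
Hypothesis b_lift : forall i, path_lift (b_ i) (w_ i).

(** By [hecke_rot] the parameters may be rotated before specializing at [m]; this amounts to
    specializing at g.m up to one scalar per orbit, which homogeneity extracts. *)
Lemma cspec_rot m b (d : horbit rW -> int) : (forall C, N%:Z * d C = D C b) ->
  cyclo_spec iota m (t (T b)) =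
    (\prod_C zscale C ^ d C) * cyclo_spec iota (cyclic_act g m) (t (T b)).
Proof.
move=> dE; rewrite -[in LHS](hecke_rot rW_faithful t_hecke t_uniq N_gt0 DM Dm g
  Hfree w_inj b_lift b).
transitivity (laurent_eval intr (fun i => zscale (tag i) * cparam (cyclic_act g m) i) (t (T b))).
  transitivity (laurent_eval intr (fun i => laurent_eval intr (cparam m)
      (lmon int (psubst (param_rot g) i))) (t (T b))).
    exact: (leval_lsubst (cparam_unit m)).
  apply: eq_laurent_eval => // i; rewrite -cparam_rot.
  exact: (leval_lvar intr (cparam_unit m)).
exact: (hecke_eval_scale rW_faithful t_hecke t_uniq N_gt0 DM Dm (cparam_unit _)
  zscale_unit dE).
Qed.

Lemma degree_prod C k (Cl : 'I_k -> horbit rW) (b : 'I_k -> B) :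
  (forall i, monodromy x0 (Cl i) (b i)) ->
  N%:Z * (\sum_i (Cl i == C)%:Z) = D C (\prod_i b i)%g.
Proof.
have D1 : D C 1%g = 0 by apply: (addrI (D C 1%g)); rewrite -DM mulg1 addr0.
move=> mb; rewrite (big_morph (D C) (@DM C) D1) mulr_sumr.
apply: eq_bigr => i _; rewrite (Dm C (mb i)).
by case: (Cl i == C); rewrite ?mulr1 ?mulr0.
Qed.

Variables (m : multiplicity rW).
Variable Gamma : quot_alg (cyclo_rel x0 m) -> quot_alg (cyclo_rel x0 (cyclic_act g m)).
Hypothesis Gamma_spec : is_Gamma Gamma.

Lemma Gamma_prod k (Cl : 'I_k -> horbit rW) (b : 'I_k -> B) :
  (forall i, monodromy x0 (Cl i) (b i)) ->
  Gamma (cyclo_of m (T (\prod_i b i)%g)) =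
    (\prod_i zscale (Cl i)) *: cyclo_of (cyclic_act g m) (T (\prod_i b i)%g).
Proof.
have [[_ GM G1] _ Gs] := Gamma_spec => mb.
have cM m' (h h' : H) : cyclo_of m' (h * h') = cyclo_of m' h * cyclo_of m' h'.
  exact: tens1M.
have c1 m' : cyclo_of m' (T 1%g) = 1.
  apply: (etrans (congr1 (@cyclo_of _ _ _ _ _ _ _ x0 m') (hecke_T1 x0))).
  exact: tens11.
apply: (@twisted_prod _ _ _ _ (fun b => Gamma (cyclo_of m (T b)))
  (fun b => cyclo_of (cyclic_act g m) (T b)) k (fun i => zscale (Cl i))).
- exact: (etrans (congr1 Gamma (c1 m)) G1).
- exact: c1.
- by move=> x y; rewrite (hecke_TM x y) cM; exact: GM.
- by move=> x y; rewrite (hecke_TM x y); exact: cM.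
- by move=> i; exact: Gs.
Qed.

Variable tm : forall m, {scalar quot_alg (cyclo_rel x0 m)}.
Hypothesis tmE : forall m h, tm m (cyclo_of m h) = cyclo_spec iota m (t h).

Lemma cyclo_trace_Gamma k (Cl : 'I_k -> horbit rW) (b : 'I_k -> B) :
  (forall i, monodromy x0 (Cl i) (b i)) ->
  tm (cyclic_act g m) (Gamma (cyclo_of m (T (\prod_i b i)%g))) =
  tm m (cyclo_of m (T (\prod_i b i)%g)).
Proof.
move=> mb; apply: (scaled_form_eq (Gamma_prod mb) (tmE _ _)).
apply: (etrans (tmE _ _)).
apply: (etrans (cspec_rot m (fun C => degree_prod C mb))).
by congr (_ * _); exact: prod_exprz_count zscale_unit.
Qed.
End CyclotomicTrace.

(** * Specialization at y = 1 *)

Section ValueAtOne.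
Variable K : fieldType.
Local Notation F := {fraction {poly K}}.
Implicit Types (f g : F) (c d : K).

Lemma value_at1_neq0 (p : {poly K}) : p.[1] != 0 -> tofrac p != 0.
Proof. by rewrite tofrac_eq0; apply: contraNneq => ->; rewrite horner0. Qed.

Lemma value_at1_poly (p : {poly K}) : value_at1 (tofrac p) p.[1].
Proof. by exists p, 1; rewrite hornerC oner_neq0 tofrac1 !divr1. Qed.

Lemma value_at1D f g c d : value_at1 f c -> value_at1 g d -> value_at1 (f + g) (c + d).
Proof.
move=> [p [r [r0 -> ->]]] [p' [r' [r'0 -> ->]]].
exists (p * r' + p' * r), (r * r'); rewrite !hornerE mulf_neq0 //.
by rewrite !addf_div ?value_at1_neq0 // tofracD !tofracM.
Qed.

Lemma value_at1M f g c d : value_at1 f c -> value_at1 g d -> value_at1 (f * g) (c * d).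
Proof.
move=> [p [r [r0 -> ->]]] [p' [r' [r'0 -> ->]]].
exists (p * p'), (r * r'); split.
- by rewrite hornerM mulf_neq0.
- by rewrite mulf_div !tofracM.
- by rewrite !hornerM mulf_div.
Qed.

Lemma value_at1V f c : c != 0 -> value_at1 f c -> value_at1 f^-1 c^-1.
Proof.
move=> c0 [p [r [r0 -> cE]]]; exists r, p; split; last by rewrite cE invf_div.
  by apply: contraNneq c0 => p0; rewrite cE p0 mul0r.
by rewrite invf_div.
Qed.

Lemma value_at1_X f c (k : nat) : value_at1 f c -> value_at1 (f ^+ k) (c ^+ k).
Proof.
move=> fc; elim: k => [|k IH]; last by rewrite !exprS; exact: value_at1M.
by have := value_at1_poly 1; rewrite hornerC tofrac1.
Qed.

Lemma value_at1_Xz f c (z : int) : c != 0 -> value_at1 f c -> value_at1 (f ^ z) (c ^ z).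
Proof.
move=> c0 fc; case: z => k; first exact: value_at1_X.
by rewrite NegzE -!exprnN; apply: value_at1V; [exact: expf_neq0|exact: value_at1_X].
Qed.

Lemma value_at1_int (a : int) : value_at1 (a%:~R : F) a%:~R.
Proof.
have e : a%:~R = (a%:~R)%:P :> {poly K} by rewrite rmorph_int.
by have := value_at1_poly (a%:~R : {poly K}); rewrite {2}e hornerC rmorph_int.
Qed.

Lemma value_at1_laurent (I : finType) (x : I -> F) (c : I -> K) (h : laurent int I) :
  (forall i, c i != 0) -> (forall i, value_at1 (x i) (c i)) ->
  value_at1 (laurent_eval intr x h) (laurent_eval intr c h).
Proof.
move=> c0 xc; apply: (big_ind2 (@value_at1 K)).
- exact: value_at1_int 0.
- by move=> *; exact: value_at1D.
- move=> k _; apply: value_at1M; first exact: value_at1_int.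
  apply: (big_ind2 (@value_at1 K)).
  + exact: value_at1_int 1.
  + by move=> *; exact: value_at1M.
  + by move=> i _; exact: value_at1_Xz.
Qed.

(** Used in contrapositive form: an element of K(y) with a nonzero value at y = 1 is nonzero. *)
Lemma value_at1_eq0 c : value_at1 0 c -> c = 0.
Proof.
move=> [p [r [r0 /esym/eqP + ->]]].
rewrite mulf_eq0 invr_eq0 (negPf (value_at1_neq0 r0)) orbF tofrac_eq0 => /eqP ->.
by rewrite horner0 mul0r.
Qed.
End ValueAtOne.

Lemma linear_span_eq0 (F : fieldType) (V : lmodType F) (L : V -> F) k
    (a : F) (c : 'I_k -> F) (x : 'I_k -> V) v :
  (forall b u w, L (b *: u + w) = b * L u + L w) ->
  a != 0 -> a *: v = \sum_i c i *: x i -> (forall i, L (x i) = 0) -> L v = 0.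
Proof.
move=> LL a0 e Lx; have L0 : L 0 = 0.
  have := LL 1 0 0; rewrite scale1r addr0 mul1r.
  by move=> /(congr1 (fun z => z - L 0)); rewrite subrr addrK.
have LZ b u : L (b *: u) = b * L u by rewrite -[b *: u]addr0 LL L0 addr0.
apply: (mulfI a0); rewrite mulr0 -LZ e.
elim/big_ind: _ => // [u w Lu Lw|i _]; last by rewrite LZ Lx mulr0.
by rewrite -[u]scale1r LL Lu Lw mulr0 addr0.
Qed.

Lemma tens1_sum (A B : comNzRingType) (phi : A -> B) (E : algType A) (S : set E)
    k (c : 'I_k -> A) (x : 'I_k -> quot_alg S) :
  tens1 phi (\sum_i c i *: x i) = \sum_i phi (c i) *: tens1 phi (x i).
Proof.
have t0 : tens1 phi (0 : quot_alg S) = 0.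
  by apply: (addrI (tens1 phi (0 : quot_alg S))); rewrite -tens1D !addr0.
rewrite (big_morph _ (@tens1D _ _ phi _ S) t0); apply: eq_bigr => i _.
exact: tens1Z.
Qed.

Section CyclotomicSpan.
Variables (R : realType) (K : fieldType) (iota : {rmorphism K -> R[i]}).
Variables (gT : finGroupType) (W : {group gT}) (n : nat).
Variables (rW : mx_representation K W n) (x0 : Vreg iota rW).
Hypothesis rW_faithful : mx_faithful rW.
Local Notation B := (braid_group x0).
Local Notation ZU := (Zu rW).
Local Notation ZKq := (laurent1 (ZK K)).
Local Notation F := {fraction {poly K}}.
Local Notation H := (quot_alg (hecke_rel x0)).
Local Notation T := (@hecke_T R K iota gT W n rW x0).
Local Notation I := (paramidx rW).
Implicit Types (b : B) (m : multiplicity rW).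

Definition ZK_const : {rmorphism ZK K -> F} :=
  @FracField.tofrac _ \o polyC \o (val : ZK K -> K).

Lemma frac_X_unit k : tofrac 'X ^+ k \is a @GRing.unit F.
Proof. by rewrite unitfE expf_neq0 // tofrac_eq0 polyX_eq0. Qed.

Definition evq : {rmorphism ZKq -> F} :=
  leval ZK_const (fun _ : unit => frac_X_unit (mu_card K)).

Lemma evqE f : eval_q f = evq f. Proof. by []. Qed.

(** At y = 1 every power of q becomes 1, and u_(C, j) goes to zeta^j as for the group algebra. *)
Lemma value_at1_evq m (f : ZU) : value_at1 (evq (cyclo_spec iota m f)) (group_spec iota f).
Proof.
have -> : evq (cyclo_spec iota m f) = laurent_eval intr (evq \o cparam iota m) f.
  apply: rmorph_laurent_eval; first exact: cparam_unit.
  by move=> a; rewrite rmorph_int.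
apply: value_at1_laurent => i.
  by have := zroot_unit iota rW_faithful i; rewrite unitfE.
have -> : val (zeta iota (horder (tag i)) ^+ tagged i) =
    zroot iota i * 1 ^+ mu_card K ^ m (tag i) (tagged i).
  by rewrite expr1n exp1rz mulr1.
have -> : (evq \o cparam iota m) i =
    tofrac (zroot iota i)%:P * (tofrac 'X ^+ mu_card K) ^ m (tag i) (tagged i).
  rewrite /= levalZ; congr (_ * _).
  apply: (etrans (rmorphXz evq _ (lvar_unit _ _))).
  by congr (_ ^ _); exact: leval_lvar.
apply: value_at1M; first by have := value_at1_poly (zroot iota i)%:P; rewrite hornerC.
apply: value_at1_Xz; first by rewrite expr1n oner_neq0.
by apply: value_at1_X; have := value_at1_poly ('X : {poly K}); rewrite hornerX.
Qed.

Variables (t : {scalar H}) (N : nat).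
Hypothesis t_hecke : hecke_form t.
Variables (w_ : 'I_N -> gT) (b_ : 'I_N -> B).
Hypothesis Hfree : free_of_rank (hecke_rel x0) N.
Hypothesis w_inj : injective w_.
Hypothesis b_lift : forall i, path_lift (b_ i) (w_ i).

(* The Gram determinant of the T_(b_i) specializes to 1 at y = 1, so it does not
   vanish in K(y) and the T_(b_i) span. *)
Lemma Kcyclo_linear_eq0 m (L : quot_alg (Kcyclo_rel x0 m) -> F) :
  (forall a h k, L (a *: h + k) = a * L h + L k) ->
  (forall i, L (Kcyclo_of (cyclo_of m (T (b_ i)))) = 0) ->
  forall h, L h = 0.
Proof.
move=> LL Lb.
have Lspec h : L (Kcyclo_of (cyclo_of m h)) = 0.
  pose G := \matrix_(i, j) t (T (b_ i) * T (b_ j)^-1%g).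
  have [c hE] : exists c : 'I_N -> ZU, \det G ^+ 2 *: h = \sum_i c i *: T (b_ i).
    by eexists; exact: (gram_span Hfree t (fun i => T (b_ i)) (fun i => T (b_ i)^-1%g) h).
  have e : eval_q (cyclo_spec iota m (\det G ^+ 2)) *: Kcyclo_of (cyclo_of m h) =
      \sum_i eval_q (cyclo_spec iota m (c i)) *: Kcyclo_of (cyclo_of m (T (b_ i))).
    have := congr1 (fun z => Kcyclo_of (cyclo_of m z)) hE.
    rewrite /Kcyclo_of /cyclo_of tens1_sum tens1_sum tens1Z tens1Z.
    exact.
  apply: (linear_span_eq0 LL _ e Lb); apply/eqP => e0.
  have := value_at1_evq m (\det G ^+ 2); rewrite -evqE e0 => /value_at1_eq0.
  have -> : group_spec iota (\det G ^+ 2) = 1.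
    rewrite (gspecE iota rW_faithful) rmorphXn -det_map_mx.
    have -> : map_mx (gspec iota rW_faithful) G = 1%:M.
      apply/matrixP => i j; rewrite !mxE.
      exact: (gspec_gram rW_faithful t_hecke w_inj b_lift).
    by rewrite det1 expr1n.
  by move/eqP; rewrite oner_eq0.
have Lcyc h : L (Kcyclo_of h) = 0.
  have [k [a [x ->]]] := tens1_span h.
  rewrite /Kcyclo_of tens1_sum.
  apply: (linear_span_eq0 LL (oner_neq0 _) (scale1r _)) => i.
  exact: Lspec.
move=> h; have [k [a [x ->]]] := tens1_span h.
by apply: (linear_span_eq0 LL (oner_neq0 _) (scale1r _)) => i; exact: Lcyc.
Qed.
End CyclotomicSpan.

(** * Characters of split semisimple algebras *)

Section SplitSemisimple.
Variable F : fieldType.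

Section Similarity.
Variable T : Type.

Lemma repr_sim_inv d1 d2 (P : 'M[F]_(d1, d2)) : row_free P -> row_full P ->
  exists2 Q, P *m Q = 1%:M & Q *m P = 1%:M.
Proof. by exists (pinvmx P); [exact: mulmxVp|exact: mulVpmx]. Qed.

Lemma inv_repr_sim d1 d2 (r1 : T -> 'M[F]_d1) (r2 : T -> 'M[F]_d2)
    (P : 'M[F]_(d1, d2)) Q : P *m Q = 1%:M -> Q *m P = 1%:M ->
  (forall h, r1 h *m P = P *m r2 h) -> repr_sim r1 r2.
Proof.
move=> PQ QP rP; exists P; split=> //; first by apply/row_freeP; exists Q.
by apply/row_fullP; exists Q.
Qed.

Lemma repr_sim_sym d1 d2 (r1 : T -> 'M[F]_d1) (r2 : T -> 'M[F]_d2) :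
  repr_sim r1 r2 -> repr_sim r2 r1.
Proof.
move=> [P [Pf Pl rP]]; have [Q PQ QP] := repr_sim_inv Pf Pl.
apply: (inv_repr_sim QP PQ) => h.
by rewrite -[r1 h]mulmx1 -PQ (mulmxA (r1 h)) rP !mulmxA QP mul1mx.
Qed.

Lemma repr_sim_trans d1 d2 d3 (r1 : T -> 'M[F]_d1) (r2 : T -> 'M[F]_d2)
    (r3 : T -> 'M[F]_d3) : repr_sim r1 r2 -> repr_sim r2 r3 -> repr_sim r1 r3.
Proof.
move=> [P [Pf Pl rP]] [P' [Pf' Pl' rP']].
have [Q PQ QP] := repr_sim_inv Pf Pl; have [Q' PQ' QP'] := repr_sim_inv Pf' Pl'.
apply: (@inv_repr_sim _ _ _ _ (P *m P') (Q' *m Q)).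
- by rewrite mulmxA -(mulmxA P) PQ' mulmx1.
- by rewrite mulmxA -(mulmxA Q') QP mulmx1.
- by move=> h; rewrite mulmxA rP -!mulmxA rP'.
Qed.

Lemma repr_sim_trace d1 d2 (r1 : T -> 'M[F]_d1) (r2 : T -> 'M[F]_d2) h :
  repr_sim r1 r2 -> \tr (r1 h) = \tr (r2 h).
Proof.
move=> [P [Pf Pl rP]]; have [Q PQ QP] := repr_sim_inv Pf Pl.
by rewrite -[r1 h]mulmx1 -PQ mulmxA rP -mulmxA mxtrace_mulC -mulmxA QP mulmx1.
Qed.

End Similarity.

Variables (E : algType F) (S : set E).
Local Notation H := (quot_alg S).

Section Separation.
Variables (k : nat) (d : 'I_k -> nat) (r : forall i, H -> 'M[F]_(d i)).
Hypothesis r_repr : forall i, alg_repr (r i).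
Hypothesis r_bij : forall M : forall i, 'M[F]_(d i), exists! h, forall i, r i h = M i.

Lemma joint_inj h h' : (forall i, r i h = r i h') -> h = h'.
Proof.
move=> e; have [h0 [_ U]] := r_bij (fun i => r i h').
by rewrite -(U h) // -(U h').
Qed.

(* A row of a nonzero rho (E_aa), moved around by the rho (E_ab), spans a copy of
   the i-th simple module. *)
Lemma irr_component d' (rho : H -> 'M[F]_d') : alg_irr rho ->
  exists i, repr_sim (r i) rho.
Proof.
move=> [[rhoL rhoM rho1] d'0 rho_irr].
have rho0 : rho 0 = 0 by exact: (semilinear0 (tau := id) rhoL).
have rZ i a h : r i (a *: h) = a *: r i h.
  by have [rL _ _] := r_repr i; exact: (semilinearZ (tau := id) rL).
have r0 i : r i 0 = 0.
  by have [rL _ _] := r_repr i; exact: (semilinear0 (tau := id) rL).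
have rD i h h' : r i (h + h') = r i h + r i h'.
  by have [rL _ _] := r_repr i; rewrite -[h]scale1r rL !scale1r.
have rhoD h h' : rho (h + h') = rho h + rho h'.
  by rewrite -[h]scale1r rhoL !scale1r.
have rhoZ a h : rho (a *: h) = a *: rho h.
  by exact: (semilinearZ (tau := id) rhoL).
have rS i I (s : seq I) (G : I -> H) : r i (\sum_(j <- s) G j) = \sum_(j <- s) r i (G j).
  exact: (big_morph _ (rD i) (r0 i)).
have rhoS I (s : seq I) (G : I -> H) : rho (\sum_(j <- s) G j) = \sum_(j <- s) rho (G j).
  exact: (big_morph _ rhoD rho0).
(* Matrix units of the simple factors; the indices are naturals so that triples form a single type
   for all sizes [d i]. *)
pose M (u : 'I_k * nat * nat) j : 'M[F]_(d j) :=
  \matrix_(x, y) [&& j == u.1.1, x == u.1.2 :> nat & y == u.2 :> nat]%:R.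
have [eu euP] : {eu : 'I_k * nat * nat -> H & forall u j, r j (eu u) = M u j}.
  apply/cid; suff /choice[eu euP] : forall u, exists h, forall j, r j h = M u j by exists eu.
  by move=> u; have [h [hP _]] := r_bij (M u); exists h.
have eu_mul i (a : 'I_(d i)) b h :
    eu (i, val a, val b) * h = \sum_(c < d i) r i h b c *: eu (i, val a, val c).
  apply: joint_inj => j; rewrite rS; under eq_bigr do rewrite rZ euP.
  have [_ rM _] := r_repr j; rewrite rM euP; apply/matrixP => x y.
  rewrite summxE mxE; under eq_bigr do rewrite mxE; under [RHS]eq_bigr do rewrite !mxE.
  case: (eqVneq j i) => [ji|ji] /=; last first.
    by rewrite !big1 // => c _; rewrite ?mul0r ?mulr0.
  subst j; rewrite (bigD1 b) //= eqxx andbT [in LHS]big1 => [|c cb]; last first.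
    by rewrite -(inj_eq val_inj) in cb; rewrite (negPf cb) andbF mul0r.
  rewrite (bigD1 y) //= eqxx andbT [in RHS]big1 => [|c cy].
    by rewrite !addr0 mulrC.
  by rewrite eq_sym -(inj_eq val_inj) in cy; rewrite (negPf cy) andbF mulr0.
have one_sum : 1 = \sum_i \sum_(a < d i) eu (i, val a, val a).
  apply: joint_inj => j; rewrite rS; have [_ _ ->] := r_repr j.
  under eq_bigr do rewrite rS; apply/matrixP => x y; rewrite summxE (bigD1 j) //=.
  rewrite [X in _ + X]big1 ?addr0 => [|i ij]; last first.
    rewrite summxE big1 // => a _; rewrite euP mxE /= eq_sym (negPf ij).
    by [].
  rewrite summxE (bigD1 x) //= euP !mxE !eqxx /= [X in _ + X]big1 ?addr0.
    by rewrite eq_sym.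
  move=> a ax; rewrite euP mxE -(inj_eq val_inj) eq_sym in ax *.
  by rewrite eqxx /= eq_sym in ax *; rewrite (negPf ax).
(* 1 is the sum of the diagonal matrix units and rho 1 is nonzero, so one of them has a nonzero
   image. *)
have [i [a rho_a]] : exists i, exists a : 'I_(d i), rho (eu (i, val a, val a)) != 0.
  apply: contrapT => no; case/eqP: (oner_neq0 F).
  have : rho 1 = 0.
    rewrite one_sum rhoS big1 // => i _; rewrite rhoS big1 // => a _.
    by apply/eqP/negPn/negP => e; apply: no; exists i, a.
  by rewrite rho1 => /matrixP/(_ (Ordinal d'0) (Ordinal d'0)); rewrite !mxE eqxx.
exists i; have [v v0] : exists v, row v (rho (eu (i, val a, val a))) != 0.
  apply/existsP; move: rho_a; apply: contraR => /existsPn h.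
  by apply/eqP/row_matrixP => v; rewrite row0; exact/eqP/negPn/h.
pose u := row v (rho (eu (i, val a, val a))).
pose P := \matrix_(b < d i) (u *m rho (eu (i, val a, val b))).
have rP h : r i h *m P = P *m rho h.
  apply/row_matrixP => b; rewrite !row_mul rowK -mulmxA -rhoM eu_mul rhoS mulmx_sumr.
  rewrite mulmx_sum_row; apply: eq_bigr => c _.
  by rewrite rhoZ -scalemxAr rowK mxE.
have Pa : row a P = u.
  rewrite rowK /u -row_mul -rhoM eu_mul rhoS (bigD1 a) //= big1 ?addr0 => [|c ca].
    by rewrite euP mxE !eqxx scale1r.
  have -> : r i (eu (i, val a, val a)) a c = 0.
    by rewrite euP mxE /= (inj_eq val_inj c a) (negPf ca) !andbF.
  by rewrite scale0r rho0.
have P0 : P != 0 by apply: contraNneq v0 => P0; rewrite -/u -Pa P0 row0.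
exists P; split=> //.
- apply/row_freeP; exists (pinvmx P).
  have kP : kermx P = 0.
    apply/row_matrixP => z; rewrite row0; set x := row z _.
    have xP : x *m P = 0 by rewrite -row_mul mulmx_ker row0.
    clearbody x.
    (* If x P = 0 with x_b nonzero, then x E_ba P is x_b u, since E_ba carries x to x_b times the
       a-th basis row; but it is also x P rho(E_ba) = 0. *)
    apply/rowP => b; rewrite [RHS]mxE; apply/eqP/negPn/negP => xb; case/eqP: v0.
    rewrite -/u -Pa -[row a P]scale1r -(mulVf xb) -scalerA.
    have -> : x 0 b *: row a P = x *m r i (eu (i, val b, val a)) *m P.
      rewrite rowE scalemxAl; congr (_ *m P); apply/rowP => c; rewrite !mxE.
      rewrite (bigD1 b) //= euP mxE !eqxx /= big1 ?addr0 => [|z' zb].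
        by rewrite (inj_eq val_inj c a).
      by rewrite mxE /= (inj_eq val_inj z' b) (negPf zb) andbF mulr0.
    by rewrite -mulmxA rP mulmxA xP mul0mx scaler0.
  by apply: mulmxVp; rewrite -kermx_eq0 kP.
(* [alg_irr] tests square matrices, hence the square matrix with the row space of [P]; that space is
   stable because [P] intertwines. *)
- have : row_full <<P>>%MS.
    apply: rho_irr; last by rewrite -mxrank_eq0 mxrank_gen mxrank_eq0.
    by move=> h; rewrite (eqmxMr _ (genmxE P)) genmxE -rP submxMl.
  by rewrite /row_full mxrank_gen.
Qed.

(* The witness is the matrix unit E_00 of the simple factor afforded by rho. *)
Lemma irr_separate d' (rho : H -> 'M[F]_d') : alg_irr rho -> exists h,
  \tr (rho h) = 1 /\ forall d1 (rho1 : H -> 'M[F]_d1), alg_irr rho1 ->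
    ~ repr_sim rho1 rho -> \tr (rho1 h) = 0.
Proof.
move=> rhoI; have [i ri] := irr_component rhoI.
have [_ d'0 _] := rhoI.
have di : (0 < d i)%N.
  have [P [_ /eqP Pl _]] := ri; apply: leq_trans d'0 _.
  by rewrite -Pl; exact: rank_leq_row.
have [h [hP _]] := r_bij (fun j => \matrix_(x, y) [&& j == i, x == 0 :> nat & y == 0 :> nat]%:R).
exists h; split.
  rewrite -(repr_sim_trace h ri) hP /mxtrace (bigD1 (Ordinal di)) //= mxE !eqxx big1 ?addr0 //.
  by move=> x x0; rewrite mxE -[val x == _]/(x == Ordinal di) (negPf x0) andbF.
move=> d1 rho1 rhoI1 nsim; have [j rj] := irr_component rhoI1.
rewrite -(repr_sim_trace h rj) hP /mxtrace big1 // => x _; rewrite mxE.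
case: eqVneq => // ji; case: nsim; rewrite ji in rj.
exact: repr_sim_trans (repr_sim_sym rj) ri.
Qed.
End Separation.
End SplitSemisimple.

(** A power of X turns the value of a Laurent polynomial into a polynomial with the same
    coefficients. *)
Lemma eval_y_inj (K : fieldType) : injective (@eval_y K).
Proof.
pose x : {fraction {poly K}} := tofrac 'X.
have xU (i : unit) : x \is a GRing.unit by rewrite unitfE tofrac_eq0 polyX_eq0.
pose ev : {rmorphism laurent1 (ZK K) -> {fraction {poly K}}} := leval (@ZK_const K) xU.
have ev0 f : ev f = 0 -> f = 0.
  pose e (k : expo unit) := (k : {ffun unit -> int}) tt.
  (* A crude bound of all the |e k|, making every e k + N nonnegative. *)
  move=> f0; pose N := (\sum_(k <- msupp f) `|e k|)%N.
  pose deg k := absz (e k + N%:Z).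
  have degE k : k \in msupp f -> e k + N%:Z = deg k.
    move=> kf; rewrite /deg gez0_abs // /N (bigD1_seq k) ?fset_uniq //=.
    by move: (e k) (\sum_(_ <- _ | _) _)%N => y z; lia.
  pose P : {poly K} := \sum_(k <- msupp f) (val f@_k)%:P * 'X^(deg k).
  have P0 : P = 0.
    apply/eqP; rewrite -tofrac_eq0; apply/eqP.
    rewrite -[RHS](mul0r (x ^+ N)) -f0 /P rmorph_sum mulr_suml.
    apply: eq_big_seq => k kf; rewrite -mulrA rmorphM /=; congr (_ * _).
    rewrite (big_pred1 tt) => [|[]] //.
    rewrite rmorphXn exprnP -degE // exprzDr //.
    exact: (xU tt).
  apply/malgP => k; rewrite mcoeff0; apply/eqP/negPn/negP; rewrite mcoeff_neq0 => kf.
  have /(congr1 (fun p : {poly K} => p`_(deg k))) := P0.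
  rewrite coef0 coef_sum (bigD1_seq k) ?fset_uniq //= coefCM coefXn eqxx mulr1 big1_seq ?addr0.
    by move=> fk; move: kf; rewrite -mcoeff_neq0 => /eqP; apply; apply: val_inj.
  move=> l /andP[lk lf]; rewrite coefCM coefXn; case: eqP => [dkl|_]; rewrite ?mulr0 //.
  case/eqP: lk; apply/ffunP => -[].
  by have := degE k kf; rewrite dkl -degE // => /addIr.
move=> f g fg; apply/eqP; rewrite -subr_eq0; apply/eqP/ev0.
by rewrite rmorphB -[ev f]/(eval_y f) fg subrr.
Qed.

(** * Comparison of two trace forms through a surjective morphism *)

Section Comparison.
Variable F : fieldType.

Lemma repr_sim_tens1 (A : comNzRingType) (phi : A -> F) (E : algType A) (S : set E)
    d1 d2 (r1 : scalar_ext phi S -> 'M[F]_d1) (r2 : scalar_ext phi S -> 'M[F]_d2) :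
  alg_repr r1 -> alg_repr r2 ->
  repr_sim (fun h => r1 (tens1 phi h)) (fun h => r2 (tens1 phi h)) -> repr_sim r1 r2.
Proof.
move=> [r1L _ _] [r2L _ _] [P [Pf Pl rP]]; exists P; split=> // h.
have r1S := semilinear_sum (tau := id) r1L erefl.
have r2S := semilinear_sum (tau := id) r2L erefl.
have [k [a [x ->]]] := tens1_span h; rewrite r1S r2S mulmx_suml mulmx_sumr.
by apply: eq_bigr => i _; rewrite -scalemxAl -scalemxAr rP.
Qed.

Variables (E : algType F) (S : set E) (E' : algType F) (S' : set E').
Variable G : quot_alg S -> quot_alg S'.
Hypothesis G_morph : alg_morphism G.
Hypothesis G_surj : forall h', exists h, G h = h'.

Lemma alg_irr_comp d (r : quot_alg S' -> 'M[F]_d) : alg_irr r -> alg_irr (r \o G).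
Proof.
have [GL GM G1] := G_morph; move=> [[rL rM r1] d0 rI]; split=> //.
  split=> [a h k|h k|] /=; first by rewrite GL rL.
    by rewrite GM rM.
  by rewrite G1 r1.
move=> U UG U0; apply: rI => // h'.
by have [h <-] := G_surj h'; exact: UG.
Qed.

(** Evaluate the identity at an element separating [r l] from the other irreducible representations:
    only the terms [l] and [l'] survive, since surjectivity of [G] keeps the [r' i \o G] irreducible
    and pairwise inequivalent. *)
Lemma irr_coef_eq (L : finType) (d : L -> nat) (r : forall l, quot_alg S -> 'M[F]_(d l))
    (r' : forall l, quot_alg S' -> 'M[F]_(d l)) (a a' : L -> F) l l' :
  split_semisimple S -> (forall i, alg_irr (r i)) -> (forall i, alg_irr (r' i)) ->
  (forall i j, repr_sim (r i) (r j) -> i = j) ->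
  (forall i j, repr_sim (r' i) (r' j) -> i = j) ->
  (forall h, \sum_i a i * \tr (r i h) = \sum_i a' i * \tr (r' i (G h))) ->
  repr_sim (r' l' \o G) (r l) -> a l = a' l'.
Proof.
move=> [k [ds [rs [rsP rsB]]]] rI r'I rS r'S aa' sim.
have [h [h1 h0]] := irr_separate (fun i => (rsP i).2) rsB (rI l).
have := aa' h; rewrite (bigD1 l) //= h1 mulr1 big1 ?addr0 => [|i il]; last first.
  by rewrite (h0 _ _ (rI i)) ?mulr0 // => /rS e; rewrite e eqxx in il.
move=> ->; rewrite (bigD1 l') //= [\tr _](repr_sim_trace h sim) h1 mulr1.
rewrite big1 ?addr0 // => i il.
rewrite [\tr _](h0 _ _ (alg_irr_comp (r'I i))) ?mulr0 // => sim'.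
have [P [Pf Pl rP]] := repr_sim_trans sim' (repr_sim_sym sim).
case/eqP: il; apply: r'S; exists P; split=> // h'.
by have [h2 <-] := G_surj h'; exact: rP.
Qed.
End Comparison.

Lemma trace_form_linear (F : fieldType) (E : algType F) (S : set E) (L : finType)
    (d : L -> nat) (r : forall l, quot_alg S -> 'M[F]_(d l)) (a : L -> F) :
  (forall l, alg_repr (r l)) -> forall c h k,
  \sum_l a l * \tr (r l (c *: h + k)) =
    c * (\sum_l a l * \tr (r l h)) + \sum_l a l * \tr (r l k).
Proof.
move=> rR c h k; rewrite mulr_sumr -big_split; apply: eq_bigr => l _.
have [rL _ _] := rR l; rewrite rL linearP mulrDr; congr (_ + _).
exact: mulrCA.
Qed.

Lemma scalar_ext_functor (A B : comNzRingType) (phi : A -> B)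
    (E E' : algType A) (S : set E) (S' : set E') (G : quot_alg S -> quot_alg S') :
  alg_morphism G -> bijective G ->
  exists GB : scalar_ext phi S -> scalar_ext phi S',
    [/\ alg_morphism GB, forall h, GB (tens1 phi h) = tens1 phi (G h) &
        forall h', exists h, GB h = h'].
Proof.
move=> [GL GM G1] [G' _ GK'].
have GZ a h : G (a *: h) = a *: G h by exact: (semilinearZ (tau := id) GL).
have GD h k : G (h + k) = G h + G k by rewrite -[h]scale1r GL !scale1r.
have [GB [GBm GBE]] : exists GB : scalar_ext phi S -> scalar_ext phi S',
    alg_morphism GB /\ forall h, GB (tens1 phi h) = tens1 phi (G h).
  apply: scalar_ext_lift.
  - by move=> h k; rewrite GD tens1D.
  - by move=> a h; rewrite GZ tens1Z.
  - by move=> h k; rewrite GM tens1M.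
  - by rewrite G1 tens11.
exists GB; split=> // h'; have [k [a [x ->]]] := tens1_span h'.
have [GBL _ _] := GBm.
exists (\sum_i a i *: tens1 phi (G' (x i))).
rewrite (semilinear_sum (tau := id) GBL erefl); apply: eq_bigr => i _.
by rewrite GBE GK'.
Qed.

Theorem proposition2p5
  (R : realType) (K : splittingFieldType rat) (iota : {rmorphism K -> R[i]})
  (gT : finGroupType) (W : {group gT}) (n : nat)
  (rW : mx_representation K W n) (x0 : Vreg iota rW)
  (hgal : galois 1 {:K}) (habel : abelian 'Gal({:K} / 1))
  (hfaith : mx_faithful rW) (hirr : mx_irreducible rW)
  (hrefl : W :=: <<[set w in W | is_refl rW w]>>%g)
  (hfree : free_of_rank (hecke_rel x0) #|W|)
  (t : {scalar quot_alg (hecke_rel x0)}) (ht : hecke_form t)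
  (htuniq : forall t' : {scalar quot_alg (hecke_rel x0)},
     hecke_form t' -> t' =1 t)
  (hsplit : forall m : multiplicity rW, split_semisimple (Kcyclo_rel x0 m))
  (Lambda : finType) (d : Lambda -> nat)
  (rho : forall l, mx_representation K W (d l)) (hrho : irr_labelling rho)
  (rhom : forall (m : multiplicity rW) (l : Lambda),
     quot_alg (Kcyclo_rel x0 m) -> 'M[{fraction {poly K}}]_(d l))
  (hrhom : forall m, tits_labelling rho (rhom m))
  (tm : forall m : multiplicity rW, {scalar quot_alg (cyclo_rel x0 m)})
  (htm : forall m h, tm m (cyclo_of m h) = cyclo_spec iota m (t h))
  (s : multiplicity rW -> Lambda -> laurent1 (ZK K))
  (hs : forall m, schur_elements (tm m) (rhom m) (s m))
  (m : multiplicity rW) (g : cyclic_prod rW) (l lg : Lambda)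
  (Gamma : quot_alg (cyclo_rel x0 m) -> quot_alg (cyclo_rel x0 (cyclic_act g m)))
  (hGamma : is_Gamma Gamma)
  (hlg : repr_sim
     (fun h => rhom (cyclic_act g m) l (Kcyclo_of (Gamma h)))
     (fun h => rhom m lg (Kcyclo_of h))) :
  s m lg = s (cyclic_act g m) l /\
  afun (s m lg) = afun (s (cyclic_act g m) l).
Proof.
(* The rank is written as a successor so that the matrices of the regular representation form a
   nonzero ring. *)
have [r rE] : exists r, #|W| = r.+1 by exists #|W|.-1; rewrite prednK // cardG_gt0.
have free' : free_of_rank (hecke_rel x0) r.+1 by rewrite -rE.
have [D DP] := choice (fun C => hecke_degree hfaith C free').
have DM C b b' := (DP C).1 b b'.
have Dm C C' b := (DP C).2 C' b.
pose w_ (i : 'I_r.+1) : gT := enum_val (cast_ord (esym rE) i).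
have w_inj : injective w_ by move=> i j /enum_val_inj/cast_ord_inj.
(* Each lift is kept together with a factorization into monodromy generators, on which alone the
   values of [Gamma] are prescribed. *)
have /choice[b_ b_P] : forall i, exists b : braid_group x0,
    (exists k (Cl : 'I_k -> horbit rW) (c : 'I_k -> braid_group x0),
      (forall j, monodromy x0 (Cl j) (c j)) /\ b = (\prod_j c j)%g) /\
    path_lift b (w_ i).
  move=> i; have [k [Cl [c [cm lc]]]] :=
    monodromy_gen hfaith x0 hrefl (enum_valP (cast_ord (esym rE) i)).
  by exists (\prod_j c j)%g; split=> //; exists k, Cl, c.
have b_lift i := (b_P i).2.
set gm := cyclic_act g m in Gamma hGamma hlg *.
have tGamma i : tm gm (Gamma (cyclo_of m (hecke_T (b_ i)))) = tm m (cyclo_of m (hecke_T (b_ i))).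
  have [k [Cl [c [cm ->]]]] := (b_P i).1.
  exact: (cyclo_trace_Gamma hfaith ht htuniq (ltn0Sn r) DM Dm free' w_inj b_lift
    hGamma htm cm).
have [Gm Gb _] := hGamma.
have [GK [GKm GKE GKs]] := scalar_ext_functor (@eval_q K) Gm Gb.
have rI m' l' := let: And4 h _ _ _ := hrhom m' in h l'.
have rS m' l1 l2 := let: And4 _ h _ _ := hrhom m' in h l1 l2.
have rR m' l' := let: And3 h _ _ := rI m' l' in h.
have rRG l' := let: And3 h _ _ := alg_irr_comp GKm GKs (rI gm l') in h.
(* The difference is a linear form on K(y)H_m, and on the T_(b_i) its two terms are the images in
   K(y) of the values compared in [tGamma]. *)
have forms h : \sum_l (eval_y (s m l))^-1 * \tr (rhom m l h) =
    \sum_l (eval_y (s gm l))^-1 * \tr (rhom gm l (GK h)).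
  apply/eqP; rewrite -subr_eq0; apply/eqP; move: h.
  apply: (Kcyclo_linear_eq0 hfaith ht free' w_inj b_lift) => [a h k|i].
    rewrite (trace_form_linear _ (rR m)) (trace_form_linear _ rRG) opprD addrACA -mulrBr.
    by [].
  apply/eqP; rewrite subr_eq0; apply/eqP.
  apply: (etrans (esym ((hs m).2 (cyclo_of m (hecke_T (b_ i)))))).
  apply: (etrans (congr1 (@eval_q K) (esym (tGamma i)))).
  apply: (etrans ((hs gm).2 (Gamma (cyclo_of m (hecke_T (b_ i)))))).
  apply: eq_bigr => j _.
  exact: (congr1 (fun z => (eval_y (s gm j))^-1 * \tr (rhom gm j z)) (esym (GKE _))).
have sim : repr_sim (rhom gm l \o GK) (rhom m lg).
  apply: repr_sim_tens1; [exact: rRG|exact: rR|].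
  have [P [Pf Pl rP]] := hlg; exists P; split=> // h.
  by rewrite /= GKE; exact: rP.
have sE : s m lg = s gm l.
  apply: eval_y_inj; apply: invr_inj.
  exact: (irr_coef_eq GKm GKs (hsplit m) (rI m) (rI gm) (rS m) (rS gm) forms sim).
by split=> //; rewrite sE.
Qed.
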